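(* Assume that $\alpha_0>0$ and $\beta_0>\beta_{\min}(\alpha_0,\Omega)$. Define $$\omega_*=\omega_*(\alpha_0,\beta_0,\Omega)=\inf\{\omega>0:\ \omega\text{ is an eigenvalue of (P) for a certain }\{\varepsilon,\mu\}\in L^\infty(\Omega,\mathbb M^{\mathrm{sym}}_{\alpha_0,\beta_0})^2\},$$ where (P) is the overdetermined eigenproblem $$\mathrm i\nabla\times\mathbf H=\omega\varepsilon\mathbf E,\qquad-\mathrm i\nabla\times\mathbf E=\omega\mu\mathbf H,\qquad0=\mathbf n\times\mathbf E,\qquad0=\mathbf H_{\tan}.$$ Then $\omega_*>0$, and there exists $\{\varepsilon,\mu\}\in L^\infty(\Omega,\mathbb M^{\mathrm{sym}}_{\alpha_0,\beta_0})^2$ such that $\omega_*$ is an eigenvalue of (P).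
   Context: $\Omega\subset\mathbb R^3$ is a fixed Lipschitz domain, i.e. a nonempty bounded open connected set with Lipschitz continuous boundary $\partial\Omega$; $\mathbf n$ is the exterior unit normal. For $0<\alpha\le\beta$, $\mathbb M^{\mathrm{sym}}_{\alpha,\beta}$ is the set of real symmetric $3\times3$ matrices $A$ with $\alpha|y|^2\le\langle Ay,y\rangle\le\beta|y|^2$ for all $y\in\mathbb R^3$, and $L^\infty(\Omega,\mathbb M^{\mathrm{sym}}_{\alpha,\beta})$ is the set of $L^\infty$ matrix-functions on $\Omega$ with values a.e. in $\mathbb M^{\mathrm{sym}}_{\alpha,\beta}$. $H(\mathbf{curl},\Omega)=\{\mathbf u\in L^2(\Omega,\mathbb C^3):\nabla\times\mathbf u\in L^2(\Omega,\mathbb C^3)\}$, and $H_0(\mathbf{curl},\Omega)$ is the closure of $C_0^\infty(\Omega,\mathbb C^3)$ in it. The traces $\mathbf n\times\mathbf u$ and $\mathbf u_{\tan}=(\mathbf n\times\mathbf u)\times\mathbf n$ of $\mathbf u\in H(\mathbf{curl},\Omega)$ are understood as the continuous extensions from smooth fields to $H(\mathbf{curl},\Omega)\to H^{-1/2}(\partial\Omega,\mathbb C^3)$. For given $\varepsilon,\mu$, a number $\omega\in\mathbb C$ is an eigenvalue of (P) if (P) has a solution $\{\mathbf E,\mathbf H\}\neq0$ in $H(\mathbf{curl},\Omega)^2$ (equivalently, in $H_0(\mathbf{curl},\Omega)^2$); i.e. $\omega$ is an eigenvalue of the symmetric Maxwell operator $\{\mathbf E,\mathbf H\}\mapsto\{\mathrm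 i\varepsilon^{-1}\nabla\times\mathbf H,-\mathrm i\mu^{-1}\nabla\times\mathbf E\}$ with domain $H_0(\mathbf{curl},\Omega)^2$. $\beta_{\min}(\alpha,\Omega)$ is the infimum of all $\beta>\alpha$ such that for certain $\varepsilon,\mu\in L^\infty(\Omega,\mathbb M^{\mathrm{sym}}_{\alpha,\beta})$ the eigenproblem (P) has at least one nonzero real eigenvalue. *)

(* Defs.v *)
(* MathComp-Analysis *)
From HB Require Import structures.
From mathcomp Require Import all_boot all_order all_algebra.
From mathcomp Require Import all_classical all_reals all_analysis.
From mathcomp Require Import complex.

Set Implicit Arguments.
Unset Strict Implicit.
Unset Printing Implicit Defensive.

Import Order.TTheory GRing.Theory Num.Theory.
Import numFieldNormedType.Exports.

Local Open Scope classical_set_scope.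
Local Open Scope ring_scope.
Local Open Scope complex_scope.

(* [measurableTypeR R] is [R] with the Borel sigma-algebra that
   [lebesgue_measure] uses; the norm of [R] is found on it as well. *)
Notation R3 R := (measurableTypeR R * measurableTypeR R * measurableTypeR R)%type.

Definition leb3 (R : realType) : {measure set (R3 R) -> \bar R} :=
  (@lebesgue_measure R \x @lebesgue_measure R \x @lebesgue_measure R)%E.

Definition vec (R : realType) (x : R3 R) : 'cV[R]_3 :=
  \col_i [tuple x.1.1; x.1.2; x.2]`_i.

Definition pt (R : realType) (v : 'cV[R]_3) : R3 R :=
  (v 0 0, v 1 0, v 2%:R 0).

(* In a neighbourhood of each boundary point, and in suitable orthonormal
   coordinates (y1, y2, y3) centred at that point, [Omega] is the part of the
   box |y1|, |y2| < r, |y3| < h that lies below the graph of a Lipschitz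
   function, and the boundary is the graph. *)
Definition lipschitz_boundary (R : realType) (Omega : set (R3 R)) : Prop :=
  forall p : R3 R, (closure Omega `\` Omega^°) p ->
  exists (Q : 'M[R]_3) (r h : R) (g : R * R -> R),
    [/\ Q^T *m Q = 1%:M, 0 < r, 0 < h,
        [lipschitz g z | z in [set: R * R]] &
        forall y : R3 R, `|y.1.1| < r -> `|y.1.2| < r -> `|y.2| < h ->
          let q := pt (vec p + Q *m vec y) in
          [/\ `|g y.1| < h,
              Omega q <-> y.2 < g y.1 &
              (closure Omega `\` Omega^°) q <-> y.2 = g y.1]].

Definition lipschitz_domain (R : realType) (Omega : set (R3 R)) : Prop :=
  [/\ Omega !=set0, bounded_set Omega, open Omega, connected Omega &
      lipschitz_boundary Omega].

Definition Msym (R : realType) (a b : R) : set 'M[R]_3 :=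
  [set A : 'M[R]_3 | A^T = A /\
    forall y : 'cV[R]_3,
      a * (\sum_i y i 0 ^+ 2) <= (y^T *m (A *m y)) 0 0 <= b * (\sum_i y i 0 ^+ 2)].

Definition Linfty_Msym (R : realType) (Omega : set (R3 R)) (a b : R) :
    set (R3 R -> 'M[R]_3) :=
  [set A : R3 R -> 'M[R]_3 | [/\ forall i j, measurable_fun Omega (fun x => A x i j : R),
      exists C : R, {ae leb3 R, forall x, Omega x ->
        forall i j, `|A x i j| <= C} &
      {ae leb3 R, forall x, Omega x -> Msym a b (A x)}]].

(* Fields in [Omega] are functions on the whole space of which only the values
   in [Omega] matter, up to [leb3]-negligible sets. Measurability is Borel
   measurability: every Lebesgue measurable class has a Borel representative. *)

Notation vfield R := (R3 R -> 'cV[R[i]]_3).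

Definition normsq (R : realType) (v : 'cV[R[i]]_3) : R :=
  \sum_i (complex.Re (v i 0) ^+ 2 + complex.Im (v i 0) ^+ 2).

Definition L2normsq (R : realType) (Omega : set (R3 R)) (u : vfield R) : \bar R :=
  (\int[leb3 R]_(x in Omega) (normsq (u x))%:E)%E.

Definition L2 (R : realType) (Omega : set (R3 R)) : set (vfield R) :=
  [set u : vfield R | (forall i, measurable_fun Omega (fun x => complex.Re (u x i 0) : R) /\
                      measurable_fun Omega (fun x => complex.Im (u x i 0) : R)) /\
           (L2normsq Omega u < +oo)%E].

Definition integralC (R : realType) (Omega : set (R3 R)) (f : R3 R -> R[i]) :
    R[i] :=
  Rintegral (leb3 R) Omega (fun x => complex.Re (f x)) +i*
  Rintegral (leb3 R) Omega (fun x => complex.Im (f x)).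

Definition unit3 (R : realType) (k : 'I_3) : R3 R :=
  pt (delta_mx k 0).

Definition partial (R : realType) (k : 'I_3) (f : R3 R -> R) : R3 R -> R :=
  fun x => 'D_(unit3 R k) f x.

(* Partial derivatives of all orders, in any sequence of directions, exist and
   are continuous. *)
Definition smooth (R : realType) (f : R3 R -> R) : Prop :=
  forall s : seq 'I_3,
    let g := foldr (@partial R) f s in
    continuous g /\ forall (x : R3 R) k, derivable g x (unit3 R k).

Definition Cc_infty (R : realType) (Omega : set (R3 R)) : set (vfield R) :=
  [set phi : vfield R | (forall i, smooth (fun x => complex.Re (phi x i 0)) /\
                        smooth (fun x => complex.Im (phi x i 0))) /\
     exists K : set (R3 R), [/\ compact K, K `<=` Omega &
       forall x, ~ K x -> phi x = 0]].

Definition partialC (R : realType) (k : 'I_3) (f : R3 R -> R[i]) : R3 R -> R[i] :=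
  fun x => partial k (fun z => complex.Re (f z)) x +i*
           partial k (fun z => complex.Im (f z)) x.

(* Indices are taken modulo 3, so that component [i] is
   d_(i+1) u_(i+2) - d_(i+2) u_(i+1). *)
Definition curl (R : realType) (u : vfield R) : vfield R :=
  fun x => \col_(i < 3)
    (partialC (i + 1) (fun z => u z (i + 2%:R) 0) x -
     partialC (i + 2%:R) (fun z => u z (i + 1) 0) x).

(* [v] is the distributional curl of [u] in [Omega]. *)
Definition weak_curl (R : realType) (Omega : set (R3 R)) (u v : vfield R) : Prop :=
  forall phi, Cc_infty Omega phi ->
    integralC Omega (fun x => ((u x)^T *m curl phi x) 0 0) =
    integralC Omega (fun x => ((v x)^T *m phi x) 0 0).

Definition Hcurl (R : realType) (Omega : set (R3 R)) : set (vfield R) :=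
  [set u : vfield R | L2 Omega u /\ exists2 v, L2 Omega v & weak_curl Omega u v].

(* Closure of [Cc_infty Omega] in [Hcurl Omega] for the graph norm. *)
Definition H0curl (R : realType) (Omega : set (R3 R)) : set (vfield R) :=
  [set u : vfield R | Hcurl Omega u /\
    forall v, L2 Omega v -> weak_curl Omega u v ->
    forall e : R, 0 < e -> exists2 phi, Cc_infty Omega phi &
      (L2normsq Omega (fun x => u x - phi x)%R
       + L2normsq Omega (fun x => v x - curl phi x)%R < e%:E)%E].

Definition act (R : realType) (A : 'M[R]_3) (v : 'cV[R[i]]_3) : 'cV[R[i]]_3 :=
  map_mx (real_complex R) A *m v.

(* [w] is an eigenvalue of the symmetric Maxwell operator
     (E, H) |-> (i eps^-1 curl H, - i mu^-1 curl E)
   on [H0curl Omega] x [H0curl Omega]. The boundary conditions n x E = 0 and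
   H_tan = 0 are the membership of [E] and [H] in [H0curl Omega]. *)
Definition maxwell_eigenvalue (R : realType) (Omega : set (R3 R))
    (eps mu : R3 R -> 'M[R]_3) (w : R[i]) : Prop :=
  exists E H : vfield R,
    [/\ H0curl Omega E, H0curl Omega H,
        ~ {ae leb3 R, forall x, Omega x -> E x = 0 /\ H x = 0} &
        exists cE cH : vfield R,
          [/\ L2 Omega cE /\ weak_curl Omega E cE,
              L2 Omega cH /\ weak_curl Omega H cH,
              {ae leb3 R, forall x, Omega x ->
                'i *: cH x = w *: act (eps x) (E x)} &
              {ae leb3 R, forall x, Omega x ->
                - 'i *: cE x = w *: act (mu x) (H x)}]].

(* An extended real, so that it is +oo when no such [b] exists. *)
Definition beta_min (R : realType) (Omega : set (R3 R)) (a : R) : \bar R :=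
  ereal_inf [set b%:E | b in [set b : R | a < b /\
    exists eps mu : R3 R -> 'M[R]_3,
      [/\ Linfty_Msym Omega a b eps, Linfty_Msym Omega a b mu &
          exists2 w : R, w != 0 & maxwell_eigenvalue Omega eps mu w%:C]]].

(* [inf] is 0 on the empty set, so [0 < omega_star] also says that eigenvalues
   exist. *)
Definition omega_star (R : realType) (Omega : set (R3 R)) (a b : R) : R :=
  inf [set w : R | 0 < w /\
    exists eps mu : R3 R -> 'M[R]_3,
      [/\ Linfty_Msym Omega a b eps, Linfty_Msym Omega a b mu &
          maxwell_eigenvalue Omega eps mu w%:C]].

(* Main.v *)
(* Let [q_{a,b}(y, z) = (z - a y) . (b y - z)]. A symmetric matrix with spectrum
   in [[a, b]] that maps the vector [y] to [z] exists if and only if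
   [q_{a,b}(y, z) >= 0], and it can then be taken to be [a I + p p^T / (p . y)]
   with [p = z - a y]. Splitting the fields into real and imaginary parts,
   [w > 0] is therefore an eigenvalue for some [eps] and [mu] if and only if
   there are real fields [E] and [H] in [H_0(curl)], not both zero, with
   [q(w E, curl H) >= 0] and [q(w H, curl E) >= 0] almost everywhere.

   For test fields [F] and [G], the derivative of
   [g(h) = \int curl G(x) . F(x + h) dx] in every direction is at most
   [|curl G| |curl F|], because [curl G] is orthogonal to gradients. As [g]
   vanishes far away, [|\int curl H . E| <= L |curl H| |curl E|] in [H_0(curl)],
   and this bounds [w] from below.

   The same estimate allows one to replace [g(0)] by an average of [g] over small
   translations, that is, to replace [F] by a mollification, which converges
   uniformly along weakly convergent sequences. Hence [\int phi curl H_n . E_n]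
   passes to weak limits. Since [\int phi |E_n|^2] and [\int phi |curl H_n|^2] are
   weakly lower semicontinuous for [phi >= 0], the inequality [q >= 0] survives in
   the weak limit of a normalized minimizing sequence. The limit is not zero,
   because [\int (curl H_n . E_n + curl E_n . H_n) >= a w_n (|E_n|^2 + |H_n|^2)]. *)

Require Import Defs.
From HB Require Import structures.
From mathcomp Require Import all_boot all_order all_algebra.
From mathcomp Require Import all_classical all_reals all_analysis.
From mathcomp Require Import complex.
From mathcomp Require Import measurable_realfun.
From mathcomp Require Import ring lra.
Set Implicit Arguments.
Unset Strict Implicit.
Unset Printing Implicit Defensive.
Import Order.TTheory GRing.Theory Num.Theory.
Import numFieldNormedType.Exports.
Local Open Scope classical_set_scope.
Local Open Scope ring_scope.
Local Open Scope complex_scope.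

(** * Pre-Hilbert spaces and weak limits *)

(** The coefficients along a minimizing sequence are merely bounded, so [eps_n E_n] has no evident
    weak limit of the form [eps E]; this is why they are traded for the pointwise condition
    [q >= 0]. That condition is not weakly closed by itself: [q] is an indefinite form in [(y, z)],
    its mixed term [z . y] being the obstacle. The mixed term survives because [curl H_n] is
    divergence free and [E_n] has a bounded curl: this is the div-curl lemma, here derived from the
    translation estimate. Weak limits are taken along an ultrafilter finer than [\oo], along which
    every bounded real sequence converges, so that no subsequence is extracted. Completeness of
    [L^2] enters only through the Riesz representation; the other Hilbert space arguments work with
    almost minimizers. Elements of [H_0(curl)] are handled as pairs in the closure of the graph of
    the curl, [H0pair]. *)

Lemma norm_le_of_sqr (R : realDomainType) (x y : R) :
  0 <= y -> x ^+ 2 <= y ^+ 2 -> `|x| <= y.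
Proof.
by move=> y0 xy; rewrite -(@ler_pXn2r _ 2)// ?nnegrE// real_normK ?num_real.
Qed.

Section PreHilbert.
Variables (R : realType) (V : lmodType R).

(** The ambient space is that of all functions and [P] selects those of finite norm: outside [P] an
    integral may be a default value, so bilinearity and positivity are asked on [P] only. The form
    is only semidefinite, since functions are not identified up to null sets. *)
Record prehilbert (P : set V) (b : V -> V -> R) : Prop := PreHilbert {
  ph0 : P 0;
  phL : forall a u v, P u -> P v -> P (a *: u + v);
  phC : forall u v, b u v = b v u;
  phM : forall a u v w, P u -> P v -> P w -> b (a *: u + v) w = a * b u w + b v w;
  ph_ge0 : forall u, P u -> 0 <= b u u }.

Variables (P : set V) (b : V -> V -> R).
Hypothesis Pb : prehilbert P b.

Let P0 := ph0 Pb.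
Let PL := phL Pb.
Let bC := phC Pb.
Let bM := phM Pb.
Let b_ge0 := ph_ge0 Pb.

Lemma phZ a u : P u -> P (a *: u).
Proof. by move=> Pu; rewrite -[a *: u]addr0; apply: PL. Qed.

Lemma phD u v : P u -> P v -> P (u + v).
Proof. by move=> Pu Pv; rewrite -[u]scale1r; apply: PL. Qed.

Lemma phB u v : P u -> P v -> P (u - v).
Proof. by move=> Pu Pv; rewrite -scaleN1r addrC; apply: PL. Qed.

Lemma bMr a u v w : P u -> P v -> P w -> b w (a *: u + v) = a * b w u + b w v.
Proof. by move=> *; rewrite bC bM// !(bC _ w). Qed.

Lemma bD u v w : P u -> P v -> P w -> b (u + v) w = b u w + b v w.
Proof. by move=> *; rewrite -{1}[u]scale1r bM// mul1r. Qed.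

Lemma bDr u v w : P u -> P v -> P w -> b w (u + v) = b w u + b w v.
Proof. by move=> *; rewrite bC bD// !(bC _ w). Qed.

Lemma bB u v w : P u -> P v -> P w -> b (u - v) w = b u w - b v w.
Proof. by move=> *; rewrite -scaleN1r addrC bM// mulN1r addrC. Qed.

Lemma bBr u v w : P u -> P v -> P w -> b w (u - v) = b w u - b w v.
Proof. by move=> *; rewrite bC bB// !(bC _ w). Qed.

Lemma b0l w : P w -> b 0 w = 0.
Proof. by move=> Pw; have := bB P0 P0 Pw; rewrite subrr subrr. Qed.

Lemma bZ a u w : P u -> P w -> b (a *: u) w = a * b u w.
Proof. by move=> *; rewrite -[a *: u]addr0 bM// b0l// addr0. Qed.

Lemma bZr a u w : P u -> P w -> b w (a *: u) = a * b w u.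
Proof. by move=> *; rewrite bC bZ// bC. Qed.

Lemma bsqrB u v : P u -> P v -> b (u - v) (u - v) = b u u - 2 * b u v + b v v.
Proof.
by move=> Pu Pv; rewrite bB ?bBr// ?(bC v u); first ring; exact: phB.
Qed.

Lemma bsqrD u v : P u -> P v -> b (u + v) (u + v) = b u u + 2 * b u v + b v v.
Proof.
by move=> Pu Pv; rewrite bD ?bDr// ?(bC v u); first ring; exact: phD.
Qed.

Lemma bsqrD_le u v : P u -> P v -> b (u + v) (u + v) <= 2 * b u u + 2 * b v v.
Proof.
move=> Pu Pv; have := b_ge0 (phB Pu Pv); rewrite bsqrB// bsqrD//; lra.
Qed.

Lemma bsqrB_le u v : P u -> P v -> b (u - v) (u - v) <= 2 * b u u + 2 * b v v.
Proof.
move=> Pu Pv; have := b_ge0 (phD Pu Pv); rewrite bsqrB// bsqrD//; lra.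
Qed.

Lemma quadratic_discr (a c d : R) : 0 <= a -> 0 <= d ->
  (forall s, 0 <= d + 2 * s * c + s ^+ 2 * a) -> c ^+ 2 <= a * d.
Proof.
move=> a0 d0 h.
have [a_gt0|] := ltP 0 a.
  have := h (- c / a).
  rewrite (_ : d + _ + _ = (a * d - c ^+ 2) / a); last by field; rewrite gt_eqF.
  by rewrite pmulr_lge0 ?invr_gt0// subr_ge0.
move=> a0'; have -> : a = 0 by apply/eqP; rewrite eq_le a0 a0'.
rewrite mul0r; have [->|c0] := eqVneq c 0; first by rewrite expr0n.
(* With [a = 0] the polynomial is affine in [s], and here it takes the value -1. *)
have := h (- (d + 1) / (2 * c)).
have -> : a = 0 by apply/eqP; rewrite eq_le a0 a0'.
rewrite (_ : d + _ + _ = -1); last by field.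
by rewrite oppr_ge0 ler10.
Qed.

Lemma cauchy_schwarz u v : P u -> P v -> (b u v) ^+ 2 <= b u u * b v v.
Proof.
move=> Pu Pv; rewrite mulrC; apply: quadratic_discr; [exact: b_ge0|exact: b_ge0|].
move=> s; have := b_ge0 (PL s Pv Pu).
have ? : P (s *: v + u) by exact: PL.
by rewrite bM// !bMr// (bC v u) => h; apply: le_trans h _; rewrite le_eqVlt; apply/orP; left; apply/eqP; ring.
Qed.

Lemma norm_le_cs u v M N : P u -> P v -> 0 <= M -> 0 <= N ->
  b u u <= M ^+ 2 -> b v v <= N ^+ 2 -> `|b u v| <= M * N.
Proof.
move=> Pu Pv M0 N0 uM vN.
apply: norm_le_of_sqr; rewrite ?mulr_ge0// exprMn.
by apply: le_trans (cauchy_schwarz Pu Pv) _; apply: ler_pM => //; exact: b_ge0.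
Qed.

(* [r] almost minimizes the distance to [W], hence is almost orthogonal to it. *)
Lemma almost_orthogonal (W : set V) r d : P r -> W `<=` P ->
  (forall a u, W u -> W (a *: u)) -> 0 <= d ->
  (forall u, W u -> b r r <= b (r - u) (r - u) + d ^+ 2) ->
  forall u, W u -> (b r u) ^+ 2 <= d ^+ 2 * b u u.
Proof.
move=> Pr WP WZ d0 h u Wu; rewrite mulrC.
have Pu := WP _ Wu.
apply: quadratic_discr; [exact: b_ge0|exact: sqr_ge0|].
move=> s; have := h _ (WZ (- s) _ Wu).
have ? := phZ (- s) Pu.
rewrite bsqrB// bZr// bZ// bZr//; lra.
Qed.

(** Mazur's theorem for a subspace, without completeness. The orthogonal projection of [v] is
    replaced by an almost minimizer [phi] of the distance to [W]: the residue [r = v - phi] is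
    almost orthogonal to [W], hence to every [un i], hence to their weak limit [v]. Then
    [b r r = b r v - b r phi] is a difference of two small numbers. *)
Lemma weak_closed_closed (I : Type) (F : set_system I) (W : set V) (un : I -> V)
    (v : V) (M : R) : ProperFilter F -> W `<=` P -> P v ->
  (forall a u w, W u -> W w -> W (a *: u + w)) -> W 0 ->
  (forall i, W (un i)) -> (forall i, b (un i) (un i) <= M) ->
  (forall r, P r -> b r (un i) @[i --> F] --> b r v) ->
  forall e, 0 < e -> exists2 phi, W phi & b (v - phi) (v - phi) < e.
Proof.
move=> FF WP Pv WL W0 Wun unM unv e e0.
have WZ a u : W u -> W (a *: u) by move=> Wu; rewrite -[_ *: _]addr0; exact: WL.
have M0 : 0 <= M by have [i _] := filter_ex (@filterT _ F _); apply: le_trans (unM i); exact/b_ge0/WP.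
(* [K] bounds the square norms of the [un i] and of [phi = v - r]; the latter is at most
   [2 |v|^2 + 2 |r|^2 <= 4 |v|^2 + 2]. As [K >= 1], also [K <= K ^+ 2], and [d K <= e / 4]. *)
pose K := M + 4 * b v v + 3.
have bv0 := b_ge0 Pv.
have K1 : 1 <= K by rewrite /K; lra.
have KK : K <= K ^+ 2 by rewrite expr2 ler_peMr// (le_trans _ K1).
pose d := Num.min 1 (e / (4 * K)).
have K0 : 0 < K by apply: lt_le_trans K1.
have d0 : 0 < d by rewrite lt_min ltr01 divr_gt0// mulr_gt0.
have d1 : d <= 1 by rewrite ge_min lexx.
have dsq1 : d ^+ 2 <= 1 by rewrite expr_le1// ltW.
pose A := [set b (v - u) (v - u) | u in W].
have Alb : lbound A 0 by move=> _ [u Wu <-]; apply: b_ge0; exact: phB (WP _ Wu).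
have A0 : A !=set0 by exists (b (v - 0) (v - 0)), 0.
have hA : has_inf A by split=> //; exists 0.
have d20 : 0 < d ^+ 2 by rewrite exprn_gt0.
have [_ [phi Wphi <-] hphi] := inf_adherent d20 hA.
have Pphi := WP _ Wphi.
set r := v - phi in hphi.
have Pr : P r by exact: phB.
have infA w : W w -> inf A <= b (v - w) (v - w).
  by move=> Ww; apply: ge_inf; [exists 0|exists w].
have rmin u : W u -> b r r <= b (r - u) (r - u) + d ^+ 2.
  move=> Wu; apply: (le_trans (ltW hphi)); rewrite lerD2r /r -addrA -opprD.
  by apply: infA; rewrite -[phi]scale1r; exact: WL.
have orth := almost_orthogonal Pr WP WZ (ltW d0) rmin.
have rle : b r r <= b v v + 1.
  by apply: (le_trans (ltW hphi)); rewrite lerD// -[v in X in _ <= X]subr0; exact: infA.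
have sq (u : V) : W u -> b u u <= K -> `|b r u| <= d * K.
  move=> Wu uK; apply: norm_le_of_sqr; first by rewrite mulr_ge0// ltW.
  by rewrite exprMn (le_trans (orth _ Wu))// ler_pM2l// (le_trans uK).
have h1 : `|b r v| <= d * K.
  apply: (cvgr_to_le (cvg_norm (unv r Pr))).
  apply: nearW => i; apply: sq => //; apply: (le_trans (unM i)); rewrite /K; lra.
have h2 : `|b r phi| <= d * K.
  apply: sq => //; have -> : phi = v - r by rewrite /r opprB addrC subrK.
  apply: (le_trans (bsqrB_le Pv Pr)); rewrite /K; lra.
exists phi => //; rewrite -/r {2}/r bBr//.
have h3 : d * K <= e / 4.
  by rewrite -ler_pdivlMr// (_ : e / 4 / K = e / (4 * K)) ?ge_min ?lexx ?orbT//; field; rewrite gt_eqF.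
move: h1 h2; rewrite !ler_norml => /andP[h11 h12] /andP[h21 h22]; lra.
Qed.

(** The representative of [L] minimizes [|w|^2 - 2 L w]. Without completeness the minimum need not
    be attained; an almost minimizer, up to [d ^+ 2], satisfies the Euler equation up to [d], by the
    discriminant of the variation along [u]. *)
Lemma approx_riesz (L : V -> R) (M : R) :
  (forall a u v, P u -> P v -> L (a *: u + v) = a * L u + L v) ->
  (forall u, P u -> (L u) ^+ 2 <= M * b u u) ->
  forall d, 0 < d -> exists2 w, P w &
    forall u, P u -> (b w u - L u) ^+ 2 <= d ^+ 2 * b u u.
Proof.
move=> LL LM d d0.
pose J w := b w w - 2 * L w.
have M0 : 0 <= `|M| by [].
have Jge w : P w -> - `|M| <= J w.
  move=> Pw; rewrite /J.
  have h : (L w) ^+ 2 <= `|M| * b w w.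
    by apply: le_trans (LM _ Pw) _; rewrite ler_wpM2r ?b_ge0// ler_norm.
  have h2 := b_ge0 Pw.
  have : `|2 * L w| <= `|M| + b w w.
    apply: norm_le_of_sqr; first by rewrite addr_ge0.
    have := sqr_ge0 (`|M| - b w w); nra.
  rewrite ler_norml; lra.
pose A := [set J w | w in P].
have hA : has_inf A.
  split; first by exists (J 0), 0.
  by exists (- `|M|) => _ [w Pw <-]; exact: Jge.
have d20 : 0 < d ^+ 2 by rewrite exprn_gt0.
have [_ [w Pw <-] hw] := inf_adherent d20 hA.
exists w => // u Pu; rewrite mulrC.
apply: quadratic_discr; [exact: b_ge0|exact: sqr_ge0|move=> s].
have : inf A <= J (w + s *: u).
  apply: ge_inf; first by case: hA.
  by exists (w + s *: u) => //; apply: phD => //; exact: phZ.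
have Psu := phZ s Pu.
rewrite /J (addrC w) LL// (addrC _ w) bsqrD// bZr// bZ// bZr//.
by move: hw; rewrite /J; lra.
Qed.

(** Both inequalities are tested with [w1 - w2] itself. Approximate representatives with tolerances
    [2^-k] therefore form a Cauchy sequence of geometric rate. *)
Lemma approx_riesz_cauchy (L : V -> R) w1 w2 d1 d2 : P w1 -> P w2 ->
  0 <= d1 -> 0 <= d2 ->
  (forall u, P u -> (b w1 u - L u) ^+ 2 <= d1 ^+ 2 * b u u) ->
  (forall u, P u -> (b w2 u - L u) ^+ 2 <= d2 ^+ 2 * b u u) ->
  b (w1 - w2) (w1 - w2) <= (d1 + d2) ^+ 2.
Proof.
move=> P1 P2 d10 d20 h1 h2; have Pu := phB P1 P2; set u := w1 - w2 in Pu *.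
have := h1 _ Pu; have := h2 _ Pu.
have B0 := b_ge0 Pu.
have E : b u u = (b w1 u - L u) - (b w2 u - L u) by rewrite {1}/u bB//; ring.
set B := b u u in B0 E *; move: (Num.sqrt B) (sqr_sqrtr B0) (sqrtr_ge0 B) => c cB c0.
rewrite -cB -!exprMn => /(norm_le_of_sqr (mulr_ge0 d20 c0)) k2.
move=> /(norm_le_of_sqr (mulr_ge0 d10 c0)) k1.
have : c ^+ 2 <= (d1 + d2) * c.
  by rewrite cB E (le_trans (ler_norm _))// (le_trans (ler_normB _ _))// mulrDl lerD.
have [->|cn] := eqVneq c 0; first by rewrite expr0n/= sqr_ge0.
have cp : 0 < c by rewrite lt_neqAle eq_sym cn.
rewrite {1}[c ^+ 2]expr2 ler_pM2r// => h.
by apply: lerXn2r => //; rewrite nnegrE addr_ge0.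
Qed.

End PreHilbert.

Section TriangleInequality.
Variables (R : realType) (V : lmodType R).
Variables (P : set V) (b : V -> V -> R).
Hypothesis Pb : prehilbert P b.

Lemma triangle_le u v M N : P u -> P v -> 0 <= M -> 0 <= N ->
  b u u <= M ^+ 2 -> b v v <= N ^+ 2 -> b (u + v) (u + v) <= (M + N) ^+ 2.
Proof.
move=> Pu Pv M0 N0 uM vN; have := norm_le_cs Pb Pu Pv M0 N0 uM vN.
rewrite ler_norml (bsqrD Pb Pu Pv) sqrrD -mulr_natl => /andP[_ h]; lra.
Qed.

Lemma triangleB_le u v M N : P u -> P v -> 0 <= M -> 0 <= N ->
  b u u <= M ^+ 2 -> b (u - v) (u - v) <= N ^+ 2 -> b v v <= (M + N) ^+ 2.
Proof.
move=> Pu Pv M0 N0 uM vN.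
have Pvu : P (v - u) by exact: (phB Pb).
have vuN : b (v - u) (v - u) <= N ^+ 2.
  move: vN; rewrite (bsqrB Pb Pu Pv) (bsqrB Pb Pv Pu) (phC Pb u v); lra.
by have := triangle_le Pu Pvu M0 N0 uM vuN; rewrite addrC subrK.
Qed.

Lemma inner_approx_le u u' v v' A B e : P u -> P u' -> P v -> P v' ->
  0 <= A -> 0 <= B -> 0 <= e <= 1 -> b u u <= A ^+ 2 -> b v v <= B ^+ 2 ->
  b (u - u') (u - u') <= e ^+ 2 -> b (v - v') (v - v') <= e ^+ 2 ->
  `|b u v - b u' v'| <= (A + B + 1) * e.
Proof.
move=> Pu Pu' Pv Pv' A0 B0 /andP[e0 e1] uA vB du dv.
have Pdu := phB Pb Pu Pu'; have Pdv := phB Pb Pv Pv'.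
have B'0 : 0 <= B + e by exact: addr_ge0.
have h1 := norm_le_cs Pb Pu Pdv A0 e0 uA dv.
have h2 := norm_le_cs Pb Pdu Pv' e0 B'0 du (triangleB_le Pv Pv' B0 e0 vB dv).
have -> : b u v - b u' v' = b u (v - v') + b (u - u') v'.
  by rewrite (bBr Pb Pv Pv' Pu) (bB Pb Pu Pu' Pv'); ring.
apply: le_trans (ler_normD _ _) _; apply: le_trans (lerD h1 h2) _.
have : e * e <= e by rewrite ler_piMr.
lra.
Qed.

End TriangleInequality.

Lemma le_of_small_error (R : realFieldType) (x y C : R) :
  (forall e, 0 < e <= 1 -> x <= y + C * e) -> x <= y.
Proof.
move=> h; have C0 : 0 < `|C| + 1 by rewrite ltr_wpDl.
apply/ler_addgt0Pr => d d0.
pose e := Num.min 1 (d / (`|C| + 1)).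
have e0 : 0 < e by rewrite lt_min ltr01 divr_gt0.
have e1 : e <= 1 by rewrite ge_min lexx.
have ed : e <= d / (`|C| + 1) by rewrite ge_min lexx orbT.
apply: le_trans (h e _) _; first by rewrite e0 e1.
rewrite lerD2l; apply: (@le_trans _ _ ((`|C| + 1) * e)).
  by rewrite ler_pM2r//; have := ler_norm C; lra.
by rewrite mulrC -ler_pdivlMr.
Qed.

(** * Square integrable functions *)

Section SquareIntegrable.
Context d (T : measurableType d) (R : realType) (mu : {measure set T -> \bar R}).
Variable D : set T.
Hypothesis mD : measurable D.

Definition sqint (f : T -> R) : Prop := measurable_fun D f /\
  (\int[mu]_(x in D) ((f x) ^+ 2)%:E < +oo)%E.

Definition ip (f g : T -> R) : R := \int[mu]_(x in D) (f x * g x).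

Lemma sqint_sqr f : sqint f -> mu.-integrable D (fun x => ((f x) ^+ 2)%:E).
Proof.
move=> [mf lf]; apply/integrableP; split.
  by apply/measurable_EFinP; apply: measurable_funX.
by under eq_integral do rewrite gee0_abs ?lee_fin ?sqr_ge0//.
Qed.

Lemma sqintP (f : T -> R) : measurable_fun D f ->
  mu.-integrable D (fun x => ((f x) ^+ 2)%:E) -> sqint f.
Proof. by move=> mf lf; split => //; exact: integrable_lty. Qed.

Lemma sqint_mul f g : sqint f -> sqint g ->
  mu.-integrable D (EFin \o (fun x => f x * g x)).
Proof.
move=> sf sg; have [mf _] := sf; have [mg _] := sg.
apply: (le_integrable mD _ _ (integrableD mD (sqint_sqr sf) (sqint_sqr sg))).
  by apply/measurable_EFinP; apply: measurable_funM.
move=> x Dx /=; rewrite lee_fin [leRHS]ger0_norm ?addr_ge0 ?sqr_ge0//.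
apply: norm_le_of_sqr; first by rewrite addr_ge0 ?sqr_ge0.
by have := sqr_ge0 (f x ^+ 2 - g x ^+ 2); have := sqr_ge0 (f x * g x); nra.
Qed.

Lemma sqintL a f g : sqint f -> sqint g -> sqint (a *: f + g).
Proof.
move=> sf sg; have [mf _] := sf; have [mg _] := sg.
have mh : measurable_fun D (a *: f + g).
  by apply: measurable_funD => //; apply: measurable_funM => //; exact: measurable_cst.
apply: sqintP => //.
have h := integrableD mD (integrableZl mD (2 * a ^+ 2) (sqint_sqr sf))
                         (integrableZl mD 2 (sqint_sqr sg)).
apply: (le_integrable mD _ _ h).
  by apply/measurable_EFinP; apply: measurable_funX.
move=> x Dx /=; rewrite lee_fin ger0_norm ?sqr_ge0// ger0_norm; last first.
  by apply: addr_ge0; do ?[exact: sqr_ge0|apply: mulr_ge0].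
have -> : (a *: f + g) x = a * f x + g x by [].
by have := sqr_ge0 (a * f x - g x); nra.
Qed.

Lemma sqint0 : sqint 0.
Proof.
split; first exact: measurable_cst.
by under eq_integral do rewrite /= expr0n/=; rewrite integral0.
Qed.

Lemma ip_integral f : sqint f -> (\int[mu]_(x in D) ((f x) ^+ 2)%:E = (ip f f)%:E)%E.
Proof.
move=> sf; rewrite /ip /Rintegral fineK.
  by apply: eq_integral => x _; rewrite expr2.
exact/integrable_fin_num/sqint_mul.
Qed.

Lemma sqint_prehilbert : prehilbert sqint ip.
Proof.
split.
- exact: sqint0.
- exact: sqintL.
- by move=> u v; apply: eq_Rintegral => x _; rewrite mulrC.
- move=> a u v w su sv sw; rewrite /ip -RintegralZl//; last exact: sqint_mul.
  rewrite -RintegralD//; [|exact: (integrableZl mD a (sqint_mul su sw))|exact: sqint_mul].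
  by apply: eq_Rintegral => x _; rewrite mulrDl -mulrA.
- by move=> u su; apply: Rintegral_ge0 => x _; rewrite -expr2 sqr_ge0.
Qed.

Lemma sqint_bounded (f : T -> R) M : (mu D < +oo)%E -> measurable_fun D f ->
  (forall x, D x -> `|f x| <= M) -> sqint f.
Proof.
move=> Doo mf fM; split => //.
apply: (@le_lt_trans _ _ (\int[mu]_(x in D) (M ^+ 2)%:E)%E).
  apply: ge0_le_integral => //.
  - by move=> x _; rewrite lee_fin sqr_ge0.
  - by apply/measurable_EFinP; apply: measurable_funX.
  - move=> x Dx; rewrite lee_fin -(real_normK (num_real _)).
    by apply: lerXn2r; rewrite ?nnegrE ?fM// (le_trans _ (fM _ Dx)).
rewrite integral_cst//; apply: lte_mul_pinfty => //; rewrite lee_fin; exact: sqr_ge0.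
Qed.

Lemma sqint_cst c : (mu D < +oo)%E -> sqint (cst c).
Proof.
by move=> Doo; apply: (@sqint_bounded _ `|c|) => //; exact: measurable_cst.
Qed.

Lemma sqint_mulb (f g : T -> R) M : sqint f -> measurable_fun D g ->
  (forall x, D x -> `|g x| <= M) -> sqint (fun x => g x * f x).
Proof.
move=> sf mg gM; have [mf _] := sf.
have mh : measurable_fun D (fun x => g x * f x) by apply: measurable_funM.
apply: sqintP => //.
apply: (le_integrable mD _ _ (integrableZl mD (M ^+ 2) (sqint_sqr sf))).
  by apply/measurable_EFinP; apply: measurable_funX.
move=> x Dx /=; rewrite lee_fin ger0_norm ?sqr_ge0// ger0_norm; last first.
  by rewrite mulr_ge0 ?sqr_ge0.
rewrite exprMn ler_wpM2r ?sqr_ge0// -(real_normK (num_real (g x))).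
by apply: lerXn2r; rewrite ?nnegrE ?gM// (le_trans _ (gM _ Dx)).
Qed.


(** On a set of finite measure the [L^2] bound controls the integral of [|f_ k.+1 - f_ k|], because
    the norm of the constant 1 is at most [1 + mu D]. These integrals are summable, so the series of
    increments converges absolutely almost everywhere, and it telescopes. *)
Lemma geometric_cauchy_ae_cvg (f_ : nat -> T -> R) C : (mu D < +oo)%E -> 0 <= C ->
  (forall k, sqint (f_ k)) ->
  (forall k, ip (f_ k.+1 - f_ k) (f_ k.+1 - f_ k) <= (C / 2 ^+ k) ^+ 2) ->
  {ae mu, forall x, D x -> cvgn (f_ ^~ x)}.
Proof.
move=> Doo C0 sf Cf.
have Pb := sqint_prehilbert.
have sd k : sqint (f_ k.+1 - f_ k) by exact: (phB Pb).
pose g k x := `|f_ k.+1 x - f_ k x|.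
have mg k : measurable_fun D (g k).
  by apply: measurableT_comp => //; case: (sd k).
pose K := 1 + fine (mu D).
have K0 : 0 <= K by rewrite addr_ge0// fine_ge0.
have sg k : sqint (g k).
  split => //; have [_] := sd k; congr (_ < _)%E.
  by apply: eq_integral => x _; rewrite /g real_normK ?num_real.
have gle k : (\int[mu]_(x in D) (g k x)%:E <= (C * K * (1 / 2) ^+ k)%:E)%E.
  have s1 := sqint_cst 1 Doo.
  have -> : (\int[mu]_(x in D) (g k x)%:E = (ip (g k) (cst 1))%:E)%E.
    rewrite /ip /Rintegral fineK; last exact/integrable_fin_num/sqint_mul.
    by apply: eq_integral => x _; rewrite mulr1.
  rewrite lee_fin (le_trans (ler_norm _))//.
  rewrite (_ : _ * _ * _ = (C / 2 ^+ k) * K); last by rewrite expr_div_n expr1n; ring.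
  apply: (norm_le_cs Pb (sg k) s1) => //; first by rewrite divr_ge0// exprn_ge0.
    rewrite (le_trans _ (Cf k))// le_eqVlt; apply/orP; left; apply/eqP.
    by apply: eq_Rintegral => x _; rewrite -!expr2 /g real_normK ?num_real.
  rewrite /ip; under eq_Rintegral do rewrite mulr1.
  rewrite Rintegral_cst// mul1r /K; move: (fine (mu D)) (fine_ge0 (measure_ge0 mu D)) => m m0; nra.
pose G x := (\sum_(0 <= k <oo) (g k x)%:E)%E.
have g0 k x : D x -> (0 <= (g k x)%:E)%E by rewrite lee_fin /g.
have mgE k : measurable_fun D (fun x => (g k x)%:E) by apply/measurable_EFinP.
have intG : mu.-integrable D G.
  apply/integrableP; split.
    by apply: ge0_emeasurable_sum => // k x Dx _; exact: g0.
  have G0 x : (0 <= G x)%E by apply: nneseries_ge0 => k _ _; rewrite lee_fin /g.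
  under eq_integral do rewrite gee0_abs//.
  rewrite integral_nneseries//.
  apply: (@le_lt_trans _ _ (\sum_(0 <= k <oo) (C * K * (1 / 2) ^+ k)%:E)%E).
    by apply: lee_nneseries => // k _ _; apply: integral_ge0 => x _; rewrite lee_fin /g.
  apply: (@le_lt_trans _ _ (C * K / (1 - 1 / 2))%:E); last by rewrite ltry.
  apply: lime_le.
    by apply: is_cvg_nneseries => n _ _; rewrite lee_fin mulr_ge0 ?exprn_ge0 ?mulr_ge0.
  apply: nearW => n; rewrite sumEFin lee_fin.
  apply: geometric_le_lim; [by rewrite mulr_ge0|lra|rewrite ger0_norm; lra].
have := integrable_ae mD intG; apply: filterS => x h Dx; have {h} Gx := h Dx.
have ser : cvgn (series (fun k => f_ k.+1 x - f_ k x)).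
  apply: normed_cvg; apply: nondecreasing_is_cvgn.
    by apply: nondecreasing_series => k _ _ /=.
  exists (fine (G x)) => _ [n _ <-] /=.
  rewrite -lee_fin fineK// /series/= -sumEFin.
  by apply: nneseries_lim_ge => k _ _; rewrite lee_fin /g.
rewrite (_ : f_^~ x = (fun n => f_ 0%N x + series (fun k => f_ k.+1 x - f_ k x) n)).
  by apply: is_cvgD => //; exact: is_cvg_cst.
by apply/funext => n; rewrite (eq_sum_telescope (f_^~ x) n).
Qed.

(** The rate survives in the limit by Fatou's lemma, applied to [(f_ l - f_ k) ^+ 2] as [l] grows
    with [k] fixed; square integrability of the limit follows from the case [k = 0]. *)
Lemma riesz_fischer (f_ : nat -> T -> R) C : (mu D < +oo)%E -> 0 <= C ->
  (forall k, sqint (f_ k)) ->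
  (forall k l, (k <= l)%N -> ip (f_ l - f_ k) (f_ l - f_ k) <= (C / 2 ^+ k) ^+ 2) ->
  exists2 f, sqint f & forall k, ip (f - f_ k) (f - f_ k) <= (C / 2 ^+ k) ^+ 2.
Proof.
move=> Doo C0 sf Cf.
have Pb := sqint_prehilbert.
have ae := geometric_cauchy_ae_cvg Doo C0 sf (fun k => Cf _ _ (leqnSn k)).
(* The upper limit is measurable without any exceptional set and agrees with the limit wherever the
   latter exists; [fine] sends infinite values to 0. *)
pose f x := fine (limn_esup (fun k => (f_ k x)%:E)).
have mf : measurable_fun D f.
  apply: (measurableT_comp (fine_measurable measurableT)) => //.
  by apply: measurable_fun_limn_esup => k; apply/measurable_EFinP; case: (sf k).
have fE x : cvgn (f_ ^~ x) -> f_ k x @[k --> \oo] --> f x.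
  move=> cf; have cf' : (f_ k x)%:E @[k --> \oo] --> (limn (f_^~ x))%:E.
    by apply/fine_cvgP; split; [exact: nearW|].
  by rewrite /f (cvg_limn_einf_sup cf').2.
have main k : (\int[mu]_(x in D) ((f x - f_ k x) ^+ 2)%:E <= ((C / 2 ^+ k) ^+ 2)%:E)%E.
  have mk l : measurable_fun D (fun x => ((f_ l x - f_ k x) ^+ 2)%:E).
    apply/measurable_EFinP; apply: measurable_funX.
    by apply: measurable_funB; [case: (sf l)|case: (sf k)].
  have ge0 l x : D x -> (0 <= ((f_ l x - f_ k x) ^+ 2)%:E)%E.
    by move=> _; rewrite lee_fin sqr_ge0.
  apply: (@le_trans _ _ (\int[mu]_(x in D) limn_einf (fun l => ((f_ l x - f_ k x) ^+ 2)%:E))%E).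
    rewrite le_eqVlt; apply/orP; left; apply/eqP; apply: ae_eq_integral => //.
    - apply/measurable_EFinP; apply: measurable_funX.
      by apply: measurable_funB => //; case: (sf k).
    - have -> : (fun x => limn_einf (fun l => ((f_ l x - f_ k x) ^+ 2)%:E)) =
          (fun x => - limn_esup (fun l => - ((f_ l x - f_ k x) ^+ 2)%:E))%E.
        by apply/funext => x; rewrite [X in (- X)%E]limn_esupN oppeK.
      apply: measurableT_comp => //; apply: measurable_fun_limn_esup => l.
      exact: measurableT_comp.
    - move: ae; apply: filterS => x h Dx; have cx := fE _ (h Dx).
      have cx' : ((f_ l x - f_ k x) ^+ 2)%:E @[l --> \oo] --> ((f x - f_ k x) ^+ 2)%:E.
        apply/fine_cvgP; split; first exact: nearW.
        have h2 : f_ l x - f_ k x @[l --> \oo] --> f x - f_ k x.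
          by apply: cvgB => //; exact: cvg_cst.
        by rewrite expr2; under eq_fun do rewrite /= expr2; apply: cvgM.
      by rewrite (cvg_limn_einf_sup cx').1.
  apply: (le_trans (fatou mu mD mk ge0)).
  rewrite limn_einf_lim; apply: lime_le; first exact: is_cvg_einfs.
  exists k => // l /= kl.
  apply: (@le_trans _ _ (\int[mu]_(x in D) ((f_ l x - f_ k x) ^+ 2)%:E)%E).
    by apply: ereal_inf_lbound; exists l => //=.
  have slk : sqint (f_ l - f_ k) by exact: (phB Pb).
  by rewrite (ip_integral slk) lee_fin; exact: Cf.
have sfk k : sqint (f - f_ k).
  split; first by apply: measurable_funB => //; case: (sf k).
  exact: le_lt_trans (main k) (ltry _).
exists f; last by move=> k; rewrite -lee_fin -ip_integral//; exact: main.
by rewrite -[f](subrK (f_ 0%N)); apply: (phD Pb).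
Qed.

(** The approximate representatives of tolerance [2^-k] satisfy
    [|w l - w k| <= 2^-l + 2^-k <= 2 / 2^k] for [k <= l], which is the form required by
    [riesz_fischer]; their limit represents [L] exactly. *)
Lemma riesz_representation (L : (T -> R) -> R) (M : R) : (mu D < +oo)%E ->
  (forall a u v, sqint u -> sqint v -> L (a *: u + v) = a * L u + L v) ->
  (forall u, sqint u -> (L u) ^+ 2 <= M * ip u u) ->
  exists2 f, sqint f & forall u, sqint u -> ip f u = L u.
Proof.
move=> Doo LL LM; have Pb := sqint_prehilbert.
have i1 k : 0 < (2 ^+ k)^-1 :> R by rewrite invr_gt0 exprn_gt0.
have ar k := approx_riesz Pb LL LM (i1 k).
have /choice[w hw] : forall k, exists w, sqint w /\
    forall u, sqint u -> (ip w u - L u) ^+ 2 <= (2 ^+ k)^-1 ^+ 2 * ip u u.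
  by move=> k; have [w sw hw] := ar k; exists w.
have i0 k : 0 <= (2 ^+ k)^-1 :> R by rewrite invr_ge0 exprn_ge0.
have [|k|k l kl|f sf hf] := @riesz_fischer w 2 Doo => //; first by case: (hw k).
  apply: (le_trans (approx_riesz_cauchy Pb (hw l).1 (hw k).1 (i0 l) (i0 k) (hw l).2 (hw k).2)).
  apply: lerXn2r; rewrite ?nnegrE ?addr_ge0 ?divr_ge0 ?exprn_ge0//.
  rewrite [leRHS]mulrDl mul1r lerD2r lef_pV2 ?posrE ?exprn_gt0//.
  by rewrite ler_eXn2l// ltr1n.
exists f => // u su; apply/eqP; rewrite -subr_eq0 -normr_eq0; apply/eqP.
have u0 := ph_ge0 Pb su.
pose c := Num.sqrt (ip u u).
have uc : ip u u <= c ^+ 2 by rewrite sqr_sqrtr.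
have c0 : 0 <= c by exact: sqrtr_ge0.
have bnd k : `|ip f u - L u| <= 3 * c / 2 ^+ k.
  have [sw wk] := hw k.
  rewrite (_ : _ - _ = ip (f - w k) u + (ip (w k) u - L u)); last first.
    by rewrite (bB Pb)//; ring.
  apply: (le_trans (ler_normD _ _)).
  rewrite (_ : 3 * c / 2 ^+ k = 2 / 2 ^+ k * c + c / 2 ^+ k); last by ring.
  apply: lerD.
    by apply: (norm_le_cs Pb) => //; exact: (phB Pb).
  apply: norm_le_of_sqr; first by rewrite mulr_ge0.
  by rewrite (le_trans (wk _ su))// mulrC exprMn ler_wpM2r// exprn_ge0.
have : 3 * c / 2 ^+ k @[k --> \oo] --> (0 : R).
  rewrite -[X in _ --> X](mulr0 (3 * c)); apply: cvgM; first exact: cvg_cst.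
  under eq_fun do rewrite -exprVn.
  by apply: cvg_expr; rewrite ger0_norm ?invr_ge0//; lra.
move=> h; apply/eqP; rewrite eq_le normr_ge0 andbT.
by apply: (cvgr_to_ge h); apply: nearW.
Qed.

Definition sqintv (I : finType) (u : I -> T -> R) := forall i, sqint (u i).

Definition ipv (I : finType) (u v : I -> T -> R) : R := \sum_i ip (u i) (v i).

Lemma sqintv_prehilbert (I : finType) : prehilbert (@sqintv I) (@ipv I).
Proof.
have Pb := sqint_prehilbert; split.
- by move=> i; exact: sqint0.
- by move=> a u v su sv i; exact: sqintL.
- by move=> u v; apply: eq_bigr => i _; exact: (phC Pb).
- move=> a u v w su sv sw; rewrite /ipv mulr_sumr -big_split/=.
  by apply: eq_bigr => i _; rewrite -(phM Pb).
- by move=> u su; apply: sumr_ge0 => i _; exact: (ph_ge0 Pb).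
Qed.

End SquareIntegrable.

(** The image of an ultrafilter is an ultrafilter on a compact segment. One ultrafilter serves all
    bounded families at once, which replaces the diagonal extraction over a countable dense set of
    test functions. *)
Lemma ultra_cvg_bounded (R : realType) (I : Type) (U : set_system I) (x : I -> R) M :
  UltraFilter U -> (forall i, `|x i| <= M) -> exists l : R, x i @[i --> U] --> l.
Proof.
move=> UU xM.
have UI : UltraFilter (x @ U).
  split; first exact: fmap_proper_filter.
  move=> G PG sG; apply/seteqP; split => // A GA.
  rewrite /= /nbhs/=; have [//|h] := in_ultra_setVsetC (x @^-1` A) UU.
  have GC : G (~` A) by apply: sG.
  by have [y []] := filter_ex (filterI GA GC).
have := @segment_compact R (- M) M; rewrite compact_ultra => /(_ _ UI) [].
  by apply: (@filterE _ U) => i /=; rewrite in_itv/= -ler_norml.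
by move=> l [_ lx]; exists l.
Qed.

(** * Weak compactness in [L^2] *)

Section WeakCompactness.
Context d (T : measurableType d) (R : realType) (mu : {measure set T -> \bar R}).
Variable D : set T.
Hypotheses (mD : measurable D) (Doo : (mu D < +oo)%E).

(** For each [v] the numbers [ip v (u i)] are bounded, hence converge along [U]. The limit is a
    bounded linear functional of [v], and its Riesz representative is the weak limit. *)
Lemma weak_compactness (I : Type) (U : set_system I) (u : I -> T -> R) (M : R) :
  UltraFilter U -> (forall i, sqint mu D (u i)) ->
  (forall i, ip mu D (u i) (u i) <= M) ->
  exists2 f, sqint mu D f &
    forall v, sqint mu D v -> ip mu D v (u i) @[i --> U] --> ip mu D v f.
Proof.
move=> UU su uM; have Pb := sqint_prehilbert mu mD.
have cs v i : sqint mu D v -> (ip mu D v (u i)) ^+ 2 <= M * ip mu D v v.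
  move=> sv; apply: (le_trans (cauchy_schwarz Pb sv (su i))).
  by rewrite mulrC ler_wpM2r// (ph_ge0 Pb).
pose L v := lim (ip mu D v (u i) @[i --> U]).
have cvL v : sqint mu D v -> ip mu D v (u i) @[i --> U] --> L v.
  move=> sv; have M0 := ph_ge0 Pb sv.
  have [|l hl] := @ultra_cvg_bounded R I U (fun i => ip mu D v (u i)) (1 + `|M * ip mu D v v|) UU.
    move=> i; apply: norm_le_of_sqr; first by rewrite addr_ge0.
    apply: (le_trans (cs _ _ sv)); have := ler_norm (M * ip mu D v v).
    have := normr_ge0 (M * ip mu D v v); nra.
  by apply: cvgP hl.
have [|v sv|f sf fE] := @riesz_representation _ _ _ mu D mD L M Doo.
- move=> a v w sv sw; apply/cvg_lim => //.
  under eq_fun => i do rewrite (phM Pb)//.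
  by apply: cvgD; [apply: cvgM => //; [exact: cvg_cst|exact: cvL]|exact: cvL].
- have h : (ip mu D v (u i)) ^+ 2 @[i --> U] --> L v ^+ 2.
    by rewrite expr2; under eq_fun do rewrite expr2; apply: cvgM; exact: cvL.
  by apply: (cvgr_to_le h); apply: nearW => i; exact: cs.
- by exists f => // v sv; rewrite (phC Pb v) fE//; exact: cvL.
Qed.

End WeakCompactness.

(** * Lebesgue measure on the three-dimensional space *)

Lemma sigma_finite_product_measure d1 d2 (T1 : measurableType d1)
    (T2 : measurableType d2) (R : realType)
    (m1 : {sigma_finite_measure set T1 -> \bar R})
    (m2 : {sigma_finite_measure set T2 -> \bar R}) :
  sigma_finite [set: T1 * T2] (m1 \x m2)%E.
Proof.
have /sigma_finiteP[F [TF ndF Foo]] := sigma_finiteT m1.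
have /sigma_finiteP[G [TG ndG Goo]] := sigma_finiteT m2.
exists (fun n => F n `*` G n).
  apply/esym/seteqP; split => // -[x y] _.
  have [i _ Fix] : (\bigcup_i F i) x by rewrite -TF.
  have [j _ Gjy] : (\bigcup_i G i) y by rewrite -TG.
  exists (maxn i j) => //; split => /=.
    by have /subsetPset := ndF _ _ (leq_maxl i j); apply.
  by have /subsetPset := ndG _ _ (leq_maxr i j); apply.
move=> k; have [mF Fk] := Foo k; have [mG Gk] := Goo k.
split; first exact: measurableX.
by rewrite product_measure1E// lte_mul_pinfty// ge0_fin_numE.
Qed.

(* A copy of [\x]: the canonical sigma-finite structure that the library attaches
   to [\x] is the one for finite factors. *)
Definition sfproduct d1 d2 (T1 : measurableType d1) (T2 : measurableType d2)
    (R : realType) (m1 : {sigma_finite_measure set T1 -> \bar R})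
    (m2 : {sigma_finite_measure set T2 -> \bar R}) : set (T1 * T2) -> \bar R :=
  (m1 \x m2)%E.

Section ProductMeasure.
Context d1 d2 (T1 : measurableType d1) (T2 : measurableType d2) (R : realType).
Variables (m1 : {sigma_finite_measure set T1 -> \bar R})
  (m2 : {sigma_finite_measure set T2 -> \bar R}).

HB.instance Definition _ := Measure.copy (sfproduct m1 m2) (m1 \x m2)%E.
HB.instance Definition _ := Measure_isSigmaFinite.Build _ _ _
  (sfproduct m1 m2) (sigma_finite_product_measure m1 m2).

End ProductMeasure.

Section ProductOfThree.
Context (d1 d2 d3 : measure_display) (T1 : measurableType d1)
  (T2 : measurableType d2) (T3 : measurableType d3) (R : realType).
Variables (m1 : {sigma_finite_measure set T1 -> \bar R})
  (m2 : {sigma_finite_measure set T2 -> \bar R})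
  (m3 : {sigma_finite_measure set T3 -> \bar R}).


(** The pushforward of the product measure agrees with it on rectangles, and a product of
    sigma-finite measures is determined by its values there. *)
Lemma product_measure_preserving (f1 : T1 -> T1) (f2 : T2 -> T2) :
  measurable_fun setT f1 -> measurable_fun setT f2 ->
  (forall A, measurable A -> m1 (f1 @^-1` A) = m1 A) ->
  (forall A, measurable A -> m2 (f2 @^-1` A) = m2 A) ->
  forall A, measurable A ->
  (m1 \x m2)%E ((fun x => (f1 x.1, f2 x.2)) @^-1` A) = (m1 \x m2)%E A.
Proof.
move=> mf1 mf2 h1 h2 A mA; apply/esym.
have mf : measurable_fun setT (fun x : T1 * T2 => (f1 x.1, f2 x.2)).
  apply: measurable_fun_pair.
    exact: (measurableT_comp mf1 measurable_fst).
  exact: (measurableT_comp mf2 measurable_snd).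
apply: (@product_measure_unique _ _ _ _ _ m1 m2 (pushforward (m1 \x m2)%E (fun x => (f1 x.1, f2 x.2)))) => // B C mB mC.
rewrite /pushforward/= -h1// -h2// -product_measure1E//.
  by rewrite -[X in measurable X]setTI; exact: mf1.
by rewrite -[X in measurable X]setTI; exact: mf2.
Qed.

Definition product_measure3 : {sigma_finite_measure set (T1 * T2 * T3)%type -> \bar R} :=
  sfproduct (sfproduct m1 m2) m3.

End ProductOfThree.

Lemma product_measure3_preserving d1 d2 d3 (T1 : measurableType d1)
  (T2 : measurableType d2) (T3 : measurableType d3) (R : realType)
  (m1 : {sigma_finite_measure set T1 -> \bar R})
  (m2 : {sigma_finite_measure set T2 -> \bar R})
  (m3 : {sigma_finite_measure set T3 -> \bar R})
  (f1 : T1 -> T1) (f2 : T2 -> T2) (f3 : T3 -> T3) :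
  measurable_fun setT f1 -> measurable_fun setT f2 -> measurable_fun setT f3 ->
  (forall A, measurable A -> m1 (f1 @^-1` A) = m1 A) ->
  (forall A, measurable A -> m2 (f2 @^-1` A) = m2 A) ->
  (forall A, measurable A -> m3 (f3 @^-1` A) = m3 A) ->
  forall A, measurable A ->
  product_measure3 m1 m2 m3 ((fun x => (f1 x.1.1, f2 x.1.2, f3 x.2)) @^-1` A) =
  product_measure3 m1 m2 m3 A.
Proof.
move=> mf1 mf2 mf3 h1 h2 h3 A mA.
have mf : measurable_fun setT (fun x : T1 * T2 => (f1 x.1, f2 x.2)).
  apply: measurable_fun_pair.
    exact: (measurableT_comp mf1 measurable_fst).
  exact: (measurableT_comp mf2 measurable_snd).
exact: (@product_measure_preserving _ _ _ _ _ (sfproduct m1 m2) m3 _ _ mf mf3 (product_measure_preserving mf1 mf2 h1 h2) h3).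
Qed.

(** * Translation invariance *)

Section Translation.
Variable R : realType.
Notation R1 := (measurableTypeR R).
Notation T := (R3 R).

(** The measure [leb3 R] again, equipped with the sigma-finite structure that Fubini's theorem asks
    for. *)
Definition leb3s : {sigma_finite_measure set T -> \bar R} :=
  product_measure3 (@lebesgue_measure R) (@lebesgue_measure R) (@lebesgue_measure R).

Definition translate (a x : R1) : R1 := x + a.

Lemma measurable_translate (a : R) : measurable_fun [set: R1] (translate a).
Proof. by apply: measurable_funD => //; exact: measurable_cst. Qed.

Lemma lebesgue_measure_translate (a : R) (A : set R1) : measurable A ->
  lebesgue_measure (translate a @^-1` A) = lebesgue_measure A.
Proof.
move=> mA; apply/esym.
have mt := measurable_translate a.
rewrite -[RHS]/(pushforward lebesgue_measure (translate a) A).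
apply: lebesgue_measure_unique => // _ [[u v] _ <-] /=.
rewrite /pushforward.
have -> : translate a @^-1` `]u, v] = `]u - a, v - a]%classic.
  by apply/seteqP; split => x /=; rewrite !in_itv/= /translate ltrBlDr lerBrDr.
rewrite !lebesgue_measure_itv/= !lte_fin ltrD2r; case: ifPn => // _.
by rewrite -!EFinD; congr EFin; ring.
Qed.

Definition shift3 (h x : T) : T := x + h.

Lemma measurable_shift3 (h : T) : measurable_fun [set: T] (shift3 h).
Proof.
apply/measurable_fun_pairP; split; last first.
  exact: (measurableT_comp (measurable_translate h.2) measurable_snd).
apply/measurable_fun_pairP; split.
- exact: (measurableT_comp (measurable_translate h.1.1) (measurableT_comp measurable_fst measurable_fst)).
- exact: (measurableT_comp (measurable_translate h.1.2) (measurableT_comp measurable_snd measurable_fst)).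
Qed.

Lemma leb3_shift (h : T) (A : set T) : measurable A ->
  leb3 R (shift3 h @^-1` A) = leb3 R A.
Proof.
have mt := @measurable_translate; have lt := @lebesgue_measure_translate.
exact: (product_measure3_preserving (mt h.1.1) (mt h.1.2) (mt h.2)
  (lt h.1.1) (lt h.1.2) (lt h.2)).
Qed.

Lemma integrable_shift3 (h : T) (f : T -> R) :
  (leb3 R).-integrable setT (EFin \o f) ->
  (leb3 R).-integrable setT (EFin \o (fun x => f (x + h))).
Proof.
move=> /integrableP[mf lf]; apply/integrableP; split.
  exact: (measurableT_comp mf (measurable_shift3 h)).
move: lf; rewrite [X in (X < _)%E](_ : _ = \int[pushforward (leb3 R) (shift3 h)]_x `|(f x)%:E|)%E.
  rewrite ge0_integral_pushforward//; first exact: measurable_shift3.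
  exact: measurableT_comp.
apply: eq_measure_integral => [|? A mA _]; first exact: measurable_shift3.
exact/esym/leb3_shift.
Qed.

Lemma integral_shift3 (h : T) (f : T -> R) :
  (leb3 R).-integrable setT (EFin \o f) ->
  \int[leb3 R]_x f (x + h) = \int[leb3 R]_x f x.
Proof.
move=> intf; have /integrableP[mf lf] := intf.
congr fine; apply/esym.
rewrite (_ : \int[leb3 R]_x (f x)%:E = \int[pushforward (leb3 R) (shift3 h)]_x (f x)%:E)%E.
  rewrite integral_pushforward//; first exact: measurable_shift3.
  exact: integrable_shift3.
apply: eq_measure_integral => [|? A mA _]; first exact: measurable_shift3.
exact/esym/leb3_shift.
Qed.

End Translation.

(** * Cubes, open sets and measurability *)

Section Borel.
Variable R : realType.
Notation R1 := (measurableTypeR R).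
Notation T := (R3 R).

Lemma norm3_lt (x : T) (e : R) :
  (`|x| < e) = [&& `|x.1.1| < e, `|x.1.2| < e & `|x.2| < e].
Proof. by rewrite prod_normE /= !gt_max andbA. Qed.

Lemma norm3_le (x : T) (e : R) :
  (`|x| <= e) = [&& `|x.1.1| <= e, `|x.1.2| <= e & `|x.2| <= e].
Proof. by rewrite prod_normE /= !ge_max andbA. Qed.

Lemma measurable_coord1 : measurable_fun [set: T] (fun x => x.1.1 : R).
Proof. exact: (measurableT_comp measurable_fst measurable_fst). Qed.

Lemma measurable_coord2 : measurable_fun [set: T] (fun x => x.1.2 : R).
Proof. exact: (measurableT_comp measurable_snd measurable_fst). Qed.

Lemma measurable_coord3 : measurable_fun [set: T] (fun x => x.2 : R).
Proof. exact: measurable_snd. Qed.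

Lemma measurable_norm_shift (a : T) : measurable_fun [set: T] (fun x : T => `|x - a|).
Proof.
have -> : (fun x : T => `|x - a|) =
    (fun x : T => Num.max (Num.max `|x.1.1 - a.1.1| `|x.1.2 - a.1.2|) `|x.2 - a.2|).
  by apply/funext => x; rewrite prod_normE.
have m1 := measurable_coord1; have m2 := measurable_coord2; have m3 := measurable_coord3.
do 2?apply: measurable_maxr; apply: measurableT_comp => //; apply: measurable_funB => //.
Qed.

Lemma measurable_ball3 (a : T) (e : R) : measurable [set x : T | `|x - a| < e].
Proof.
rewrite -[X in measurable X]setTI.
have -> : [set x : T | `|x - a| < e] = (fun x => `|x - a|) @^-1` `]-oo, e[.
  by apply/seteqP; split => x /=; rewrite in_itv.
exact: (measurable_norm_shift a).
Qed.

Lemma open_normP (A : set T) x : open A -> A x ->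
  exists2 e : R, 0 < e & forall y, `|y - x| < e -> A y.
Proof.
rewrite openE => oA /oA; rewrite /interior/= => /nbhs_ballP[e /= e0 he]; exists e => // y xy.
by apply: he; rewrite ball_prod_normE /ball_/= distrC.
Qed.

(** This connects the topology with the sigma-algebra, which is generated by rectangles. Open cubes
    cover [A] while the closed ones stay inside: the closed cubes will also be the compact supports
    of cutoff functions. *)
Lemma open_union_cubes (A : set T) : open A -> exists (c : nat -> T) (r : nat -> R),
  (forall n x, `|x - c n| <= r n -> A x) /\
  (forall x, A x -> exists n, `|x - c n| < r n).
Proof.
move=> oA.
pose c (q : rat * rat * rat * nat) : T := (ratr q.1.1.1, ratr q.1.1.2, ratr q.1.2).
pose r (q : rat * rat * rat * nat) : R := (q.2.+1%:R)^-1.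
pose good q := [set x : T | `|x - c q| <= r q] `<=` A.
(* Numbers that encode no cube, or a cube that is not contained in [A], receive the radius -1 and
   thus the empty cube. *)
pose r' n := if unpickle n is Some q then if pselect (good q) then r q else - 1 else - 1.
pose c' n := if unpickle n is Some q then c q else 0.
exists c', r'; split => [n x|x Ax].
  have neg : `|x - c' n| <= - 1 -> A x.
    by move=> /(le_trans (normr_ge0 _)); rewrite oppr_ge0 ler10.
  by rewrite /r' /c'; rewrite /c' in neg; case: (unpickle n) neg => // q neg; case: pselect => //= h; exact: h.
have [e e0 he] := open_normP oA Ax.
have e20 : 0 < e / 2 by rewrite divr_gt0.
have [n hn] : exists n, (n.+1%:R)^-1 < e / 2.
  have := near_infty_natSinv_lt (PosNum e20); rewrite /= => h.
  by have [n] := filter_ex h; exists n.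
have n0 : 0 < (n.+1%:R)^-1 :> R by [].
have rat_near (t : R) : exists q, `|t - ratr q| < (n.+1%:R)^-1.
  move: (n.+1%:R^-1) n0 => e' e'0.
  have h : t - e' < t + e' by lra.
  have [q] := rat_in_itvoo h.
  by rewrite in_itv/= => hq; exists q; rewrite ltr_norml; lra.
have [q1 h1] := rat_near x.1.1; have [q2 h2] := rat_near x.1.2; have [q3 h3] := rat_near x.2.
have hx : `|x - c (q1, q2, q3, n)| < (n.+1%:R)^-1 by rewrite norm3_lt/= h1 h2 h3.
exists (pickle (q1, q2, q3, n)); rewrite /c' /r' pickleK; case: pselect => [_|[]]//.
move=> y /= hy; apply: he; rewrite -(subrKA (c (q1, q2, q3, n))) (le_lt_trans (ler_normD _ _))//.
rewrite [X in _ + X]distrC; move: hx hy hn; rewrite /r/=; move: (n.+1%:R^-1) => ?; lra.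
Qed.

Lemma open_measurable3 (A : set T) : open A -> measurable A.
Proof.
move=> oA; have [c [r [cr Acr]]] := open_union_cubes oA.
have -> : A = \bigcup_n [set x : T | `|x - c n| < r n].
  apply/seteqP; split => [x /Acr[n hn]|x [n _ /= hn]]; first by exists n.
  by apply: (cr n); exact: ltW.
by apply: bigcup_measurable => n _; exact: measurable_ball3.
Qed.

Lemma continuous_measurable3 (f : T -> R) : continuous f -> measurable_fun [set: T] f.
Proof.
move=> cf; apply: (measurability _ (RGenOpens.measurableE R)).
move=> _ [_ [a [b ->]] <-]; rewrite setTI; apply: open_measurable3.
by apply: open_comp => //; exact: interval_open.
Qed.

Lemma leb3_box_lt (M : R) : (leb3 R [set x : T | (`|x| <= M)%R] < +oo)%E.
Proof.
pose I := [set` `[- M, M]] : set R1.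
have -> : [set x : T | (`|x| <= M)%R] = I `*` I `*` I.
  apply/seteqP; split => x /=; rewrite norm3_le /I/= !in_itv/= -!ler_norml.
    by case/and3P.
  by case=> -[-> ->] ->.
have mI : measurable I by exact: measurable_itv.
have Ioo : (lebesgue_measure I < +oo)%E.
  by rewrite /I lebesgue_measure_itv/=; case: ifP => // _; rewrite -EFinD ltry.
have mul_lt (a b : \bar R) : (0 <= a)%E -> (a < +oo -> 0 <= b -> b < +oo -> a * b < +oo)%E.
  by move: a b => [a| |] [b| |]// _ _ _ _; rewrite -EFinM ltry.
rewrite /leb3 [X in (X < _)%E](@product_measure1E _ _ _ _ R _ lebesgue_measure (I `*` I) I)//; last exact: measurableX.
rewrite [X in (X * _ < _)%E](@product_measure1E _ _ _ _ R lebesgue_measure lebesgue_measure I I)//.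
by rewrite !mul_lt// mule_ge0.
Qed.

Lemma measurable_cball3 (M : R) : measurable [set x : T | `|x| <= M].
Proof.
rewrite -[X in measurable X]setTI.
have -> : [set x : T | (`|x| <= M)%R] = (fun x : T => `|x - 0|) @^-1` `]-oo, M].
  by apply/seteqP; split => x /=; rewrite in_itv/= subr0.
exact: (measurable_norm_shift 0).
Qed.

Lemma leb3_bounded_lt (A : set T) (M : R) : measurable A -> (forall x, A x -> `|x| <= M) ->
  (leb3 R A < +oo)%E.
Proof.
move=> mA AM; apply: le_lt_trans (leb3_box_lt M); apply: le_measure; rewrite ?inE//.
exact: measurable_cball3.
Qed.

Lemma bounded_support_integrable (f : T -> R) (M C : R) : measurable_fun [set: T] f ->
  (forall x, `|f x| <= C) -> (forall x, M < `|x| -> f x = 0) ->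
  (leb3 R).-integrable setT (EFin \o f).
Proof.
move=> mf fC f0.
pose B := [set x : T | (`|x| <= M)%R].
have mB : measurable B by exact: measurable_cball3.
apply/integrableP; split; first exact/measurable_EFinP.
have -> : (fun x => `|(EFin \o f) x|%E) = ((fun x => `|(EFin \o f) x|%E) \_ B).
  apply/funext => x; rewrite patchE; case: ifPn => // /negP xB.
  by rewrite /= f0 ?normr0// ltNge; apply/negP => h; apply: xB; rewrite inE.
rewrite -integral_mkcond.
apply: (@le_lt_trans _ _ (\int[leb3 R]_(x in B) C%:E)%E).
  apply: ge0_le_integral => //.
  - by apply/measurable_EFinP; apply: measurableT_comp => //; exact: measurable_funTS.
  - by move=> x _ /=; rewrite lee_fin.
rewrite integral_cst//; apply: lte_mul_pinfty => //; last exact: leb3_box_lt.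
by rewrite lee_fin (le_trans _ (fC 0)).
Qed.

Lemma bounded_support_sqint (f : T -> R) (M C : R) : measurable_fun [set: T] f ->
  (forall x, `|f x| <= C) -> (forall x, M < `|x| -> f x = 0) -> sqint (leb3 R) setT f.
Proof.
move=> mf fC f0; apply: sqintP => //.
apply: (@bounded_support_integrable (fun x => f x ^+ 2) M (C ^+ 2)).
- exact: measurable_funX.
- by move=> x; rewrite normrX lerXn2r ?nnegrE// (le_trans _ (fC x)).
- by move=> x /f0 ->; rewrite expr0n.
Qed.

Lemma compact_box (M : R) : compact [set x : T | `|x| <= M].
Proof.
have -> : [set x : T | (`|x| <= M)%R] = (`[- M, M]%classic `*` `[- M, M]%classic) `*` `[- M, M]%classic.
  apply/seteqP; split => x /=; rewrite norm3_le !in_itv/= -!ler_norml.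
    by case/and3P.
  by case=> -[-> ->] ->.
by apply: compact_setX; [apply: compact_setX|]; exact: segment_compact.
Qed.

Lemma continuous_compact_bounded (f : T -> R) (M : R) : continuous f ->
  (forall x, M < `|x| -> f x = 0) -> exists C, forall x, `|f x| <= C.
Proof.
move=> cf f0.
have := continuous_compact (continuous_subspaceT cf) (@compact_box M).
move=> /compact_bounded [C [_ hC]]; exists (`|C| + 1) => x.
have hM : C < `|C| + 1 by have := ler_norm C; lra.
have [xM|xM] := leP `|x| M; first by apply: (hC _ hM); exists x.
by rewrite f0// normr0 addr_ge0.
Qed.

End Borel.

(** * Smooth functions and integration by parts *)

Lemma is_derive_comp_opp (R : realType) (g : R -> R) (a : R) :
  is_derive (0 : R) 1 g a -> is_derive (0 : R) 1 (fun t => g (- t)) (- a).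
Proof.
move=> dg; rewrite -[- a]mulrN1.
by apply: (@is_derive1_comp R g -%R); rewrite ?oppr0//; exact: is_deriveN.
Qed.

Lemma derive_lincomb (R : realType) (V : normedModType R) (f g : V -> R) (a : R) x v :
  derivable f x v -> derivable g x v ->
  'D_v (fun x => a * f x + g x) x = a * 'D_v f x + 'D_v g x.
Proof.
move=> df dg.
have hf := @is_deriveZ _ _ _ f a x v _ (derivableP df).
have [_ h] := @is_deriveD _ _ _ _ g x v _ _ hf (derivableP dg).
exact: h.
Qed.

Lemma is_derive_unique (R : realType) (f g : R -> R) (x a b : R) :
  is_derive x 1 f a -> is_derive x 1 g b -> f =1 g -> a = b.
Proof. by move=> [_ <-] [_ <-] /funext ->. Qed.

Section Smooth.
Variable R : realType.
Notation T := (R3 R).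
Implicit Types (f g : T -> R) (k : 'I_3).

Lemma derivable_lineE f (x v : T) (t : R) :
  (fun h : R => h^-1 *: (((fun s : R => f (x + s *: v)) \o shift t) (h *: 1) - f (x + t *: v)))
  = (fun h : R => h^-1 *: ((f \o shift (x + t *: v)) (h *: v) - f (x + t *: v))).
Proof.
apply/funext => h /=; congr (_ *: (f _ - _)).
by rewrite scaler1 scalerDl addrCA.
Qed.

Lemma derivable_line f (x v : T) (t : R) : derivable f (x + t *: v) v ->
  is_derive t 1 (fun s : R => f (x + s *: v)) ('D_v f (x + t *: v)).
Proof. by move=> df; split; rewrite /derivable /derive derivable_lineE. Qed.

Lemma derivative_translateE f (x h v : T) :
  (fun s : R => s^-1 *: (((fun y => f (y + h)) \o shift x) (s *: v) - f (x + h)))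
  = (fun s : R => s^-1 *: ((f \o shift (x + h)) (s *: v) - f (x + h))).
Proof. by apply/funext => s /=; rewrite addrA. Qed.

Lemma derivable_translate f (x h v : T) : derivable f (x + h) v ->
  derivable (fun y => f (y + h)) x v.
Proof. by rewrite /derivable derivative_translateE. Qed.

Lemma partial_translate k f (h : T) :
  partial k (fun y => f (y + h)) = (fun y => partial k f (y + h)).
Proof. by apply/funext => x; rewrite /partial /derive derivative_translateE. Qed.

(** [smooth] speaks of words of directions, which suits differentiation but not products: the
    Leibniz rule turns one word into a sum over many. Recursion on the order makes closure under
    products a plain induction; [smoothP] links the two forms. *)
Fixpoint Ck (n : nat) f : Prop := continuous f /\
  if n is m.+1 then
    forall k, (forall x, derivable f x (unit3 R k)) /\ Ck m (partial k f)
  else True.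

Lemma smooth_continuous f : smooth f -> continuous f.
Proof. by move=> /(_ [::])[]. Qed.

Lemma smooth_derivable f x k : smooth f -> derivable f x (unit3 R k).
Proof. by move=> /(_ [::])[_]; apply. Qed.

Lemma smooth_partial k f : smooth f -> smooth (partial k f).
Proof. by move=> sf s; have := sf (rcons s k); rewrite foldr_rcons. Qed.

Lemma smoothP f : smooth f <-> forall n, Ck n f.
Proof.
split=> [sf n|].
  elim: n f sf => [|n IH] f sf; split => //; try exact: smooth_continuous.
  by move=> k; split => [x|]; [exact: smooth_derivable|apply: IH; exact: smooth_partial].
move=> hf s; elim/last_ind: s f hf => [|s k IH] f hf.
  by split; [case: (hf 0%N)|move=> x k; have [_ /(_ k)[]] := hf 1%N].
by rewrite foldr_rcons; apply: IH => n; have [_ /(_ k)[]] := hf n.+1.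
Qed.

Lemma Ck_continuous n f : Ck n f -> continuous f.
Proof. by case: n => [|n] []. Qed.

Lemma CkW n f : Ck n.+1 f -> Ck n f.
Proof.
elim: n f => [|n IH] f [cf h]; split => // k; have [dk hk] := h k.
by split => //; exact: IH.
Qed.

Lemma Ck0 n : Ck n (cst 0).
Proof.
have p0 k : partial k (cst 0 : T -> R) = cst 0.
  by apply/funext => x; rewrite /partial derive_cst.
by elim: n => [|n IH]; split => //; try exact: cst_continuous; move=> k; rewrite p0.
Qed.

Lemma Ck_cst n c : Ck n (cst c).
Proof.
have p0 k : partial k (cst c : T -> R) = cst 0.
  by apply/funext => x; rewrite /partial derive_cst.
by case: n => [|n]; split => //; try exact: cst_continuous; move=> k; rewrite p0; split => //; exact: Ck0.
Qed.

Lemma partialD k f g : (forall x, derivable f x (unit3 R k)) ->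
  (forall x, derivable g x (unit3 R k)) ->
  partial k (f \+ g) = partial k f \+ partial k g.
Proof. by move=> df dg; apply/funext => x; rewrite /partial deriveD. Qed.

Lemma partialM k f g : (forall x, derivable f x (unit3 R k)) ->
  (forall x, derivable g x (unit3 R k)) ->
  partial k (f \* g) = (f \* partial k g) \+ (g \* partial k f).
Proof. by move=> df dg; apply/funext => x; rewrite /partial deriveM. Qed.

Lemma CkD n f g : Ck n f -> Ck n g -> Ck n (f \+ g).
Proof.
elim: n f g => [|n IH] f g [cf hf] [cg hg].
  by split => // x; apply: cvgD; [exact: cf|exact: cg].
split => [x|k]; first by apply: cvgD; [exact: cf|exact: cg].
have [df Hf] := hf k; have [dg Hg] := hg k.
split => [x|]; first exact: derivableD.
by rewrite partialD//; exact: IH.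
Qed.

Lemma CkM n f g : Ck n f -> Ck n g -> Ck n (f \* g).
Proof.
elim: n f g => [|n IH] f g Cf Cg; have cf := Ck_continuous Cf; have cg := Ck_continuous Cg.
  by split => // x; apply: cvgM; [exact: cf|exact: cg].
split => [x|k]; first by apply: cvgM; [exact: cf|exact: cg].
have [_ /(_ k)[df Hf]] := Cf; have [_ /(_ k)[dg Hg]] := Cg.
split => [x|]; first exact: derivableM.
by rewrite partialM//; apply: CkD; apply: IH => //; exact: CkW.
Qed.

Lemma continuous_translate f (h : T) : continuous f -> continuous (fun x : T => f (x + h)).
Proof.
move=> cf x; have ch : (y + h) @[y --> x] --> x + h.
  by apply: cvgD; [exact: cvg_id|exact: cvg_cst].
exact: (cvg_comp _ _ ch (cf _)).
Qed.

Lemma Ck_translate n f (h : T) : Ck n f -> Ck n (fun x => f (x + h)).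
Proof.
elim: n f => [|n IH] f [cf hf].
  by split => //; exact: continuous_translate.
split => [|k]; first exact: continuous_translate.
have [df Hf] := hf k.
split => [x|]; first exact: derivable_translate.
by rewrite partial_translate; exact: IH.
Qed.

Lemma smooth_cst c : smooth (cst c : T -> R).
Proof. by apply/smoothP => n; exact: Ck_cst. Qed.

Lemma smoothD f g : smooth f -> smooth g -> smooth (f \+ g).
Proof. by move=> /smoothP sf /smoothP sg; apply/smoothP => n; exact: CkD. Qed.

Lemma smoothM f g : smooth f -> smooth g -> smooth (f \* g).
Proof. by move=> /smoothP sf /smoothP sg; apply/smoothP => n; exact: CkM. Qed.

Lemma smooth_translate f h : smooth f -> smooth (fun x => f (x + h)).
Proof. by move=> /smoothP sf; apply/smoothP => n; exact: Ck_translate. Qed.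

Lemma smoothL a f g : smooth f -> smooth g -> smooth (fun x => a * f x + g x).
Proof.
move=> sf sg; apply: (smoothD _ sg); exact: (smoothM (smooth_cst a) sf).
Qed.

Lemma partialL k a f g : smooth f -> smooth g ->
  partial k (fun x => a * f x + g x) = (fun x => a * partial k f x + partial k g x).
Proof.
move=> sf sg; apply/funext => x; rewrite /partial.
have df := @smooth_derivable f x k sf; have dg := @smooth_derivable g x k sg.
exact: derive_lincomb.
Qed.

Definition testfun f := smooth f /\ exists M, forall x, M < `|x| -> f x = 0.

Lemma testfun_smooth f : testfun f -> smooth f. Proof. by case. Qed.

Lemma partial_support k f (M : R) : (forall x, M < `|x| -> f x = 0) ->
  forall x, M < `|x| -> partial k f x = 0.
Proof.
move=> f0 x xM; rewrite /partial (@near_eq_derive _ _ _ f (cst 0)) ?derive_cst//.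
have : \forall y \near x, M < `|y|.
  by apply: (cvgr_gt _ (@norm_continuous _ _ x)).
by apply: filterS => y /f0.
Qed.

Lemma testfun_partial k f : testfun f -> testfun (partial k f).
Proof.
move=> [sf [M f0]]; split; first exact: smooth_partial.
by exists M; exact: partial_support.
Qed.

Lemma testfun_translate f (h : T) : testfun f -> testfun (fun x => f (x + h)).
Proof.
move=> [sf [M f0]]; split; first exact: smooth_translate.
exists (M + `|h|) => x hx; apply: f0.
have : `|x| <= `|x + h| + `|h| by rewrite -{1}(addrK h x) ler_normB.
lra.
Qed.

Lemma testfunM f g : smooth f -> testfun g -> testfun (f \* g).
Proof.
move=> sf [sg [M g0]]; split; first exact: smoothM.
by exists M => x /g0 /= ->; rewrite mulr0.
Qed.

Lemma testfun_bounded f : testfun f -> exists C, forall x, `|f x| <= C.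
Proof.
by move=> [sf [M f0]]; apply: (continuous_compact_bounded (smooth_continuous sf) f0).
Qed.

Lemma testfun_measurable f : testfun f -> measurable_fun [set: T] f.
Proof. by move=> [sf _]; apply: continuous_measurable3; exact: smooth_continuous. Qed.

Lemma testfun_integrable f : testfun f -> (leb3 R).-integrable setT (EFin \o f).
Proof.
move=> tf; have [C fC] := testfun_bounded tf; have [_ [M f0]] := tf.
exact: (bounded_support_integrable (testfun_measurable tf) fC f0).
Qed.

Lemma testfun_sqint f : testfun f -> sqint (leb3 R) setT f.
Proof.
move=> tf; have [C fC] := testfun_bounded tf; have [_ [M f0]] := tf.
exact: (bounded_support_sqint (testfun_measurable tf) fC f0).
Qed.

Lemma testfun_line_derivative f k (x : T) (t : R) : smooth f ->
  is_derive t 1 (fun s : R => f (x + s *: unit3 R k)) (partial k f (x + t *: unit3 R k)).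
Proof. by move=> sf; apply: derivable_line; exact: smooth_derivable. Qed.

(** Differentiation under the integral sign, dominated by [|w|] times a bound of [partial k chi].
    Integration by parts and the exchange of mixed derivatives are both drawn from it. *)
Lemma derivative_integral_translate (w chi : T -> R) k (a : R) :
  testfun w -> testfun chi ->
  is_derive a 1 (fun t : R => \int[leb3 R]_x (w x * chi (x + t *: unit3 R k)))
    (\int[leb3 R]_x (w x * partial k chi (x + a *: unit3 R k))).
Proof.
move=> tw tchi; have sc := testfun_smooth tchi.
have [C hC] := testfun_bounded (testfun_partial k tchi).
pose f (t : R) (x : T) : R := w x * chi (x + t *: unit3 R k).
pose G (x : T) := `|w x| * C.
have C0 : 0 <= C by apply: le_trans (hC 0).
have Ia : (`]a - 1, a + 1[%classic : set R) a by rewrite /= in_itv/=; apply/andP; split; lra.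
have fd (t : R) (x : T) : is_derive t 1 (f ^~ x) (w x * partial k chi (x + t *: unit3 R k)).
  have h := @testfun_line_derivative chi k x t sc.
  exact: (is_deriveZ (w x) h).
have intf t : (leb3 R).-integrable setT (EFin \o f t).
  apply: testfun_integrable.
  apply: (@testfunM w (fun x => chi (x + t *: unit3 R k))); first exact: testfun_smooth.
  exact: testfun_translate.
have d1E t x : partial1of2 f t x = w x * partial k chi (x + t *: unit3 R k).
  by rewrite partial1of2E; have [_ <-] := fd t x.
have G0 x : 0 <= G x by rewrite /G mulr_ge0.
have intG : (leb3 R).-integrable setT (EFin \o G).
  have h := integrableZr measurableT C (integrable_norm (testfun_integrable tw)).
  by apply: eq_integrable h.
have Gub t x : `|partial1of2 f t x| <= G x by rewrite d1E normrM /G ler_wpM2l.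
have df t x : derivable (f ^~ x) t 1 by have [] := fd t x.
have D := @derivable_under_integral R _ _ (leb3 R) f setT measurableT a (a - 1) (a + 1) Ia (fun x _ => intf x) (fun t x _ _ => df t x) G G0 intG (fun t x _ _ => Gub t x).
have E := @differentiation_under_integral R _ _ (leb3 R) f setT measurableT a (a - 1) (a + 1) Ia (fun x _ => intf x) (fun t x _ _ => df t x) G G0 intG (fun t x _ _ => Gub t x).
split; first exact: D.
rewrite -derive1E E; apply: eq_Rintegral => x _; exact: d1E.
Qed.

(** By translation invariance the integral of [chi(x) phi(x + t e_k)] equals that of
    [phi(x) chi(x - t e_k)]. Both sides are differentiated at [t = 0]. *)
Lemma integration_by_parts3 (phi chi : T -> R) k : testfun phi -> testfun chi ->
  \int[leb3 R]_x (partial k phi x * chi x) = - \int[leb3 R]_x (phi x * partial k chi x).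
Proof.
move=> tp tc.
have D1 := @derivative_integral_translate chi phi k 0 tc tp.
have D2 := @derivative_integral_translate phi chi k 0 tp tc.
have E t : \int[leb3 R]_x (chi x * phi (x + t *: unit3 R k)) =
    \int[leb3 R]_x (phi x * chi (x + (- t) *: unit3 R k)).
  rewrite -(@integral_shift3 R (- t *: unit3 R k)).
    by apply: eq_Rintegral => x _; rewrite scaleNr subrK mulrC.
  apply: testfun_integrable.
  apply: (@testfunM chi (fun x => phi (x + t *: unit3 R k))); first exact: testfun_smooth.
  exact: testfun_translate.
have D2' : is_derive (0 : R) 1 (fun t : R => \int[leb3 R]_x (phi x * chi (x + (- t) *: unit3 R k)))
    (- \int[leb3 R]_x (phi x * partial k chi (x + 0 *: unit3 R k))).
  exact: (is_derive_comp_opp D2).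
have : \int[leb3 R]_x (chi x * partial k phi (x + 0 *: unit3 R k)) =
   - \int[leb3 R]_x (phi x * partial k chi (x + 0 *: unit3 R k)).
  exact: (is_derive_unique D1 D2' E).
under eq_Rintegral do rewrite scale0r addr0 mulrC.
by under [in X in _ = X -> _]eq_Rintegral do rewrite scale0r addr0.
Qed.

(* Equality of mixed partials in weak form: both sides are the derivative at
   [t = 0] of the integral of [phi (x + t e_i) * partial j chi x]. *)
Lemma integral_partial_swap (phi chi : T -> R) i j : testfun phi -> testfun chi ->
  \int[leb3 R]_x (partial i phi x * partial j chi x) =
  \int[leb3 R]_x (partial j phi x * partial i chi x).
Proof.
move=> tp tc.
have tdc := testfun_partial j tc; have tdp := testfun_partial j tp.
have D1 := @derivative_integral_translate (partial j chi) phi i 0 tdc tp.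
have D2 := @derivative_integral_translate (partial j phi) chi i 0 tdp tc.
have E t : \int[leb3 R]_x (partial j chi x * phi (x + t *: unit3 R i)) =
    - \int[leb3 R]_x (partial j phi x * chi (x + (- t) *: unit3 R i)).
  have tpt := testfun_translate (t *: unit3 R i) tp.
  rewrite (integration_by_parts3 j tc tpt); congr (- _).
  rewrite -(@integral_shift3 R (- t *: unit3 R i)).
    by apply: eq_Rintegral => x _; rewrite partial_translate scaleNr subrK mulrC.
  apply: testfun_integrable.
  apply: testfunM; first exact: testfun_smooth.
  exact: testfun_partial.
have D2' : is_derive (0 : R) 1 (fun t : R => - \int[leb3 R]_x (partial j phi x * chi (x + (- t) *: unit3 R i)))
    (- (- \int[leb3 R]_x (partial j phi x * partial i chi (x + 0 *: unit3 R i)))).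
  exact: (is_deriveN (is_derive_comp_opp D2)).
have : \int[leb3 R]_x (partial j chi x * partial i phi (x + 0 *: unit3 R i)) =
   - - \int[leb3 R]_x (partial j phi x * partial i chi (x + 0 *: unit3 R i)).
  exact: (is_derive_unique D1 D2' E).
rewrite opprK.
under eq_Rintegral do rewrite scale0r addr0 mulrC.
by under [in X in _ = X -> _]eq_Rintegral do rewrite scale0r addr0.
Qed.


Lemma sum_cyclic3 (V : nmodType) (F : 'I_3 -> 'I_3 -> 'I_3 -> V) :
  \sum_i F i (i + 1) (i + 2%:R) = F 0 1 2%:R + F 1 2%:R 0 + F 2%:R 0 1.
Proof.
rewrite !big_ord_recl big_ord0 addr0 addrA.
by congr (F _ _ _ + F _ _ _ + F _ _ _); apply/val_inj.
Qed.

Lemma sum3 (V : nmodType) (F : 'I_3 -> V) : \sum_i F i = F 0 + F 1 + F 2%:R.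
Proof. by rewrite (sum_cyclic3 (fun i _ _ => F i)). Qed.

Definition rcurl (u : 'I_3 -> T -> R) : 'I_3 -> T -> R :=
  fun i x => partial (i + 1) (u (i + 2%:R)) x - partial (i + 2%:R) (u (i + 1)) x.

Definition testfield (u : 'I_3 -> T -> R) := forall i, testfun (u i).

Lemma testfunL a f g : testfun f -> testfun g -> testfun (fun x => a * f x + g x).
Proof.
move=> [sf [M f0]] [sg [N g0]]; split; first exact: smoothL.
exists (Num.max M N) => x; rewrite gt_max => /andP[/f0 -> /g0 ->].
by rewrite mulr0 addr0.
Qed.

Lemma testfunB f g : testfun f -> testfun g -> testfun (fun x => f x - g x).
Proof.
move=> tf tg; have := testfunL (- 1) tg tf; congr testfun.
by apply/funext => x; rewrite mulN1r addrC.
Qed.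

Lemma testfield_rcurl u : testfield u -> testfield (rcurl u).
Proof. by move=> tu i; apply: testfunB; exact: testfun_partial. Qed.

Lemma rcurl_translate (u : 'I_3 -> T -> R) h :
  rcurl (fun i x => u i (x + h)) = fun i x => rcurl u i (x + h).
Proof. by apply/funext => i; apply/funext => x; rewrite /rcurl !partial_translate. Qed.

Lemma testfun_mul_integrable f g : testfun f -> testfun g ->
  (leb3 R).-integrable setT (EFin \o (fun x => f x * g x)).
Proof.
by move=> tf tg; apply: testfun_integrable; apply: (testfunM (testfun_smooth tf) tg).
Qed.

(** Let [A i j k] be the integral of [d_i u_j d_k chi]. Exchanging derivatives gives
    [A i j k = A k j i], and the six terms of the cyclic sum cancel in pairs. *)
Lemma integral_rcurl_gradient u chi : testfield u -> testfun chi ->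
  \sum_i \int[leb3 R]_x (rcurl u i x * partial i chi x) = 0.
Proof.
move=> tu tc.
pose A i j k := \int[leb3 R]_x (partial i (u j) x * partial k chi x).
have swap i j k : A i j k = A k j i by exact: integral_partial_swap.
have split_int i : \int[leb3 R]_x (rcurl u i x * partial i chi x) =
    A (i + 1) (i + 2%:R) i - A (i + 2%:R) (i + 1) i.
  rewrite /A -RintegralB//; first by apply: eq_Rintegral => x _; rewrite /rcurl mulrBl.
    by apply: testfun_mul_integrable; exact: testfun_partial.
  by apply: testfun_mul_integrable; exact: testfun_partial.
rewrite (eq_bigr _ (fun i _ => split_int i)).
move: A swap {split_int} => A swap.
rewrite (sum_cyclic3 (fun i j k => A j k i - A k j i)).
rewrite (swap 1 2%:R 0) (swap 2%:R 0 1) (swap 0 1 2%:R); ring.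
Qed.

End Smooth.

(** * Translation estimate and mollification *)

Lemma chain3_le (R : realDomainType) (a b c d q : R) :
  `|a - c| <= q -> `|c - d| <= q -> `|d - b| <= q -> `|a - b| <= 3 * q.
Proof. rewrite !ler_norml; lra. Qed.

Lemma lt_of_far (R : realDomainType) (r n1 n2 n3 : R) :
  n1 <= r -> 2 * r + 1 <= n2 -> n2 <= n3 + n1 -> 0 <= r -> r < n3.
Proof. lra. Qed.

Lemma mvt_bound (R : realType) (f df : R -> R) (K t : R) :
  (forall x : R, is_derive x 1 f (df x)) -> (forall x, `|df x| <= K) ->
  `|f t - f 0| <= `|t| * K.
Proof.
move=> fd dfK.
have cf : continuous f.
  by move=> x; apply/differentiable_continuous/derivable1_diffP; have [] := fd x.
have main a b : a <= b -> `|f b - f a| <= `|b - a| * K.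
  move=> ab; have [|c _ ->] := MVT_segment ab (fun x _ => fd x).
    exact: continuous_subspaceT.
  by rewrite normrM mulrC ler_wpM2l.
have [t0|t0] := leP 0 t; first by have := main _ _ t0; rewrite subr0.
by have := main _ _ (ltW t0); rewrite distrC sub0r normrN.
Qed.

Section TranslationEstimate.
Variable R : realType.
Notation T := (R3 R).
Notation ipvT := (ipv (leb3 R) [set: T]).

Lemma sqintv_testfield (u : 'I_3 -> T -> R) : testfield u -> sqintv (leb3 R) setT u.
Proof. by move=> tu i; exact: testfun_sqint. Qed.

Lemma ip_shift3 (f g : T -> R) (h : T) : testfun f -> testfun g ->
  ip (leb3 R) setT (fun x => f (x + h)) (fun x => g (x + h)) = ip (leb3 R) setT f g.
Proof.
by move=> tf tg; rewrite /ip (integral_shift3 h (testfun_mul_integrable tf tg)).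
Qed.

(** The [k]-th derivative of [v] minus the gradient of [v k]. Of its three entries one vanishes and
    the other two are components of the curl of [v] up to sign. *)
Definition jacobian_skew (v : 'I_3 -> T -> R) (k : 'I_3) : 'I_3 -> T -> R :=
  fun i x => partial k (v i) x - partial i (v k) x.

Lemma testfield_jacobian_skew v k : testfield v -> testfield (jacobian_skew v k).
Proof. by move=> tv i; apply: testfunB; exact: testfun_partial. Qed.

Lemma I3_addE : ((0 + 1 = 1 :> 'I_3)%R * (0 + 2%:R = 2%:R :> 'I_3)%R *
  (1 + 1 = 2%:R :> 'I_3)%R * (1 + 2%:R = 0 :> 'I_3)%R *
  (2%:R + 1 = 0 :> 'I_3)%R * (2%:R + 2%:R = 1 :> 'I_3)%R)%type.
Proof. by do !split; apply/val_inj. Qed.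

Lemma I3_cases (k : 'I_3) : [\/ k = 0, k = 1 | k = 2%:R].
Proof.
by case: k => -[|[|[|//]]] p; [apply: Or31|apply: Or32|apply: Or33]; apply/val_inj.
Qed.

(** Stated for an abstract [B] insensitive to signs, so that only index arithmetic modulo 3 is left;
    the square norm is the intended instance. The component of the curl that does not occur on the
    left accounts for the inequality. *)
Lemma sum_jacobian_skew_le (B : (T -> R) -> R) v k : (forall f, 0 <= B f) ->
  (forall f, (forall x, f x = 0) -> B f = 0) ->
  (forall f g, (forall x, f x = g x \/ f x = - g x) -> B f = B g) ->
  \sum_i B (jacobian_skew v k i) <= \sum_i B (rcurl v i).
Proof.
move=> B_ge0 B0 BE; have := B_ge0 (rcurl v 0); have := B_ge0 (rcurl v 1).
have := B_ge0 (rcurl v 2%:R); rewrite !sum3.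
have skew0 i : B (jacobian_skew v i i) = 0.
  by apply: B0 => x; rewrite /jacobian_skew subrr.
have [-> | -> | ->] := I3_cases k.
- have -> : B (jacobian_skew v 0 0) + B (jacobian_skew v 0 1) + B (jacobian_skew v 0 2%:R) =
      0 + B (rcurl v 2%:R) + B (rcurl v 1).
    congr (_ + _ + _); [exact: skew0|apply: BE => x; left|apply: BE => x; right];
    by rewrite /rcurl !I3_addE ?opprB.
  lra.
- have -> : B (jacobian_skew v 1 0) + B (jacobian_skew v 1 1) + B (jacobian_skew v 1 2%:R) =
      B (rcurl v 2%:R) + 0 + B (rcurl v 0).
    congr (_ + _ + _); [apply: BE => x; right|exact: skew0|apply: BE => x; left];
    by rewrite /rcurl !I3_addE ?opprB.
  lra.
- have -> : B (jacobian_skew v 2%:R 0) + B (jacobian_skew v 2%:R 1) + B (jacobian_skew v 2%:R 2%:R) =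
      B (rcurl v 1) + B (rcurl v 0) + 0.
    congr (_ + _ + _); [apply: BE => x; left|apply: BE => x; right|exact: skew0];
    by rewrite /rcurl !I3_addE ?opprB.
  lra.
Qed.

Lemma ipv_jacobian_skew_le v k :
  ipvT (jacobian_skew v k) (jacobian_skew v k) <= ipvT (rcurl v) (rcurl v).
Proof.
apply: (@sum_jacobian_skew_le (fun f => ip (leb3 R) setT f f)).
- by move=> f; apply: Rintegral_ge0 => x _; rewrite -expr2 sqr_ge0.
- move=> f f0; rewrite /ip (@eq_Rintegral _ _ _ _ _ (cst 0)); last by move=> x _; rewrite f0 mul0r.
  by rewrite Rintegral_cst// mul0r.
- by move=> f g fg; apply: eq_Rintegral => x _; have [->|->] := fg x; rewrite ?mulrNN.
Qed.

Definition pairing (u v : 'I_3 -> T -> R) (h : T) : R :=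
  \sum_i \int[leb3 R]_x (u i x * v i (x + h)).

Lemma is_derive_pairing u v k (t : R) : testfield u -> testfield v ->
  is_derive t 1 (fun s : R => pairing u v (s *: unit3 R k))
    (\sum_i \int[leb3 R]_x (u i x * partial k (v i) (x + t *: unit3 R k))).
Proof.
move=> tu tv.
have h i := @derivative_integral_translate R _ _ k t (tu i) (tv i).
have -> : (fun s : R => pairing u v (s *: unit3 R k)) =
    \sum_i (fun s : R => \int[leb3 R]_x (u i x * v i (x + s *: unit3 R k))).
  by apply/funext => s; rewrite fct_sumE.
exact: (is_derive_sum h).
Qed.

(* The gradient part of the derivative of [v] along [e_k] is orthogonal to the
   curl [rcurl u], and what remains is a component of the curl of [v]. *)
Lemma pairing_axis_le u v k (t M N : R) : testfield u -> testfield v ->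
  0 <= M -> 0 <= N ->
  ipvT (rcurl u) (rcurl u) <= M ^+ 2 -> ipvT (rcurl v) (rcurl v) <= N ^+ 2 ->
  `|pairing (rcurl u) v (t *: unit3 R k) - pairing (rcurl u) v 0| <= `|t| * (M * N).
Proof.
move=> tu tv M0 N0 uM vN.
have tD := testfield_rcurl tu.
have Pv := sqintv_prehilbert (leb3 R) (@measurableT _ T) 'I_3.
have fd s := is_derive_pairing k s tD tv.
have bnd (s : R) :
    `|\sum_i \int[leb3 R]_x (rcurl u i x * partial k (v i) (x + s *: unit3 R k))| <= M * N.
  pose c := fun i x => jacobian_skew v k i (x + s *: unit3 R k).
  have tc : testfield c.
    by move=> i; apply: testfun_translate; exact: testfield_jacobian_skew.
  have tvk := testfun_translate (s *: unit3 R k) (tv k).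
  have -> : \sum_i \int[leb3 R]_x (rcurl u i x * partial k (v i) (x + s *: unit3 R k)) =
      ipvT (rcurl u) c.
    pose G i := \int[leb3 R]_x (rcurl u i x *
      partial i (fun x0 : T => v k (x0 + s *: unit3 R k)) x).
    have G0 : \sum_i G i = 0 by exact: (integral_rcurl_gradient tu tvk).
    transitivity (\sum_i (ip (leb3 R) setT (rcurl u i) (c i) + G i)); last first.
      by rewrite big_split/= G0 addr0.
    apply: eq_bigr => i _; rewrite /G partial_translate /ip -RintegralD//.
    + by apply: eq_Rintegral => x _; rewrite -mulrDr /c /jacobian_skew subrK.
    + exact: testfun_mul_integrable.
    + by apply: testfun_mul_integrable => //; apply: testfun_translate; exact: testfun_partial.
  apply: (norm_le_cs Pv); [exact: sqintv_testfield|exact: sqintv_testfield|by []|by []|by []|].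
  apply: le_trans vN; apply: le_trans (ipv_jacobian_skew_le v k).
  rewrite le_eqVlt; apply/orP; left; apply/eqP; apply: eq_bigr => i _.
  by apply: ip_shift3; exact: testfield_jacobian_skew.
have := mvt_bound t fd bnd.
by rewrite scale0r.
Qed.

Lemma pairing_translate u v (a h : T) :
  pairing u (fun i x => v i (x + a)) h = pairing u v (h + a).
Proof. by apply: eq_bigr => i _; apply: eq_Rintegral => x _; rewrite addrA. Qed.

Lemma norm3_coords (x : T) : [/\ `|x.1.1| <= `|x|, `|x.1.2| <= `|x| & `|x.2| <= `|x|].
Proof. by have := norm3_le x `|x|; rewrite lexx => /esym/and3P. Qed.

Lemma axis_decomposition (h : T) :
  h = h.1.1 *: unit3 R 0 + (h.1.2 *: unit3 R 1 + h.2 *: unit3 R 2%:R).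
Proof.
case: h => -[a b] c; rewrite /unit3 /pt !mxE /=.
by do 2?apply: injective_projections; rewrite /= /GRing.scale/= !(mulr0, mulr1, addr0, add0r).
Qed.

(** The path from 0 to [h] follows the three axes in turn. Each leg is an axis estimate for a
    translate of [v], whose curl has the same norm; hence the factor 3 and the maximum norm of
    [h]. *)
Lemma pairing_translate_le u v (h : T) (M N : R) : testfield u -> testfield v ->
  0 <= M -> 0 <= N ->
  ipvT (rcurl u) (rcurl u) <= M ^+ 2 -> ipvT (rcurl v) (rcurl v) <= N ^+ 2 ->
  `|pairing (rcurl u) v h - pairing (rcurl u) v 0| <= 3 * `|h| * (M * N).
Proof.
move=> tu tv M0 N0 uM vN.
have step k (t : R) (a : T) : `|t| <= `|h| ->
    `|pairing (rcurl u) v (t *: unit3 R k + a) - pairing (rcurl u) v a| <= `|h| * (M * N).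
  move=> th; pose va := fun i x => v i (x + a).
  have tva : testfield va by move=> i; exact: testfun_translate.
  have vaN : ipvT (rcurl va) (rcurl va) <= N ^+ 2.
    apply: le_trans vN; rewrite le_eqVlt; apply/orP; left; apply/eqP.
    rewrite /va rcurl_translate; apply: eq_bigr => i _.
    by apply: ip_shift3; exact: testfield_rcurl.
  have := pairing_axis_le k t tu tva M0 N0 uM vaN.
  rewrite !pairing_translate add0r => H; apply: (le_trans H).
  by rewrite ler_wpM2r// mulr_ge0.
have [h1 h2 h3] : [/\ `|h.1.1| <= `|h|, `|h.1.2| <= `|h| & `|h.2| <= `|h|].
  exact: norm3_coords.
have s1 := step 0 _ (h.1.2 *: unit3 R 1 + h.2 *: unit3 R 2%:R) h1.
have s2 := step 1 _ (h.2 *: unit3 R 2%:R) h2.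
have s3 := step 2%:R _ 0 h3; rewrite addr0 in s3.
rewrite -axis_decomposition in s1.
by rewrite -mulrA; apply: chain3_le s1 s2 s3.
Qed.

(** Both fields live in the cube of half-side [r], so a shift by [2 r + 1] along the first axis
    separates their supports and the pairing vanishes there. The axis estimate bounds the change
    from that zero to the value without shift. *)
Lemma poincare_pairing u v (r M N : R) : testfield u -> testfield v ->
  0 <= M -> 0 <= N -> 0 <= r ->
  (forall i x, r < `|x| -> u i x = 0) -> (forall i x, r < `|x| -> v i x = 0) ->
  ipvT (rcurl u) (rcurl u) <= M ^+ 2 -> ipvT (rcurl v) (rcurl v) <= N ^+ 2 ->
  `|pairing (rcurl u) v 0| <= (2 * r + 1) * (M * N).
Proof.
move=> tu tv M0 N0 r0 u0 v0 uM vN.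
have := pairing_axis_le 0 (2 * r + 1) tu tv M0 N0 uM vN.
have -> : pairing (rcurl u) v ((2 * r + 1) *: unit3 R 0) = 0.
  apply: big1 => i _; rewrite (@eq_Rintegral _ _ _ _ _ (cst 0)) ?Rintegral_cst ?mul0r//.
  move=> x _; have [xr|xr] := ltP r `|x|.
    by rewrite /rcurl !(@partial_support _ _ _ r) ?subrr ?mul0r//; exact: u0.
  rewrite v0 ?mulr0//.
  have h1 : 2 * r + 1 <= `|(2 * r + 1) *: unit3 R 0|.
    have [n1 _ _] := norm3_coords ((2 * r + 1) *: unit3 R 0); apply: le_trans n1.
    by rewrite /unit3 /pt !mxE/= /GRing.scale/= mulr1 ler_norm.
  have h2 : `|(2 * r + 1) *: unit3 R 0| <= `|x + (2 * r + 1) *: unit3 R 0| + `|x|.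
    by rewrite -{1}(addKr x (_ *: _)) addrC ler_normB.
  exact: (lt_of_far xr h1 h2 r0).
have r1 : 0 <= 2 * r + 1 by rewrite addr_ge0// mulr_ge0.
by rewrite sub0r normrN (ger0_norm r1).
Qed.

End TranslationEstimate.

(** * Fubini's theorem under a product bound *)

Section DominatedFubini.
Context d1 d2 (T1 : measurableType d1) (T2 : measurableType d2) (R : realType).
Variables (m1 : {sigma_finite_measure set T1 -> \bar R})
  (m2 : {sigma_finite_measure set T2 -> \bar R}).
Variables (f : T1 * T2 -> R) (p : T1 -> R) (q : T2 -> R).
Hypotheses (mf : measurable_fun setT f) (ip_ : m1.-integrable setT (EFin \o p))
  (iq : m2.-integrable setT (EFin \o q)).
Hypothesis fpq : forall x y, `|f (x, y)| <= p x * q y.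

Let inner2 x : m2.-integrable setT (EFin \o (fun y => f (x, y))).
Proof.
apply: (@le_integrable _ _ _ m2 _ measurableT _ (fun y => (p x * q y)%:E)).
- by apply/measurable_EFinP; exact: measurable_fun_pair2.
- by move=> y _ /=; rewrite lee_fin (le_trans (fpq x y))// ler_norm.
- exact: (integrableZl measurableT (p x) iq).
Qed.

Let inner1 y : m1.-integrable setT (EFin \o (fun x => f (x, y))).
Proof.
apply: (@le_integrable _ _ _ m1 _ measurableT _ (fun x => (p x * q y)%:E)).
- by apply/measurable_EFinP; exact: measurable_fun_pair1.
- by move=> x _ /=; rewrite lee_fin (le_trans (fpq x y))// ler_norm.
- exact: (integrableZr measurableT (q y) ip_).
Qed.

Let imf : (m1 \x m2)%E.-integrable setT (EFin \o f).
Proof.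
apply/integrable12ltyP; first exact/measurable_EFinP.
apply: (@le_lt_trans _ _ (\int[m1]_x (`|p x| * \int[m2]_y `|q y|)%:E)%E).
  apply: ge0_le_integral => //.
  - by move=> x _; apply: integral_ge0 => y _; rewrite lee_fin.
  - apply: (@measurable_fun_fubini_tonelli_F _ _ _ _ _ m2 (fun z => `|(f z)%:E|%E)) => //.
    by apply/measurable_EFinP; exact: measurableT_comp.
  - apply/measurable_EFinP; apply: measurable_funM => //.
    by apply: measurableT_comp => //; have /integrableP[/measurable_EFinP] := ip_.
  - move=> x _.
    rewrite EFinM; rewrite [in leRHS]/Rintegral fineK; last first.
      by apply: integrable_fin_num => //; exact: integrable_norm.
    rewrite -ge0_integralZl//; first last.
    + by have /integrableP[/measurable_EFinP h _] := iq; apply/measurable_EFinP; exact: measurableT_comp.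
    apply: ge0_le_integral => //.
    + apply/measurable_EFinP; apply: measurableT_comp => //; exact: measurable_fun_pair2.
    + apply/measurable_EFinP; apply: measurable_funM => //.
      by apply: measurableT_comp => //; have /integrableP[/measurable_EFinP] := iq.
    + by move=> y _ /=; rewrite lee_fin (le_trans (fpq x y))// -normrM ler_norm.
have := integrable_lty measurableT (integrableZr measurableT (\int[m2]_y `|q y|) (integrable_norm ip_)).
by [].
Qed.

Lemma fubini_dominated :
  \int[m1]_x \int[m2]_y f (x, y) = \int[m2]_y \int[m1]_x f (x, y).
Proof.
rewrite /Rintegral; congr fine.
transitivity (\int[m1]_x \int[m2]_y (EFin \o f) (x, y))%E.
  by apply: eq_integral => x _; rewrite fineK//; exact: (integrable_fin_num measurableT (inner2 x)).
rewrite (Fubini imf); apply: eq_integral => y _.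
by rewrite fineK//; exact: (integrable_fin_num measurableT (inner1 y)).
Qed.

Lemma fubini_dominated_measurable :
  measurable_fun setT (fun y => \int[m1]_x f (x, y)).
Proof.
have := measurable_fubini_G imf => h.
apply: (measurableT_comp (fine_measurable measurableT)) => //.
Qed.

End DominatedFubini.

(** * Mollification and the pairing with a curl *)

Section Mollification.
Variable R : realType.
Notation T := (R3 R).
Notation ipvT := (ipv (leb3 R) [set: T]).

Lemma measurable_add3 : measurable_fun [set: T * T] (fun z : T * T => z.1 + z.2).
Proof.
have m1 := @measurable_coord1 R; have m2 := @measurable_coord2 R; have m3 := @measurable_coord3 R.
have m1f := measurableT_comp m1 (@measurable_fst _ _ T T).
have m2f := measurableT_comp m2 (@measurable_fst _ _ T T).
have m3f := measurableT_comp m3 (@measurable_fst _ _ T T).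
have m1s := measurableT_comp m1 (@measurable_snd _ _ T T).
have m2s := measurableT_comp m2 (@measurable_snd _ _ T T).
have m3s := measurableT_comp m3 (@measurable_snd _ _ T T).
have -> : (fun z : T * T => z.1 + z.2) =
  (fun z : T * T => (z.1.1.1 + z.2.1.1 : measurableTypeR R, z.1.1.2 + z.2.1.2 : measurableTypeR R,
     z.1.2 + z.2.2 : measurableTypeR R)).
  by apply/funext => -[[[? ?] ?] [[? ?] ?]].
apply: measurable_fun_pair; last exact: measurable_funD.
by apply: measurable_fun_pair; exact: measurable_funD.
Qed.

Variables (eta : T -> R) (delta : R).
Hypotheses (teta : testfun eta) (eta0 : forall x, 0 <= eta x)
  (inteta : \int[leb3 R]_x eta x = 1) (suppeta : forall x, delta < `|x| -> eta x = 0).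

(** Substituting [y = x + h] shows the average of the translates [f(x + h)] with weight [eta(h)];
    the sign inside [eta] is chosen so that the shifts are those of [pairing]. *)
Definition mollify (f : T -> R) (x : T) : R := \int[leb3 R]_y (f y * eta (y - x)).

Lemma integral_mul_mollify (f g : T -> R) : testfun f -> testfun g ->
  (leb3 R).-integrable setT (EFin \o (fun h => eta h * \int[leb3 R]_x (f x * g (x + h)))) /\
  \int[leb3 R]_x (f x * mollify g x) =
  \int[leb3 R]_h (eta h * \int[leb3 R]_x (f x * g (x + h))).
Proof.
move=> tf tg.
have [C gC] := testfun_bounded tg.
pose G (z : T * T) := eta z.2 * (f z.1 * g (z.1 + z.2)).
have mG : measurable_fun [set: T * T] G.
  apply: measurable_funM; first exact: (measurableT_comp (testfun_measurable teta) measurable_snd).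
  apply: measurable_funM; first exact: (measurableT_comp (testfun_measurable tf) measurable_fst).
  exact: (measurableT_comp (testfun_measurable tg) measurable_add3).
have nf := integrable_norm (testfun_integrable tf).
have ieta := testfun_integrable teta.
have intf : (leb3s R).-integrable setT (EFin \o (fun x => C * `|f x|)).
  exact: (integrableZl measurableT C nf).
have GE x y : `|G (x, y)| <= (C * `|f x|) * eta y.
  rewrite /G normrM (ger0_norm (eta0 _)) mulrC; apply: ler_wpM2r; first exact: eta0.
  by rewrite normrM mulrC; apply: ler_wpM2r => //; exact: gC.
have tgh h : testfun (fun x => g (x + h)) by exact: testfun_translate.
have inner h : \int[leb3 R]_x G (x, h) = eta h * \int[leb3 R]_x (f x * g (x + h)).
  by rewrite -RintegralZl//; exact: testfun_mul_integrable.
split.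
  apply: (@le_integrable _ _ _ (leb3 R) _ measurableT _ (fun h => ((\int[leb3 R]_x (C * `|f x|)) * eta h)%:E)).
  - apply/measurable_EFinP; have := @fubini_dominated_measurable _ _ _ _ R (leb3s R) (leb3s R) G _ _ mG intf ieta GE.
    by apply: eq_measurable_fun => h _; exact: inner.
  - move=> h _ /=; rewrite lee_fin -inner [leRHS]ger0_norm; last first.
      rewrite mulr_ge0//; apply: Rintegral_ge0 => x _; rewrite mulr_ge0//.
      exact: le_trans (gC 0).
    have iGh : (leb3 R).-integrable setT (EFin \o (fun x => G (x, h))).
      exact: (integrableZl measurableT (eta h) (testfun_mul_integrable tf (tgh h))).
    rewrite (le_trans (le_normr_Rintegral measurableT iGh))//.
    rewrite -RintegralZr//; apply: le_Rintegral => //.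
    + exact: (integrable_norm iGh).
    + exact: (integrableZr measurableT (eta h) intf).
  - exact: (integrableZl measurableT _ ieta).
have := @fubini_dominated _ _ _ _ R (leb3s R) (leb3s R) G _ _ mG intf ieta GE.
rewrite [X in _ = X -> _](_ : _ = \int[leb3 R]_h (eta h * \int[leb3 R]_x (f x * g (x + h)))); last first.
  by apply: eq_Rintegral => h _; exact: inner.
move=> <-; apply: eq_Rintegral => x _.
have tex : testfun (fun y => eta (y - x)) by exact: testfun_translate.
rewrite /mollify -(integral_shift3 x (testfun_mul_integrable tg tex)).
have ix : (leb3 R).-integrable setT (EFin \o (fun h => g (h + x) * eta (h + x - x))).
  exact: (integrable_shift3 x (testfun_mul_integrable tg tex)).
rewrite -(RintegralZl (f x) measurableT ix).
apply: eq_Rintegral => h _; rewrite /G /= addrK [h + x]addrC.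
by rewrite mulrA mulrC.
Qed.

(** By Fubini the mollified pairing is the average of [pairing (rcurl u) v h] with weight [eta h].
    As [eta] has mass 1 and vanishes beyond [delta], only shifts with [|h| <= delta] contribute,
    each with an error of at most [3 delta M N]. The error involves the curls alone. *)
Lemma mollified_pairing u v (M N : R) : testfield u -> testfield v ->
  0 <= M -> 0 <= N ->
  ipvT (rcurl u) (rcurl u) <= M ^+ 2 -> ipvT (rcurl v) (rcurl v) <= N ^+ 2 ->
  `|pairing (rcurl u) v 0 - \sum_i \int[leb3 R]_x (rcurl u i x * mollify (v i) x)|
    <= 3 * delta * (M * N).
Proof.
move=> tu tv M0 N0 uM vN.
have tD := testfield_rcurl tu.
have ieta := testfun_integrable teta.
have D := fun i => integral_mul_mollify (tD i) (tv i).
pose p := pairing (rcurl u) v.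
have pE h : eta h * p h = \sum_i (eta h * \int[leb3 R]_x (rcurl u i x * v i (x + h))).
  by rewrite mulr_sumr.
have ip_ : (leb3 R).-integrable setT (EFin \o (fun h => eta h * p h)).
  have := integrableD measurableT (integrableD measurableT (D 0).1 (D 1).1) (D 2%:R).1.
  by apply: eq_integrable => // h _; rewrite /= pE sum3 !EFinD.
have sumE : \sum_i \int[leb3 R]_x (rcurl u i x * mollify (v i) x) =
    \int[leb3 R]_h (eta h * p h).
  under [RHS]eq_Rintegral do rewrite pE sum3.
  rewrite sum3 (D 0).2 (D 1).2 (D 2%:R).2 RintegralD//; first congr (_ + _).
  - by rewrite RintegralD//; [exact: (D 0).1|exact: (D 1).1].
  - exact: (integrableD measurableT (D 0).1 (D 1).1).
  - exact: (D 2%:R).1.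
have p0E : pairing (rcurl u) v 0 = \int[leb3 R]_h (eta h * p 0).
  by rewrite RintegralZr// inteta mul1r.
have ip0 : (leb3 R).-integrable setT (EFin \o (fun h => eta h * p 0)).
  exact: (integrableZr measurableT (p 0) ieta).
have MN0 : 0 <= M * N by rewrite mulr_ge0.
rewrite sumE p0E -RintegralB//.
have iB := integrableB measurableT ip0 ip_.
rewrite (le_trans (le_normr_Rintegral measurableT iB))//.
have -> : 3 * delta * (M * N) = \int[leb3 R]_h (eta h * (3 * delta * (M * N))).
  by rewrite RintegralZr// inteta mul1r.
apply: le_Rintegral => //.
- exact: (integrable_norm iB).
- exact: (integrableZr measurableT _ ieta).
- move=> h _; rewrite -mulrBr normrM ger0_norm//.
  have [hd|hd] := ltP delta `|h|; first by rewrite suppeta// !mul0r.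
  apply: ler_wpM2l => //; rewrite distrC.
  apply: (le_trans (pairing_translate_le h tu tv M0 N0 uM vN)).
  by apply: ler_wpM2r => //; apply: ler_wpM2l.
Qed.

End Mollification.

(** * Bump functions *)

Section FlatFunction.
Variable R : realType.
Implicit Types (p : {poly R}) (x t : R).

(** The polynomial factor makes the class closed under differentiation: the derivative of [flat p]
    is [flat (flat_next p)], at 0 as well. All derivatives of [exp(-1/x)], extended by zero, are
    thus treated at once. *)
Definition flat p x : R := if 0 < x then p.[x^-1] * expR (- x^-1) else 0.

Definition flat_next p : {poly R} := 'X^2 * (p - p^`()).

Lemma exp_bound (n : nat) t : 0 <= t -> t ^+ n <= n`!%:R * expR t.
Proof.
move=> t0; case: n => [|n]; first by rewrite expr0 mul1r -expR0 ler_expR.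
have h := expR_ge1Dxn n t0.
have f0 : 0 < (n.+1)`!%:R :> R by rewrite ltr0n fact_gt0.
rewrite mulrC -ler_pdivrMr//; lra.
Qed.

Lemma horner_expR_bounded p : exists2 C, 0 <= C &
  forall t, 0 <= t -> `|p.[t]| * expR (- t) <= C.
Proof.
exists (\sum_(i < size p) `|p`_i| * i`!%:R).
  by apply: sumr_ge0 => i _; rewrite mulr_ge0.
move=> t t0; rewrite expRN ler_pdivrMr ?expR_gt0// horner_coef.
apply: (le_trans (ler_norm_sum _ _ _)); rewrite mulr_suml; apply: ler_sum => i _.
rewrite normrM -mulrA ler_wpM2l// ger0_norm ?exprn_ge0//; exact: exp_bound.
Qed.

(* Flatness at [0]: [flat p x = O(x ^ 2)]. *)
Lemma flat_le p : exists2 C, 0 <= C & forall x, `|flat p x| <= C * x ^+ 2.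
Proof.
have [C C0 hC] := horner_expR_bounded ('X^2 * p); exists C => // x.
rewrite /flat; case: ltP => x0; last by rewrite normr0 mulr_ge0 ?sqr_ge0.
have xn0 : x != 0 by rewrite gt_eqF.
have := hC x^-1; rewrite invr_ge0 (ltW x0) => /(_ isT).
rewrite hornerM hornerXn normrM [`|_ ^+ 2|]ger0_norm ?sqr_ge0// exprVn.
rewrite -mulrA mulrC ler_pdivrMr ?exprn_gt0// => h.
by rewrite normrM [`|expR _|]ger0_norm ?expR_ge0.
Qed.

Lemma is_derive_flat_pos p x : 0 < x -> is_derive x 1 (flat p) (flat (flat_next p) x).
Proof.
move=> x0; have xn0 : x != 0 by rewrite gt_eqF.
have dinv : is_derive x 1 (fun y : R => y^-1) (- x ^- 2).
  by have := @is_deriveV _ (@id R) x 1 1 xn0 _; rewrite scaler1; apply.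
have dp := is_derive1_comp (is_derive_poly p x^-1) dinv.
have dm : is_derive x 1 (fun y : R => - y^-1) (x ^- 2).
  by rewrite -[x ^- 2]opprK; exact: is_deriveN.
have de := @is_derive1_comp R expR (fun y : R => - y^-1) x _ _ (is_derive_expR _) dm.
have [D E] := is_deriveM dp de.
have nearE : \forall y \near x, flat p y = ((horner p \o (fun y : R => y^-1)) * (expR \o (fun y : R => - y^-1))) y.
  have : \forall y \near x, 0 < y by exact: lt_nbhsr.
  by apply: filterS => y y0; rewrite /flat y0.
split.
  by move: D; apply: near_eq_derivable; exact: filterS nearE.
rewrite (near_eq_derive _ nearE) E /flat x0 /flat_next !hornerE /= /GRing.scale/=.
rewrite exprVn; ring.
Qed.

Lemma is_derive_flat_neg p x : x < 0 -> is_derive x 1 (flat p) (flat (flat_next p) x).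
Proof.
move=> x0.
have nearE : \forall y \near x, flat p y = cst 0 y.
  have : \forall y \near x, y < 0 by exact: lt_nbhsl.
  by apply: filterS => y y0; rewrite /flat ltNge (ltW y0).
split.
  have := @derivable_cst R R R 0 x 1; apply: near_eq_derivable.
  by apply: filterS nearE => y ->.
rewrite (near_eq_derive _ nearE) derive_cst /flat.
by rewrite ltNge (ltW x0).
Qed.

Lemma is_derive_flat0 p : is_derive (0 : R) 1 (flat p) (flat (flat_next p) 0).
Proof.
have [C C0 hC] := flat_le p.
have f0 q : flat q 0 = 0 by rewrite /flat ltxx.
have key : h^-1 *: ((flat p \o shift (0 : R)) (h *: 1) - flat p 0) @[h --> 0^'] --> (0 : R).
  apply/cvgrPdist_le => e e0; near=> h.
  rewrite sub0r normrN f0 subr0 /= addr0 scaler1 /GRing.scale/= normrM normfV.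
  have h0 : h != 0 by near: h; exact: nbhs_dnbhs_neq.
  rewrite ler_pdivrMl ?normr_gt0// (le_trans (hC _))//.
  rewrite -(real_normK (num_real h)) expr2 mulrCA ler_wpM2l//.
  have : `|h| <= e / (C + 1).
    by near: h; apply: dnbhs0_le; rewrite divr_gt0//; lra.
  rewrite ler_pdivlMr; last by lra.
  by have := normr_ge0 h; nra.
split; first by apply/cvg_ex; exists 0.
by rewrite f0; apply/cvg_lim.
Unshelve. all: by end_near. Qed.

Lemma is_derive_flat p x : is_derive x 1 (flat p) (flat (flat_next p) x).
Proof.
have [x0|x0|->] := ltgtP x 0; first exact: is_derive_flat_neg.
  exact: is_derive_flat_pos.
exact: is_derive_flat0.
Qed.

Definition bump x : R := flat 1 x.

Lemma bumpE x : bump x = if 0 < x then expR (- x^-1) else 0.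
Proof. by rewrite /bump /flat hornerE mul1r. Qed.

Lemma bump_ge0 x : 0 <= bump x.
Proof. by rewrite bumpE; case: ifP => // _; exact: expR_ge0. Qed.

Lemma bump_le1 x : bump x <= 1.
Proof.
rewrite bumpE; case: ifP => // x0.
by rewrite -expR0 ler_expR oppr_le0 invr_ge0 ltW.
Qed.

Lemma bump_eq0 x : x <= 0 -> bump x = 0.
Proof. by rewrite bumpE ltNge => ->. Qed.

Lemma bump_homo x y : x <= y -> bump x <= bump y.
Proof.
move=> xy; rewrite [bump x]bumpE; case: ifP => [x0|_]; last exact: bump_ge0.
have y0 := lt_le_trans x0 xy.
by rewrite bumpE y0 ler_expR lerN2 lef_pV2.
Qed.

Lemma bump_gt0 x : 0 < x -> 0 < bump x.
Proof. by move=> x0; rewrite bumpE x0 expR_gt0. Qed.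

Lemma cvg_bump x : bump (k%:R * x) @[k --> \oo] --> ((0 < x)%R%:R : R).
Proof.
have [x0|x0] := ltP 0 x; last first.
  apply: cvg_near_cst; apply: nearW => k; rewrite bump_eq0//.
  by rewrite mulr_ge0_le0.
have h : - (k%:R * x)^-1 @[k --> \oo] --> (0 : R).
  rewrite -oppr0; apply: cvgN.
  have pos : \forall k \near \oo, 0 < k%:R * x.
    by exists 1%N => // k /= k1; rewrite pmulr_lgt0// ltr0n.
  have [_ h] := @gtr0_cvgV0 R nat \oo _ (fun k : nat => k%:R * x) pos; apply: h.
  apply/cvgryPge => A; near=> k.
  by rewrite -ler_pdivrMr//; near: k; exact: nbhs_infty_ger.
have : expR (- (k%:R * x)^-1) @[k --> \oo] --> (1 : R).
  by rewrite -[X in _ --> X]expR0; exact: (cvg_comp _ _ h (@continuous_expR R 0)).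
apply: cvg_trans; apply: near_eq_cvg; exists 1%N => // k /= k1.
by rewrite bumpE pmulr_lgt0// ltr0n k1.
Unshelve. all: by end_near. Qed.

End FlatFunction.

(** * Smooth cutoffs of cubes and mollifiers *)

Section CoordinateBumps.
Variable R : realType.
Notation T := (R3 R).

Definition crd (j : 'I_3) (x : T) : R := nth 0 [:: x.1.1; x.1.2; x.2] j.

Lemma crd_line (j k : 'I_3) (h : R) (x : T) :
  crd j (h *: unit3 R k + x) = h * (j == k)%:R + crd j x.
Proof.
rewrite /crd /unit3 /pt !mxE /= /GRing.scale/=.
by case: j => -[|[|[|//]]] pj; case: k => -[|[|[|//]]] pk;
  rewrite -!val_eqE /= /GRing.scale/= ?mulr0 ?mulr1.
Qed.

Lemma crdB j x y : crd j (x - y) = crd j x - crd j y.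
Proof. by rewrite /crd; case: j => -[|[|[|//]]]. Qed.

Lemma crd_le_norm j x : `|crd j x| <= `|x|.
Proof.
by rewrite /crd; have [h1 h2 h3] := norm3_coords x; case: j => -[|[|[|//]]].
Qed.

Lemma norm_lt_crd x (e : R) : (`|x| < e) = [forall j, `|crd j x| < e].
Proof.
apply/idP/forallP => [xe j|h]; first exact: le_lt_trans (crd_le_norm j x) xe.
by rewrite norm3_lt; apply/and3P; split; [exact: (h 0)|exact: (h 1)|exact: (h 2%:R)].
Qed.

Lemma crd_continuous j : continuous (crd j : T -> R).
Proof.
move=> x; apply/cvgrPdist_le => e e0.
have := nbhsx_ballx (x : T) e e0; apply: filterS => y.
rewrite ball_prod_normE /ball_/= -crdB => /ltW; exact/le_trans/crd_le_norm.
Qed.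

Lemma is_derive_crd (F : R -> R) (l : R) (j k : 'I_3) (x : T) :
  is_derive (crd j x) 1 F l ->
  derivable (F \o crd j) x (unit3 R k) /\ 'D_(unit3 R k) (F \o crd j) x = (j == k)%:R * l.
Proof.
move=> [dF <-]; have [jk|jk] := eqVneq j k; last first.
  have E : (fun h : R => h^-1 *: (((F \o crd j) \o shift x) (h *: unit3 R k) - (F \o crd j) x)) = cst 0.
    apply/funext => h /=; rewrite crd_line (negbTE jk) mulr0 add0r subrr.
    by rewrite scaler0.
  rewrite /derivable /derive E mul0r; split; first exact: is_cvg_cst.
  by apply/cvg_lim => //; exact: cvg_cst.
have E : (fun h : R => h^-1 *: (((F \o crd j) \o shift x) (h *: unit3 R k) - (F \o crd j) x)) =
    (fun h : R => h^-1 *: ((F \o shift (crd j x)) (h *: 1) - F (crd j x))).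
  by apply/funext => h /=; rewrite crd_line jk eqxx mulr1 scaler1.
by rewrite mul1r /derivable /derive E; split.
Qed.

(** Iterated derivatives are supplied as a sequence [F] in which each function is the derivative of
    its predecessor, which gives the induction on the order a closed form. *)
Lemma Ck_crd (F : nat -> R -> R) (n m : nat) (j : 'I_3) :
  (forall i (s : R), is_derive s 1 (F i) (F i.+1 s)) -> Ck n (F m \o crd j).
Proof.
move=> dF.
have cF i : continuous (F i \o crd j).
  move=> x; have cFi : {for crd j x, continuous (F i)}.
    by apply/differentiable_continuous/derivable1_diffP; have [] := dF i (crd j x).
  exact: (cvg_comp _ _ (@crd_continuous j x) cFi).
elim: n m => [|n IH] m; first by split.
split => // k; split => [x|]; first by have [] := @is_derive_crd _ _ j k x (dF m (crd j x)).
have -> : partial k (F m \o crd j) = cst ((j == k)%:R : R) \* (F m.+1 \o crd j).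
  by apply/funext => x; rewrite /partial (@is_derive_crd _ _ j k x (dF m (crd j x))).2.
by apply: CkM; [exact: Ck_cst|exact: IH].
Qed.

Lemma smooth_bump_crd j (a b : R) : smooth (fun x : T => bump (a * crd j x + b)).
Proof.
(* [q n] is the polynomial factor of the [n]-th derivative of [bump]; the powers of [a] in [F] come
   from the chain rule. *)
pose q := fix q n : {poly R} := if n is m.+1 then flat_next (q m) else 1.
pose F n (s : R) : R := a ^+ n * flat (q n) (a * s + b).
apply/smoothP => n.
have -> : (fun x : T => bump (a * crd j x + b)) = F 0%N \o crd j.
  by apply/funext => x; rewrite /F /= expr0 mul1r.
apply: Ck_crd => i s.
have da : is_derive s 1 (fun s : R => a * s + b) a.
  have := is_deriveD (is_deriveZ a (is_derive_id s (1 : R))) (is_derive_cst b s 1).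
  by rewrite addr0 /GRing.scale/= mulr1.
have := is_deriveZ (a ^+ i) (@is_derive1_comp R (flat (q i)) (fun s : R => a * s + b) s _ _ (is_derive_flat (q i) (a * s + b)) da).
have -> : F i.+1 s = a ^+ i *: (flat (flat_next (q i)) (a * s + b) * a).
  by rewrite /F exprSr -mulrA; congr (_ * _); rewrite mulrC.
by [].
Qed.

Definition slab_bump (r : R) (k : nat) (c : T) (j : 'I_3) (x : T) : R :=
  bump (k%:R * (r - (crd j x - crd j c))) * bump (k%:R * (r + (crd j x - crd j c))).

(* Positive exactly on the open ball of center [c] and radius [r] for the
   maximum norm, which is a cube; as [k] goes to infinity it converges to the
   indicator of that cube. *)
Definition cube_bump (r : R) (k : nat) (c x : T) : R :=
  slab_bump r k c 0 x * (slab_bump r k c 1 x * slab_bump r k c 2%:R x).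

Lemma smooth_slab_bump r k c j : smooth (slab_bump r k c j).
Proof.
apply: smoothM.
  have := smooth_bump_crd j (- k%:R) (k%:R * (r + crd j c)).
  by congr smooth; apply/funext => x; congr bump; ring.
have := smooth_bump_crd j k%:R (k%:R * (r - crd j c)).
by congr smooth; apply/funext => x; congr bump; ring.
Qed.

Lemma smooth_cube_bump r k c : smooth (cube_bump r k c).
Proof.
have sj := smooth_slab_bump r k c.
exact: (smoothM (sj 0) (smoothM (sj 1) (sj 2%:R))).
Qed.

Lemma slab_bump_ge0 r k c j x : 0 <= slab_bump r k c j x.
Proof. by rewrite mulr_ge0// bump_ge0. Qed.

Lemma slab_bump_le1 r k c j x : slab_bump r k c j x <= 1.
Proof. by rewrite mulr_ile1 ?bump_ge0 ?bump_le1. Qed.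

Lemma cube_bump_ge0 r k c x : 0 <= cube_bump r k c x.
Proof. by apply: mulr_ge0; [|apply: mulr_ge0]; exact: slab_bump_ge0. Qed.

Lemma cube_bump_le1 r k c x : cube_bump r k c x <= 1.
Proof.
have g := slab_bump_ge0 r k c; have l := slab_bump_le1 r k c.
by apply: mulr_ile1 => //; [exact: mulr_ge0|exact: mulr_ile1].
Qed.

Lemma slab_bump_eq0 r k c j x : r <= `|crd j x - crd j c| -> slab_bump r k c j x = 0.
Proof.
rewrite /slab_bump ler_normr => /orP[h|h].
  by rewrite bump_eq0 ?mul0r// mulr_ge0_le0// subr_le0.
by rewrite [X in _ * X]bump_eq0 ?mulr0// mulr_ge0_le0//; move: h; lra.
Qed.

Lemma cube_bump_eq0 r k c x : r <= `|x - c| -> cube_bump r k c x = 0.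
Proof.
rewrite leNgt norm_lt_crd negb_forall => /existsP[j]; rewrite -leNgt crdB => hj.
rewrite /cube_bump; have [e|e|e] := I3_cases j; rewrite e in hj.
- by rewrite (slab_bump_eq0 k hj) mul0r.
- by rewrite (slab_bump_eq0 k hj) mul0r mulr0.
- by rewrite (slab_bump_eq0 k hj) !mulr0.
Qed.

Lemma cvg_cube_bump r c x :
  cube_bump r k c x @[k --> \oo] --> ((`|x - c| < r)%R%:R : R).
Proof.
have [xr|xr] := ltP `|x - c| r; last first.
  by apply: cvg_near_cst; apply: nearW => k; rewrite cube_bump_eq0.
have hj j : slab_bump r k c j x @[k --> \oo] --> (1 : R).
  have : `|crd j x - crd j c| < r by rewrite -crdB (le_lt_trans (crd_le_norm _ _)).
  rewrite ltr_norml => /andP[h1 h2]; rewrite -[X in _ --> X]mulr1; apply: cvgM.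
    by have := @cvg_bump R (r - (crd j x - crd j c)); rewrite subr_gt0 h2.
  have := @cvg_bump R (r + (crd j x - crd j c)).
  by have -> : (0 < r + (crd j x - crd j c)) by lra.
rewrite (_ : true%:R = 1 * (1 * 1) :> R); last by rewrite !mulr1.
by apply: cvgM; [|apply: cvgM]; exact: hj.
Qed.

Lemma cube_bump_lower (r : R) k c x : 0 < r -> `|x - c| <= r / 2 ->
  bump (k%:R * (r / 2)) ^+ 6 <= cube_bump r k c x.
Proof.
move=> r0 xr; set b := bump _; have b0 : 0 <= b by exact: bump_ge0.
have sj j : b * b <= slab_bump r k c j x.
  have : `|crd j x - crd j c| <= r / 2 by rewrite -crdB (le_trans (crd_le_norm _ _)).
  by rewrite ler_norml => /andP[h1 h2]; apply: ler_pM => //; apply: bump_homo;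
    rewrite ler_wpM2l//; lra.
have -> : b ^+ 6 = (b * b) * ((b * b) * (b * b)) by ring.
by apply: ler_pM; rewrite ?mulr_ge0//; apply: ler_pM; rewrite ?mulr_ge0.
Qed.

Lemma leb3_cube_gt0 (r : R) : 0 < r -> (0 < leb3 R [set x : T | (`|x| <= r)%R])%E.
Proof.
move=> r0.
pose I := [set` `[- r, r]] : set (measurableTypeR R).
have -> : [set x : T | (`|x| <= r)%R] = I `*` I `*` I.
  apply/seteqP; split => x /=; rewrite norm3_le /I/= !in_itv/= -!ler_norml.
    by case/and3P.
  by case=> -[-> ->] ->.
have mI : measurable I by exact: measurable_itv.
have I0 : (0 < lebesgue_measure I)%E.
  rewrite /I lebesgue_measure_itv/= lte_fin; have -> : - r < r by lra.
  by rewrite -EFinD lte_fin; lra.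
rewrite /leb3 [X in (_ < X)%E](@product_measure1E _ _ _ _ R _ lebesgue_measure (I `*` I) I)//; last exact: measurableX.
rewrite [X in (_ < X * _)%E](@product_measure1E _ _ _ _ R lebesgue_measure lebesgue_measure I I)//.
by rewrite !mule_gt0.
Qed.

Lemma mollifier_exists (delta : R) : 0 < delta -> exists eta : T -> R,
  [/\ testfun eta, forall x, 0 <= eta x, \int[leb3 R]_x eta x = 1 &
      forall x, delta < `|x| -> eta x = 0].
Proof.
move=> d0; pose th := cube_bump delta 1 0.
have tth : testfun th.
  split; first exact: smooth_cube_bump.
  by exists delta => x dx; apply: cube_bump_eq0; rewrite subr0 ltW.
have I0 : 0 < \int[leb3 R]_x th x.
  (* On the cube of half the size each of the six factors of [th] is at least [bump (delta / 2)],
     which makes the integral positive. *)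
  pose c := bump (1%:R * (delta / 2)) ^+ 6.
  have c0 : 0 < c by rewrite exprn_gt0// bump_gt0// mul1r divr_gt0.
  pose B := [set x : T | (`|x| <= delta / 2)%R].
  have mB : measurable B by exact: measurable_cball3.
  have Bfin : leb3 R B \is a fin_num by rewrite ge0_fin_numE// leb3_box_lt.
  have iB : (leb3 R).-integrable setT (EFin \o (fun x => c * \1_B x)).
    apply: (@bounded_support_integrable _ _ (delta / 2) c).
    - by apply: measurable_funM => //; exact: measurable_indic.
    - move=> x; rewrite indicE normrM (ger0_norm (ltW c0)).
      by case: (x \in B); rewrite ?normr1 ?normr0 ?mulr1 ?mulr0// ltW.
    - move=> x hx; rewrite indicE; case: (boolP (x \in B)); last by rewrite mulr0.
      by rewrite inE /B/= leNgt hx.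
  apply: (@lt_le_trans _ _ (\int[leb3 R]_x (c * \1_B x))); last first.
    apply: le_Rintegral => //; first exact: testfun_integrable.
    move=> x _; rewrite indicE; case: (boolP (x \in B)); rewrite ?mulr1 ?mulr0.
      by rewrite inE => hx; apply: cube_bump_lower; rewrite ?subr0.
    by move=> _; exact: cube_bump_ge0.
  rewrite /Rintegral.
  have -> : (\int[leb3 R]_x (c * \1_B x)%:E)%E = (c%:E * leb3 R B)%E.
    under eq_integral do rewrite EFinM.
    rewrite ge0_integralZl//; last by rewrite lee_fin ltW.
      by rewrite integral_indic// setIT.
    by apply/measurable_EFinP; exact: measurable_indic.
  by rewrite fineM// mulr_gt0// fine_gt0// leb3_cube_gt0 ?divr_gt0// ltey_eq Bfin.
exists (fun x => (\int[leb3 R]_x th x)^-1 * th x); split.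
- exact: (testfunM (smooth_cst _) tth).
- by move=> x; rewrite mulr_ge0 ?cube_bump_ge0// invr_ge0 ltW.
- by rewrite RintegralZl// ?mulVf// ?gt_eqF//; exact: testfun_integrable.
- by move=> x dx; rewrite /th cube_bump_eq0 ?mulr0// subr0 ltW.
Qed.

End CoordinateBumps.

(** * The fundamental lemma of the calculus of variations *)

Section Approximation.
Variable R : realType.
Notation T := (R3 R).
Variable Omega : set T.
Hypothesis oOmega : open Omega.
Let mOmega : measurable Omega := open_measurable3 oOmega.

Definition testfun_in (f : T -> R) := testfun f /\
  exists K : set T, [/\ compact K, K `<=` Omega & forall x, ~ K x -> f x = 0].

Variable w : T -> R.
Hypothesis iw : (leb3 R).-integrable Omega (EFin \o w).

(* Stable under products, complements and pointwise limits, hence satisfied by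
   the indicators of all Borel sets. *)
Definition approximable (f : T -> R) := [/\ measurable_fun Omega f,
  forall x, 0 <= f x <= 1 &
  forall e : R, 0 < e -> exists phi, [/\ testfun_in phi, forall x, 0 <= phi x <= 1 &
    \int[leb3 R]_(x in Omega) (`|f x - phi x| * `|w x|) <= e]].

Lemma testfun_in_mul f g : smooth f -> testfun_in g -> testfun_in (f \* g).
Proof.
move=> sf [tg [K [cK KO g0]]]; split; first exact: testfunM.
by exists K; split => // x /g0 /= ->; rewrite mulr0.
Qed.

Lemma testfun_in_lincomb a f g : testfun_in f -> testfun_in g ->
  testfun_in (fun x => a * f x + g x).
Proof.
move=> [tf [K [cK KO f0]]] [tg [L [cL LO g0]]]; split; first exact: testfunL.
exists (K `|` L); split; first exact: compactU.
  by move=> x [/KO|/LO].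
by move=> x KLx; rewrite f0 ?g0 ?mulr0 ?addr0// => h; apply: KLx; [right|left].
Qed.

Lemma testfun_in0 : testfun_in (cst 0).
Proof.
split; first by split; [exact: smooth_cst|exists 0].
by exists set0; split => //; exact: compact0.
Qed.

Lemma weighted_integrable (f : T -> R) C : measurable_fun Omega f ->
  (forall x, `|f x| <= C) -> (leb3 R).-integrable Omega (EFin \o (fun x => `|f x| * `|w x|)).
Proof.
move=> mf fC; apply: (@le_integrable _ _ _ (leb3 R) _ mOmega _ (fun x => (C * `|w x|)%:E)).
- apply/measurable_EFinP; apply: measurable_funM; apply: measurableT_comp => //.
  by have /integrableP[/measurable_EFinP] := iw.
- move=> x _ /=; rewrite lee_fin !normrM !normr_id; apply: ler_wpM2r => //.
  exact: le_trans (ler_norm _).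
- exact: (integrableZl mOmega C (integrable_norm iw)).
Qed.

Lemma measurable_testfun_in f : testfun_in f -> measurable_fun Omega f.
Proof. by move=> [tf _]; apply: measurable_funTS; exact: testfun_measurable. Qed.

(* A combination of two approximable functions is approximated by the same
   combination of the approximants, if it is 1-Lipschitz on [[0, 1]^2]. *)
Lemma approximable_comb (F : R -> R -> R) f g :
  (forall a b, 0 <= a <= 1 -> 0 <= b <= 1 -> 0 <= F a b <= 1) ->
  (forall a b c d, 0 <= a <= 1 -> 0 <= b <= 1 -> 0 <= c <= 1 -> 0 <= d <= 1 ->
    `|F a b - F c d| <= `|a - c| + `|b - d|) ->
  (forall f g, measurable_fun Omega f -> measurable_fun Omega g -> measurable_fun Omega (fun x => F (f x) (g x))) ->
  (forall f g, testfun_in f -> testfun_in g -> testfun_in (fun x => F (f x) (g x))) ->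
  approximable f -> approximable g -> approximable (fun x => F (f x) (g x)).
Proof.
move=> F01 FL mF tF [mf f01 af] [mg g01 ag]; split; first exact: mF.
  by move=> x; exact: F01.
move=> e e0; have e20 : 0 < e / 2 by rewrite divr_gt0.
have [phi [tp p01 hp]] := af _ e20; have [psi [ts s01 hs]] := ag _ e20.
exists (fun x => F (phi x) (psi x)); split; first exact: tF.
  by move=> x; exact: F01.
have mp := measurable_testfun_in tp; have ms := measurable_testfun_in ts.
have bnd a b : 0 <= a <= 1 -> 0 <= b <= 1 -> `|a - b| <= 1 :> R.
  by move=> /andP[? ?] /andP[? ?]; rewrite ler_norml; apply/andP; split; lra.
have i1 : (leb3 R).-integrable Omega (EFin \o (fun x => `|f x - phi x| * `|w x|)).
  by apply: (@weighted_integrable (fun x => f x - phi x) 1) => [|x]; [exact: measurable_funB|exact: bnd].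
have i2 : (leb3 R).-integrable Omega (EFin \o (fun x => `|g x - psi x| * `|w x|)).
  by apply: (@weighted_integrable (fun x => g x - psi x) 1) => [|x]; [exact: measurable_funB|exact: bnd].
apply: (@le_trans _ _ (\int[leb3 R]_(x in Omega) (`|f x - phi x| * `|w x| + `|g x - psi x| * `|w x|))).
  apply: le_Rintegral => //.
  - apply: (@weighted_integrable (fun x => F (f x) (g x) - F (phi x) (psi x)) 1) => [|x].
      by apply: measurable_funB; exact: mF.
    by apply: bnd; exact: F01.
  - exact: (integrableD mOmega i1 i2).
  - by move=> x _; rewrite -mulrDl ler_wpM2r// FL.
rewrite RintegralD//; lra.
Qed.

Lemma approximable_mul f g : approximable f -> approximable g ->
  approximable (fun x => f x * g x).
Proof.
apply: (@approximable_comb (fun a b => a * b)).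
- by move=> a b /andP[a0 a1] /andP[b0 b1]; rewrite mulr_ge0//= mulr_ile1.
- move=> a b c d /andP[a0 a1] /andP[b0 b1] /andP[c0 c1] /andP[d0 d1].
  have -> : a * b - c * d = (a - c) * b + c * (b - d) by ring.
  apply: (le_trans (ler_normD _ _)); rewrite !normrM (ger0_norm b0) (ger0_norm c0).
  by apply: lerD; [rewrite ler_piMr|rewrite ler_piMl].
- by move=> u v mu mv; exact: measurable_funM.
- by move=> u v [[su _] _] tv; apply: (testfun_in_mul su tv).
Qed.

Lemma approximable_cup f g : approximable f -> approximable g ->
  approximable (fun x => f x + g x - f x * g x).
Proof.
apply: (@approximable_comb (fun a b => a + b - a * b)).
- move=> a b /andP[a0 a1] /andP[b0 b1].
  have -> : a + b - a * b = a + b * (1 - a) by ring.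
  have h : 0 <= b * (1 - a) by rewrite mulr_ge0// subr_ge0.
  by apply/andP; split; [rewrite addr_ge0|nra].
- move=> a b c d /andP[a0 a1] /andP[b0 b1] /andP[c0 c1] /andP[d0 d1].
  have -> : a + b - a * b - (c + d - c * d) = (a - c) * (1 - b) + (1 - c) * (b - d) by ring.
  apply: (le_trans (ler_normD _ _)); rewrite !normrM.
  rewrite (@ger0_norm _ (1 - b)) ?subr_ge0// (@ger0_norm _ (1 - c)) ?subr_ge0//.
  by apply: lerD; [rewrite ler_piMr//; lra|rewrite ler_piMl//; lra].
- by move=> u v mu mv; apply: measurable_funB; [exact: measurable_funD|exact: measurable_funM].
- move=> u v tu tv; have [[su _] _] := tu.
  have := testfun_in_lincomb (- 1) (testfun_in_mul su tv) (testfun_in_lincomb 1 tu tv).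
  by congr testfun_in; apply/funext => x /=; ring.
Qed.

(** Serves for half-spaces, whose smooth approximations do not have compact support in [Omega]: they
    are multiplied by approximants of the constant 1. *)
Lemma approximable_smooth s f : smooth s -> (forall x, 0 <= s x <= 1) ->
  approximable f -> approximable (fun x => s x * f x).
Proof.
move=> ss s01 [mf f01 af]; split.
- apply: measurable_funM => //; apply: measurable_funTS; apply: continuous_measurable3.
  exact: smooth_continuous.
- by move=> x; have /andP[? ?] := s01 x; have /andP[? ?] := f01 x; rewrite mulr_ge0//= mulr_ile1.
move=> e e0; have [phi [tp p01 hp]] := af _ e0.
exists (fun x => s x * phi x); split; first exact: testfun_in_mul.
  by move=> x; have /andP[? ?] := s01 x; have /andP[? ?] := p01 x; rewrite mulr_ge0//= mulr_ile1.
have mp := measurable_testfun_in tp.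
have ms : measurable_fun Omega s.
  by apply: measurable_funTS; apply: continuous_measurable3; exact: smooth_continuous.
have bnd a b : 0 <= a <= 1 -> 0 <= b <= 1 -> `|a - b| <= 1 :> R.
  by move=> /andP[? ?] /andP[? ?]; rewrite ler_norml; apply/andP; split; lra.
apply: le_trans hp; apply: le_Rintegral => //.
- apply: (@weighted_integrable (fun x => s x * f x - s x * phi x) 1) => [|x].
    by apply: measurable_funB; exact: measurable_funM.
  by rewrite -mulrBr normrM mulr_ile1// ?bnd//; have /andP[h0 h1] := s01 x; rewrite ger0_norm.
- by apply: (@weighted_integrable (fun x => f x - phi x) 1) => [|x]; [exact: measurable_funB|exact: bnd].
- move=> x _; rewrite -mulrBr normrM ler_wpM2r// ler_piMl//.
  by have /andP[h0 h1] := s01 x; rewrite ger0_norm.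
Qed.

Lemma approximable_testfun phi : testfun_in phi -> (forall x, 0 <= phi x <= 1) ->
  approximable phi.
Proof.
move=> tp p01; split; [exact: measurable_testfun_in|by []|].
move=> e e0; exists phi; split => //.
rewrite (@eq_Rintegral _ _ _ _ _ (cst 0)); last by move=> x _; rewrite subrr normr0 mul0r.
by rewrite Rintegral_cst// mul0r ltW.
Qed.

Lemma approximable_lim (f_ : nat -> T -> R) (f : T -> R) : (forall n, approximable (f_ n)) ->
  measurable_fun Omega f -> (forall x, 0 <= f x <= 1) ->
  (forall x, Omega x -> f_ n x @[n --> \oo] --> f x) -> approximable f.
Proof.
move=> af mf f01 fl; split => // e e0.
have bnd a b : 0 <= a <= 1 -> 0 <= b <= 1 -> `|a - b| <= 1 :> R.
  by move=> /andP[? ?] /andP[? ?]; rewrite ler_norml; apply/andP; split; lra.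
pose h n x := `|f x - f_ n x| * `|w x|.
have mw : measurable_fun Omega w by have /integrableP[/measurable_EFinP] := iw.
have mfn n : measurable_fun Omega (f_ n) by case: (af n).
have fn01 n x : 0 <= f_ n x <= 1 by case: (af n).
have mh n : measurable_fun Omega (EFin \o h n).
  apply/measurable_EFinP; apply: measurable_funM; apply: measurableT_comp => //.
  exact: measurable_funB.
have ih n : (leb3 R).-integrable Omega (EFin \o h n).
  apply: (@weighted_integrable (fun x => f x - f_ n x) 1) => [|x]; last exact: bnd.
  exact: measurable_funB.
have hl : {ae leb3 R, forall x, Omega x -> (EFin \o h n) x @[n --> \oo] --> (EFin \o (cst 0 : T -> R)) x}.
  apply: aeW => x Ox; apply/fine_cvgP; split; first exact: nearW.
  rewrite -[X in _ --> X](mul0r `|w x|) /=; apply: cvgM; last exact: cvg_cst.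
  rewrite -[X in _ --> X](@normr0 _ R) -(subrr (f x)); apply: cvg_norm.
  by apply: cvgB; [exact: cvg_cst|exact: fl].
have hd : {ae leb3 R, forall x, forall n, Omega x -> (`|(EFin \o h n) x| <= (`|w x|%R)%:E)%E}.
  apply: aeW => x n _; rewrite lee_fin /h normrM !normr_id ler_piMl// bnd//.
have m0 : measurable_fun Omega (EFin \o (cst 0 : T -> R)) 
  by apply/measurable_EFinP; exact: (@measurable_cst _ _ T (measurableTypeR R) Omega 0).
have iw' : (leb3 R).-integrable Omega (fun x => (`|w x|%R)%:E) := integrable_norm iw.
have [_ _ H] := dominated_convergence mOmega mh m0 hl iw' hd.
have H2 : \int[leb3 R]_(x in Omega) h n x @[n --> \oo] --> (0 : R).
  have I0 : (\int[leb3 R]_(x in Omega) (EFin \o (cst 0%R : T -> R)) x = 0%R%:E)%E.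
    by rewrite integral0_eq.
  by move: H; rewrite I0 => /fine_cvgP[_].
have e20 : 0 < e / 2 by rewrite divr_gt0.
have [n hn] : exists n, \int[leb3 R]_(x in Omega) h n x <= e / 2.
  have hh : \forall n \near \oo, \int[leb3 R]_(x in Omega) h n x <= e / 2.
    by apply: (cvgr_le (0 : R)).
  by have [n] := filter_ex hh; exists n.
have [_ _ /(_ _ e20)[phi [tp p01 hp]]] := af n.
exists phi; split => //; have mp := measurable_testfun_in tp.
have i2 : (leb3 R).-integrable Omega (EFin \o (fun x => `|f_ n x - phi x| * `|w x|)).
  apply: (@weighted_integrable (fun x => f_ n x - phi x) 1) => [|x]; last exact: bnd.
  exact: measurable_funB.
apply: (@le_trans _ _ (\int[leb3 R]_(x in Omega) (h n x + `|f_ n x - phi x| * `|w x|))).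
  apply: le_Rintegral => //.
  - apply: (@weighted_integrable (fun x => f x - phi x) 1) => [|x]; last exact: bnd.
    exact: measurable_funB.
  - exact: (integrableD mOmega (ih n) i2).
  - move=> x _; rewrite -mulrDl ler_wpM2r//.
    by rewrite -[f x - phi x](subrKA (f_ n x)) ler_normD.
have := ih n => ihn; rewrite RintegralD//; lra.
Qed.

Definition approximable_set (A : set T) := measurable A /\ approximable (\1_A : T -> R).

Lemma indic_setU (A B : set T) x :
  \1_(A `|` B) x = \1_A x + \1_B x - \1_A x * \1_B x :> R.
Proof.
rewrite !indicE in_setU.
by case: (x \in A); case: (x \in B); rewrite /= ?mulr1 ?mulr0 ?mul0r ?addr0 ?subr0 ?add0r ?addrK.
Qed.

Lemma approximable_setU A B : approximable_set A -> approximable_set B ->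
  approximable_set (A `|` B).
Proof.
move=> [mA aA] [mB aB]; split; first exact: measurableU.
have := approximable_cup aA aB; congr approximable.
by apply/funext => x; rewrite indic_setU.
Qed.

Lemma approximable_set0 : approximable_set set0.
Proof.
split; first exact: measurable0.
rewrite indic0; apply: approximable_testfun; first exact: testfun_in0.
by move=> x /=; rewrite lexx ler01.
Qed.

Lemma indic01 (A : set T) x : 0 <= (\1_A x : R) <= 1.
Proof. by rewrite indicE; case: (x \in A); rewrite ?lexx ?ler01. Qed.

Lemma approximable_bigcup (A : nat -> set T) : (forall n, approximable_set (A n)) ->
  approximable_set (\bigcup_n A n).
Proof.
move=> aA; pose B := fix B n : set T := if n is m.+1 then B m `|` A m else set0.
have BP n x : B n x <-> exists2 i, (i < n)%N & A i x.
  elim: n => [|n IH]; first by split => // -[].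
  split=> [|].
    by case=> [h|Anx]; [have [i ilt Aix] := IH.1 h; exists i => //; exact: ltnW|exists n].
  case=> i; rewrite ltnS leq_eqVlt => /orP[/eqP ->|ilt] Aix; [by right|by left; apply/IH; exists i].
have aB n : approximable_set (B n).
  by elim: n => [|n IH]; [exact: approximable_set0|exact: approximable_setU].
have mU : measurable (\bigcup_n A n) by apply: bigcup_measurable => n _; case: (aA n).
split => //; apply: (@approximable_lim (fun n => \1_(B n))).
- by move=> n; case: (aB n).
- by apply: measurable_funTS; exact: measurable_indic.
- exact: indic01.
move=> x _; rewrite !indicE.
have [h|h] := boolP (x \in \bigcup_n A n); last first.
  apply: cvg_near_cst; apply: nearW => n; rewrite indicE.
  suff -> : (x \in B n) = false by [].
  by apply/negbTE; apply: contra h; rewrite !inE => /BP[i _ Aix]; exists i.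
move: h; rewrite inE => -[m _ Amx]; apply: cvg_near_cst; exists m.+1 => // n /= mn.
rewrite indicE; have -> : x \in B n; last by [].
by rewrite inE; apply/BP; exists m.
Qed.

Lemma approximable_cube c r : [set x | `|x - c| <= r] `<=` Omega ->
  approximable_set [set x | `|x - c| < r].
Proof.
move=> cO; split; first exact: measurable_ball3.
have bmp k : approximable (cube_bump r k c).
  apply: approximable_testfun; last by move=> x; rewrite cube_bump_ge0 cube_bump_le1.
  split; first split; first exact: smooth_cube_bump.
    exists (r + `|c|) => x hx; apply: cube_bump_eq0.
    by have := lerB_normD x (- c); rewrite normrN; lra.
  exists [set x | `|x - c| <= r]; split => //.
    have -> : [set x : T | (`|x - c| <= r)%R] = (fun x => x + c) @` [set x : T | (`|x| <= r)%R].
      apply/seteqP; split => [x hx|_ [x hx <-]]; last by rewrite /= addrK.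
      by exists (x - c) => //; rewrite subrK.
    apply: continuous_compact; last exact: compact_box.
    apply: continuous_subspaceT => x; apply: cvgD; [exact: cvg_id|exact: cvg_cst].
  by move=> x /= /negP; rewrite -ltNge => /ltW; exact: cube_bump_eq0.
apply: (approximable_lim bmp).
- by apply: measurable_funTS; apply: measurable_indic; exact: measurable_ball3.
- exact: indic01.
move=> x _; have := @cvg_cube_bump R r c x.
have -> // : (`|x - c| < r)%R%:R = \1_[set x0 | `|x0 - c| < r] x :> R.
by rewrite indicE; congr (_%:R); congr nat_of_bool; apply/idP/idP; rewrite inE.
Qed.

Lemma approximable_set_Omega : approximable_set Omega.
Proof.
have [c [r [cr Ocr]]] := open_union_cubes oOmega.
have -> : Omega = \bigcup_n [set x | `|x - c n| < r n].
  apply/seteqP; split => [x /Ocr[n hn]|x [n _ /= hn]]; first by exists n.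
  by apply: (cr n); exact: ltW.
by apply: approximable_bigcup => n; apply: approximable_cube; exact: cr.
Qed.

(** Convergence is asked inside [Omega] only, where 1 agrees with the indicator of [Omega], a
    countable union of cubes. This is the exhaustion of [Omega] by compact sets. *)
Lemma approximable1 : approximable (cst 1).
Proof.
have [_ aO] := approximable_set_Omega.
have O1 x : Omega x -> \1_Omega x = 1 :> R by move=> Ox; rewrite indicE mem_set.
apply: (@approximable_lim (fun=> \1_Omega)) => //.
- by move=> x /=; rewrite lexx ler01.
- by move=> x Ox; rewrite O1//; exact: cvg_cst.
Qed.

(** If [phi] has compact support then [1 - phi] does not. The complement is therefore read as the
    product [1 * (1 - f)], in which the first factor is approximated as well. *)
Lemma approximable_compl f : approximable f -> approximable (fun x => 1 - f x).
Proof.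
move=> af.
have := @approximable_comb (fun a b => a * (1 - b)) (cst 1) f _ _ _ _ approximable1 af.
rewrite (_ : (fun x => cst 1 x * (1 - f x)) = (fun x => 1 - f x)); last by apply/funext => x; rewrite mul1r.
apply.
- by move=> a b /andP[a0 a1] /andP[b0 b1]; rewrite mulr_ge0 ?subr_ge0//= mulr_ile1 ?subr_ge0//; lra.
- move=> a b c d /andP[a0 a1] /andP[b0 b1] /andP[c0 c1] /andP[d0 d1].
  have -> : a * (1 - b) - c * (1 - d) = (a - c) * (1 - b) + c * (d - b) by ring.
  apply: (le_trans (ler_normD _ _)); rewrite !normrM (ger0_norm c0) [`|d - b|]distrC.
  rewrite (@ger0_norm _ (1 - b)) ?subr_ge0//.
  by apply: lerD; [rewrite ler_piMr//; lra|rewrite ler_piMl].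
- by move=> u v mu mv; apply: measurable_funM => //; apply: measurable_funB => //; exact: measurable_cst.
- move=> u v tu tv; have [[su _] _] := tu.
  have := testfun_in_lincomb (- 1) (testfun_in_mul su tv) tu.
  by congr testfun_in; apply/funext => x /=; ring.
Qed.

Lemma approximable_setC A : approximable_set A -> approximable_set (~` A).
Proof.
move=> [mA aA]; split; first exact: measurableC.
have := approximable_compl aA; congr approximable; apply/funext => x.
by rewrite !indicE in_setC; case: (x \in A); rewrite /= ?subrr ?subr0.
Qed.

Lemma approximable_setI A B : approximable_set A -> approximable_set B ->
  approximable_set (A `&` B).
Proof.
move=> [mA aA] [mB aB]; split; first exact: measurableI.
by rewrite indicI; exact: approximable_mul.
Qed.

Lemma approximable_preimage_sigma_algebra U (g : T -> U) :
  sigma_algebra setT [set B | approximable_set (g @^-1` B)].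
Proof.
split.
- by rewrite /= preimage_set0; exact: approximable_set0.
- by move=> A /= aA; rewrite setTD preimage_setC; exact: approximable_setC.
- by move=> A aA; rewrite /= preimage_bigcup; exact: approximable_bigcup.
Qed.

Lemma approximable_halfspace j (a : R) : approximable_set [set x | a < crd j x].
Proof.
have mj : measurable_fun [set: T] (crd j : T -> R).
  by apply: continuous_measurable3; exact: crd_continuous.
have mH : measurable [set x : T | a < crd j x].
  rewrite -[X in measurable X]setTI (_ : [set x | _] = crd j @^-1` `]a, +oo[); last first.
    by apply/seteqP; split => x /=; rewrite in_itv/= andbT.
  exact: mj.
split => //.
pose s k (x : T) : R := bump (k%:R * crd j x + - (k%:R * a)).
have ak k : approximable (fun x => s k x * cst 1 x).
  apply: approximable_smooth; [exact: smooth_bump_crd| |exact: approximable1].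
  by move=> x; rewrite bump_ge0 bump_le1.
apply: (approximable_lim ak); [|exact: indic01|].
  by apply: measurable_funTS; exact: measurable_indic.
move=> x _ /=; under eq_fun do rewrite mulr1 /s -mulrBr.
have := @cvg_bump R (crd j x - a); rewrite subr_gt0.
have -> // : (a < crd j x)%R%:R = \1_[set x0 | a < crd j x0] x :> R.
by rewrite indicE; congr (_%:R); congr nat_of_bool; apply/idP/idP; rewrite inE.
Qed.

Lemma approximable_crd_preimage j (B : set (measurableTypeR R)) : measurable B ->
  approximable_set (crd j @^-1` B).
Proof.
rewrite [X in X B](RGenOInfty.measurableE R).
apply: (smallest_sub (approximable_preimage_sigma_algebra (crd j))).
move=> _ [a ->] /=; have := approximable_halfspace j a.
by congr approximable_set; apply/seteqP; split => x /=; rewrite in_itv/= andbT.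
Qed.

(** The sigma-algebra of a product is generated by rectangles. Undoing the two products leaves
    preimages under coordinates, and these are generated by half-spaces. *)
Lemma approximable_measurable (A : set T) : measurable A -> approximable_set A.
Proof.
rewrite measurable_prod_measurableType.
apply: (smallest_sub (approximable_preimage_sigma_algebra (@id T))).
move=> _ [A1 mA1 [C mC <-]] /=.
have -> : A1 `*` C = (fst @^-1` A1) `&` (crd 2%:R @^-1` C) by [].
apply: approximable_setI; last exact: approximable_crd_preimage.
move: mA1; rewrite measurable_prod_measurableType.
apply: (smallest_sub (approximable_preimage_sigma_algebra (@fst _ _ : T -> _))).
move=> _ [B1 mB1 [B2 mB2 <-]] /=.
have -> : fst @^-1` (B1 `*` B2) = (crd 0 @^-1` B1) `&` (crd 1 @^-1` B2) by [].
by apply: approximable_setI; exact: approximable_crd_preimage.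
Qed.

End Approximation.

(** * Pointwise sign from integrals against test functions *)

Section PositivityLemma.
Variable R : realType.
Notation T := (R3 R).
Variable Omega : set T.
Hypothesis oOmega : open Omega.
Let mOmega : measurable Omega := open_measurable3 oOmega.

(** The test functions approximate the indicator of the set where [q < 0], in the [L^1] sense
    weighted by [|q|] itself. In the limit the integral of [q] over that set is nonnegative, so [q]
    times the indicator vanishes almost everywhere. *)
Lemma ae_ge0_of_testfun (q : T -> R) : (leb3 R).-integrable Omega (EFin \o q) ->
  (forall phi, testfun_in Omega phi -> (forall x, 0 <= phi x) ->
    0 <= \int[leb3 R]_(x in Omega) (phi x * q x)) ->
  {ae leb3 R, forall x, Omega x -> 0 <= q x}.
Proof.
move=> iq hq.
have mq : measurable_fun Omega q by have /integrableP[/measurable_EFinP] := iq.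
pose A := Omega `&` q @^-1` `]-oo, 0[.
have mA : measurable A by exact: mq.
have [_ [mi _ ap]] := approximable_measurable oOmega iq mA.
have intA : 0 <= \int[leb3 R]_(x in Omega) (\1_A x * q x).
  apply/ler_addgt0Pl => e e0; have [phi [tp p01 hp]] := ap _ e0.
  have mp := measurable_testfun_in tp.
  have ph := hq _ tp (fun x => proj1 (andP (p01 x))).
  have bq (f : T -> R) C : measurable_fun Omega f -> (forall x, `|f x| <= C) ->
      (leb3 R).-integrable Omega (EFin \o (fun x => f x * q x)).
    move=> mf fC; apply: (le_integrable mOmega _ _ (weighted_integrable oOmega iq mf fC)).
      by apply/measurable_EFinP; exact: measurable_funM.
    by move=> x _ /=; rewrite lee_fin !normrM !normr_id.
  have b1 : forall x, `|(\1_A x : R)| <= 1.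
    by move=> x; have /andP[h0 h1] := indic01 A x; rewrite ger0_norm.
  have b2 : forall x, `|phi x| <= 1.
    by move=> x; have /andP[h0 h1] := p01 x; rewrite ger0_norm.
  have i1 := bq _ 1 mi b1; have i2 := bq _ 1 mp b2.
  have -> : \int[leb3 R]_(x in Omega) (\1_A x * q x) =
      \int[leb3 R]_(x in Omega) (phi x * q x) +
      (\int[leb3 R]_(x in Omega) (\1_A x * q x) - \int[leb3 R]_(x in Omega) (phi x * q x)) by ring.
  rewrite -RintegralB//.
  have i3 := integrableB mOmega i1 i2.
  have n3 := le_normr_Rintegral mOmega i3.
  have n4 : \int[leb3 R]_(x in Omega) `|\1_A x * q x - phi x * q x| <= e.
    by under eq_Rintegral do rewrite -mulrBl normrM.
  have := le_trans n3 n4; rewrite ler_norml => /andP[+ _]; lra.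
have iAq : (leb3 R).-integrable Omega (EFin \o (fun x => \1_A x * q x)).
  have mi' : measurable_fun Omega (\1_A : T -> R) by apply: measurable_funTS; exact: measurable_indic.
  apply: (@le_integrable _ _ _ (leb3 R) _ mOmega _ (EFin \o q)) => //.
    by apply/measurable_EFinP; exact: measurable_funM.
  move=> x _ /=; rewrite lee_fin normrM ler_piMl//.
  by have /andP[h0 h1] := indic01 A x; rewrite ger0_norm.
have negA x : Omega x -> `|\1_A x * q x| = - (\1_A x * q x).
  move=> Ox; rewrite indicE; case: (boolP (x \in A)) => [|_]; last by rewrite mul0r normr0 oppr0.
  by rewrite inE => -[_ /=]; rewrite in_itv/= mul1r => /ltr0_norm.
have abs0 : (\int[leb3 R]_(x in Omega) `|(EFin \o (fun x => (\1_A x * q x)%R)) x| = 0)%E.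
  have -> : (\int[leb3 R]_(x in Omega) `|(EFin \o (fun x => (\1_A x * q x)%R)) x| =
      (\int[leb3 R]_(x in Omega) `|\1_A x * q x|)%R%:E)%E.
    by rewrite /Rintegral fineK//; exact/integrable_fin_num/integrable_norm.
  congr EFin; apply/eqP; rewrite eq_le; apply/andP; split; last by apply: Rintegral_ge0.
  rewrite (@eq_Rintegral _ _ _ _ _ (fun x => - 1 * (\1_A x * q x))); last first.
    by move=> x; rewrite inE => Ox; rewrite negA// mulN1r.
  by rewrite RintegralZl// mulN1r oppr_le0.
have mAq : measurable_fun Omega (EFin \o (fun x => \1_A x * q x)).
  by have /integrableP[] := iAq.
have /(ae_eq_integral_abs (leb3 R) mOmega mAq) := abs0.
apply: filterS => x h Ox; have := h Ox => -[].
rewrite leNgt; case: ltP => // q0; rewrite indicE.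
have -> : x \in A by rewrite inE; split => //=; rewrite in_itv.
by rewrite mul1r => q00; rewrite q00 ltxx in q0.
Qed.

End PositivityLemma.

(** * Compensated compactness *)

Lemma mul_ratio_le_half (R : realFieldType) (e c : R) : 0 < e -> 0 < 2 * (c + 1) ->
  e * c / (2 * (c + 1)) <= e / 2.
Proof. by move=> e0 c0; rewrite ler_pdivrMr//; lra. Qed.

Lemma half_chain_le (R : realFieldType) (x a b c d m e : R) : `|x - (a + b + c)| <= d ->
  `|a| <= m -> `|b| <= m -> `|c| <= m -> d <= e / 2 -> 3 * m <= e / 2 -> `|x| <= e.
Proof. rewrite !ler_norml => /andP[? ?] /andP[? ?] /andP[? ?] /andP[? ?] ? ?; apply/andP; split; lra. Qed.

Lemma lincombB (R : pzRingType) (V : lmodType R) (a : R) (u v u' v' : V) :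
  a *: u + v - (a *: u' + v') = a *: (u - u') + (v - v').
Proof. by rewrite scalerBr opprD addrACA. Qed.

Lemma sqr_scale_le (R : realFieldType) (a s : R) : 0 <= a -> 0 <= s ->
  2 * (a ^+ 2 * s) + 2 * s <= (2 * (a + 1)) ^+ 2 * s.
Proof.
move=> a0 s0; rewrite -subr_ge0.
have -> : (2 * (a + 1)) ^+ 2 * s - (2 * (a ^+ 2 * s) + 2 * s) =
  2 * (a ^+ 2 * s) + 8 * (a * s) + 2 * s by ring.
by rewrite !addr_ge0// !mulr_ge0.
Qed.

Lemma product_error_le (R : realFieldType) (s t M N C L e : R) :
  0 <= L -> 0 < e -> e <= 1 -> `|s - t| <= C * e ->
  `|t| <= L * ((M + e) * (N + e)) -> `|s| <= L * (M * N) + (C + L * (M + N + 1)) * e.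
Proof.
move=> L0 e0 e1 st tL.
have : `|s| <= `|s - t| + `|t| by rewrite -{1}(subrK t s) ler_normD.
have : L * ((M + e) * (N + e)) <= L * (M * N + (M + N + 1) * e).
  by apply: ler_wpM2l => //; have : e * e <= e by [rewrite ler_piMl// ltW]; lra.
lra.
Qed.

Section LipschitzTestFunctions.
Variable R : realType.
Notation T := (R3 R).

Lemma testfun_C1_bounded (p : T -> R) : testfun p -> exists K, [/\ 0 <= K,
  forall x, `|p x| <= K & forall k x, `|partial k p x| <= K].
Proof.
move=> tp; have [B hB] := testfun_bounded tp.
have [C hC] : {C : 'I_3 -> R & forall k x, `|partial k p x| <= C k}.
  apply: (@choice _ _ (fun k C => forall x, `|partial k p x| <= C)) => k.
  exact: (testfun_bounded (testfun_partial k tp)).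
have S0 : 0 <= \sum_k `|C k| by rewrite sumr_ge0.
exists (`|B| + \sum_k `|C k|); split; first by rewrite addr_ge0.
- by move=> x; apply: le_trans (hB x) _; rewrite (le_trans (ler_norm B))// lerDl.
- move=> k x; apply: le_trans (hC k x) _; apply: le_trans (ler_norm _) _.
  by rewrite (bigD1 k)//= addrCA lerDl addr_ge0// sumr_ge0.
Qed.

Lemma testfun_lipschitz (f : T -> R) : testfun f ->
  exists2 L, 0 < L & forall x y, `|f x - f y| <= L * `|x - y|.
Proof.
move=> tf; have [S [S0 _ SC]] := testfun_C1_bounded tf.
have step k (t : R) (a : T) (n : R) : `|t| <= n -> `|f (t *: unit3 R k + a) - f a| <= S * n.
  move=> tn; have D := fun s : R => testfun_line_derivative k a s (testfun_smooth tf).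
  have := mvt_bound t D (fun s => SC k _); rewrite scale0r addr0 [_ *: _ + a]addrC => h.
  by apply: le_trans h _; rewrite mulrC ler_wpM2l.
exists (3 * S + 1) => [|x y]; first by rewrite ltr_wpDl// mulr_ge0.
set h := x - y.
have [h1 h2 h3] := norm3_coords h.
have s1 := step 0 _ (h.1.2 *: unit3 R 1 + (h.2 *: unit3 R 2%:R + y)) _ h1.
have s2 := step 1 _ (h.2 *: unit3 R 2%:R + y) _ h2.
have s3 := step 2%:R _ y _ h3.
have E : h.1.1 *: unit3 R 0 + (h.1.2 *: unit3 R 1 + (h.2 *: unit3 R 2%:R + y)) = x.
  by rewrite !addrA -[h.1.1 *: _ + _ + _]addrA -axis_decomposition subrK.
rewrite E in s1.
have := chain3_le s1 s2 s3; rewrite mulrA => /le_trans; apply.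
by rewrite ler_wpM2r// lerDl.
Qed.

End LipschitzTestFunctions.

(** * Fields in a bounded open set and the closure of the graph of the curl *)

Section FieldsInDomain.
Variables (R : realType) (Omega : set (R3 R)) (r : R).
Notation T := (R3 R).
Notation field := ('I_3 -> T -> R).
Hypotheses (oOmega : open Omega) (Or : forall x, Omega x -> `|x| <= r).
Let mO : measurable Omega := open_measurable3 oOmega.
Let Ooo : (leb3 R Omega < +oo)%E := leb3_bounded_lt mO Or.
Notation sqO := (sqint (leb3 R) Omega).
Notation sqvO := (@sqintv _ _ _ (leb3 R) Omega 'I_3).
Notation ipO := (ip (leb3 R) Omega).
Notation ipvO := (@ipv _ _ _ (leb3 R) Omega 'I_3).
Notation ipvT := (ipv (leb3 R) [set: T]).
Notation testin := (testfun_in Omega).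

Definition testfield_in (u : field) := forall i, testin (u i).

Lemma testfield_in_testfield u : testfield_in u -> testfield u.
Proof. by move=> tu i; case: (tu i). Qed.

Lemma testfun_in_off f x : testin f -> ~ Omega x -> f x = 0.
Proof. by move=> [_ [K [_ KO f0]]] nOx; apply: f0 => /KO. Qed.

Lemma testfun_in_partial k f : testin f -> testin (partial k f).
Proof.
move=> [tf [K [cK KO f0]]]; split; first exact: testfun_partial.
exists K; split => // x nKx.
rewrite /partial (@near_eq_derive _ _ _ f (cst 0)) ?derive_cst//.
have : \forall y \near x, (~` K) y.
  apply: open_nbhs_nbhs; split => //; apply: closed_openC.
  exact: (compact_closed (@norm_hausdorff R T) cK).
by apply: filterS => y /f0.
Qed.

Lemma testfield_in_rcurl u : testfield_in u -> testfield_in (rcurl u).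
Proof.
move=> tu i.
have := testfun_in_lincomb (- 1) (testfun_in_partial (i + 2%:R) (tu (i + 1)))
  (testfun_in_partial (i + 1) (tu (i + 2%:R))).
by congr testfun_in; apply/funext => x; rewrite /rcurl mulN1r addrC.
Qed.

Lemma Rintegral_off (f : T -> R) : (forall x, ~ Omega x -> f x = 0) ->
  \int[leb3 R]_(x in Omega) f x = \int[leb3 R]_x f x.
Proof.
move=> f0; rewrite Rintegral_mkcond; apply: eq_Rintegral => x _.
by rewrite patchE; case: ifPn => // /negP; rewrite inE => /f0.
Qed.

Lemma ip_testfun_in f g : testin f -> ipO f g = ip (leb3 R) setT f g.
Proof.
by move=> tf; apply: Rintegral_off => x /(testfun_in_off tf) ->; rewrite mul0r.
Qed.

Lemma ipv_testfield_in u v : testfield_in u -> ipvO u v = ipvT u v.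
Proof. by move=> tu; apply: eq_bigr => i _; exact: ip_testfun_in. Qed.

Lemma pairing0 u v : testfield_in u -> pairing u v 0 = ipvO u v.
Proof.
move=> tu; rewrite (ipv_testfield_in _ tu); apply: eq_bigr => i _.
by apply: eq_Rintegral => x _; rewrite addr0.
Qed.

Lemma testfun_in_sqint f : testin f -> sqO f.
Proof.
move=> [tf _]; have [C fC] := testfun_bounded tf.
apply: (sqint_bounded mO Ooo _ (fun x _ => fC x)).
by apply: measurable_funTS; exact: testfun_measurable.
Qed.

Lemma testfield_in_sqintv u : testfield_in u -> sqvO u.
Proof. by move=> tu i; exact: testfun_in_sqint. Qed.

Lemma rcurl_smoothM (p : T -> R) (u : field) i x : smooth p -> (forall i, smooth (u i)) ->
  rcurl (fun i => p \* u i) i x = p x * rcurl u i x +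
    (partial (i + 1) p x * u (i + 2%:R) x - partial (i + 2%:R) p x * u (i + 1) x).
Proof.
move=> sp su.
have E k j := partialM (fun y => @smooth_derivable R p y k sp)
  (fun y => @smooth_derivable R (u j) y k (su j)).
by rewrite /rcurl !E /=; ring.
Qed.

Lemma leibniz_sqr_le (p a b c u v K : R) : `|p| <= K -> `|a| <= K -> `|b| <= K ->
  (p * c + (a * u - b * v)) ^+ 2 <= 3 * K ^+ 2 * (c ^+ 2 + (u ^+ 2 + v ^+ 2)).
Proof.
move=> pK aK bK.
have K0 : 0 <= K by exact: le_trans (normr_ge0 p) pK.
have sq (s t : R) : `|s| <= K -> (s * t) ^+ 2 <= K ^+ 2 * t ^+ 2.
  move=> sK; rewrite exprMn ler_wpM2r ?sqr_ge0//.
  by rewrite -(real_normK (num_real s)) lerXn2r ?nnegrE.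
have := sq _ c pK; have := sq _ u aK; have := sq _ v bK.
move: (p * c) (a * u) (b * v) => s t w.
have : (s + (t - w)) ^+ 2 <= 3 * (s ^+ 2 + (t ^+ 2 + w ^+ 2)).
  rewrite -subr_ge0.
  have -> : 3 * (s ^+ 2 + (t ^+ 2 + w ^+ 2)) - (s + (t - w)) ^+ 2 =
    (s - t) ^+ 2 + (s + w) ^+ 2 + (t + w) ^+ 2 by ring.
  by rewrite !addr_ge0 ?sqr_ge0.
move: (K ^+ 2) => K2; lra.
Qed.

(** The Leibniz rule bounds each squared component by [3 K^2] times three squares. In the sum over
    components every [u j] occurs twice, which gives [3 K^2 (M^2 + 2 M^2)]. *)
Lemma rcurl_smoothM_le (p : T -> R) (u : field) (K M : R) : smooth p -> testfield_in u ->
  (forall x, Omega x -> `|p x| <= K) ->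
  (forall k x, Omega x -> `|partial k p x| <= K) ->
  ipvO u u <= M ^+ 2 -> ipvO (rcurl u) (rcurl u) <= M ^+ 2 ->
  ipvO (rcurl (fun i => p \* u i)) (rcurl (fun i => p \* u i)) <= (3 * K * M) ^+ 2.
Proof.
move=> sp tu pK dpK uM cM.
have su i : smooth (u i) by have [/testfun_smooth] := tu i.
have tpu : testfield_in (fun i => p \* u i) by move=> i; exact: testfun_in_mul.
have qu i := testfun_in_sqint (tu i).
have qc i := testfun_in_sqint (testfield_in_rcurl tu i).
have qv i := testfun_in_sqint (testfield_in_rcurl tpu i).
have comp i : ipO (rcurl (fun i => p \* u i) i) (rcurl (fun i => p \* u i) i) <=
    3 * K ^+ 2 * (ipO (rcurl u i) (rcurl u i) +
      (ipO (u (i + 2%:R)) (u (i + 2%:R)) + ipO (u (i + 1)) (u (i + 1)))).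
  have i1 := sqint_mul mO (qc i) (qc i).
  have i2 := sqint_mul mO (qu (i + 2%:R)) (qu (i + 2%:R)).
  have i3 := sqint_mul mO (qu (i + 1)) (qu (i + 1)).
  have i23 := integrableD mO i2 i3; have i123 := integrableD mO i1 i23.
  rewrite /ip -RintegralD// -RintegralD// -RintegralZl//.
  apply: le_Rintegral => //.
  - exact: (sqint_mul mO (qv i) (qv i)).
  - exact: (integrableZl mO _ i123).
  - move=> x Ox; rewrite rcurl_smoothM// -!expr2.
    by apply: leibniz_sqr_le; [exact: pK|exact: dpK|exact: dpK].
apply: le_trans (ler_sum _ (fun i _ => comp i)) _.
move: uM cM; rewrite /ipv !sum3 !I3_addE.
move: (ipO _ _) (ipO _ _) (ipO _ _) (ipO _ _) (ipO _ _) (ipO _ _) => a b c d e f.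
move=> h1 h2.
have K20 : 0 <= K ^+ 2 by rewrite sqr_ge0.
have -> : (3 * K * M) ^+ 2 = 3 * K ^+ 2 * (M ^+ 2 + 2 * M ^+ 2) by ring.
rewrite -!mulrDr; apply: ler_wpM2l; first by rewrite mulr_ge0.
lra.
Qed.

Lemma mollify_ip (eta f : T -> R) x : testin f ->
  mollify eta f x = ipO (fun y => eta (y - x)) f.
Proof.
move=> tf; rewrite /mollify -Rintegral_off; first by apply: eq_Rintegral => y _; rewrite mulrC.
by move=> y /(testfun_in_off tf) ->; rewrite mul0r.
Qed.

(** The constant depends on [f] only through its [L^2] norm, by Cauchy-Schwarz against a difference
    of two translates of [eta]. Mollifications of a bounded family are thus equicontinuous. *)
Lemma mollify_lipschitz (eta : T -> R) (M : R) : testfun eta ->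
  exists2 L, 0 < L & forall f, testin f -> ipO f f <= M ->
    forall x x', `|mollify eta f x - mollify eta f x'| <= L * `|x - x'|.
Proof.
move=> te; have [L L0 hL] := testfun_lipschitz te.
have qx (x : T) : sqO (fun y : T => eta (y - x)).
  have tx : testfun (fun y : T => eta (y - x)) by exact: testfun_translate.
  have [C hC] := testfun_bounded tx.
  apply: (sqint_bounded mO Ooo _ (fun y _ => hC y)).
  by apply: measurable_funTS; exact: testfun_measurable.
have ph := sqint_prehilbert (leb3 R) mO.
pose A := fine (leb3 R Omega).
have A0 : 0 <= A by exact/fine_ge0/measure_ge0.
pose N := Num.sqrt `|M|; pose S := Num.sqrt A.
have S2 : S ^+ 2 = A by rewrite sqr_sqrtr.
have N0 : 0 <= N by exact: sqrtr_ge0.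
have S0 : 0 <= S by exact: sqrtr_ge0.
exists (L * S * N + 1) => [|f tf fM x x']; first by rewrite ltr_wpDl// !mulr_ge0// ltW.
have qf := testfun_in_sqint tf.
apply: (@le_trans _ _ ((L * `|x - x'| * S) * N)); last first.
  have -> : L * `|x - x'| * S * N = L * S * N * `|x - x'| by ring.
  by apply: ler_wpM2r => //; rewrite lerDl.
rewrite !mollify_ip// -(bB ph (qx x) (qx x') qf).
apply: (norm_le_cs ph (phB ph (qx x) (qx x')) qf) => //.
- by rewrite !mulr_ge0// ltW.
- have -> : (L * `|x - x'| * S) ^+ 2 = \int[leb3 R]_(y in Omega) ((L * `|x - x'|) ^+ 2).
    by rewrite Rintegral_cst//= exprMn S2.
  apply: le_Rintegral => //.
  + exact: (sqint_mul mO (phB ph (qx x) (qx x')) (phB ph (qx x) (qx x'))).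
  + exact: (sqint_mul mO (sqint_cst mO _ Ooo) (sqint_cst mO _ Ooo)).
  + move=> y _; rewrite -expr2 -(real_normK (num_real (_ y))) lerXn2r ?nnegrE//.
      by rewrite mulr_ge0// ltW.
    have -> : `|x - x'| = `|(y - x) - (y - x')| :> R.
      by rewrite distrC opprB [_ + (x' - y)]addrC subrKA.
    exact: hL.
- by rewrite sqr_sqrtr//; apply: le_trans fM (ler_norm _).
Qed.

Lemma measurable_mollify (eta f : T -> R) : testfun eta -> testin f ->
  measurable_fun Omega (mollify eta f).
Proof.
move=> te tf; have [L L0 hL] := mollify_lipschitz (ipO f f) te.
apply: measurable_funTS; apply: continuous_measurable3 => x.
apply/cvgrPdist_lt => e e0; have eL : 0 < e / L by rewrite divr_gt0.
have /cvgrPdist_lt/(_ _ eL) := @cvg_id T (nbhs x).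
apply: filterS => x' h; apply: le_lt_trans (hL _ tf (lexx _) x x') _.
by rewrite mulrC -ltr_pdivlMr.
Qed.

(** At a fixed [x] the mollification is the inner product with the fixed function [eta(. - x)], so
    it tends to 0. The common Lipschitz constant extends this to a neighbourhood of [x], and
    compactness of the cube makes it uniform, along an arbitrary filter. *)
Lemma weak_null_mollify_uniform (J : Type) (F : set_system J) (f : J -> T -> R)
    (eta : T -> R) (M : R) : Filter F -> testfun eta ->
  (forall j, testin (f j)) -> (forall j, ipO (f j) (f j) <= M) ->
  (forall w : T -> R, sqO w -> ipO w (f j) @[j --> F] --> (0 : R)) ->
  forall e, 0 < e -> \forall j \near F, forall x, Omega x -> `|mollify eta (f j) x| <= e.
Proof.
move=> FF te tf fM fw e e0.
have [L L0 hL] := mollify_lipschitz M te.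
have e20 : 0 < e / 2 by rewrite divr_gt0.
have small (x : T) : \forall j \near F, `|mollify eta (f j) x| <= e / 2.
  have tx : testfun (fun y : T => eta (y - x)) by exact: testfun_translate.
  have qx : sqO (fun y : T => eta (y - x)).
    have [C hC] := testfun_bounded tx.
    apply: (sqint_bounded mO Ooo _ (fun y _ => hC y)).
    by apply: measurable_funTS; exact: testfun_measurable.
  have /cvgr0_norm_le/(_ _ e20) := fw _ qx.
  by apply: filterS => j; rewrite mollify_ip.
have cB := @compact_box R r; move/compact_near_coveringP in cB.
have := cB J F (fun j x => `|mollify eta (f j) x| <= e) FF.
have near_small (x : T) : \forall x' \near x & j \near F, `|mollify eta (f j) x'| <= e.
  have d0 : 0 < e / 2 / L by rewrite divr_gt0.
  exists ([set x' | `|x - x'| < e / 2 / L], [set j | `|mollify eta (f j) x| <= e / 2]).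
    split; last exact: small.
    by have /cvgrPdist_lt/(_ _ d0) := @cvg_id T (nbhs x).
  move=> [x' j] /= [xx' hx].
  have h := hL _ (tf j) (fM j) x x'.
  have h2 : L * `|x - x'| <= e / 2 by rewrite mulrC -ler_pdivlMr// ltW.
  have := ler_distD (mollify eta (f j) x) 0 (mollify eta (f j) x').
  rewrite !sub0r !normrN => h3; apply: le_trans h3 _.
  by move: h h2 hx; lra.
move=> /(_ (fun x _ => near_small x)); apply: filterS => j h x Ox.
by apply: h => /=; exact: Or.
Qed.

Lemma ipv_comp_le (u : field) i : sqvO u -> ipO (u i) (u i) <= ipvO u u.
Proof.
move=> qu; rewrite /ipv (bigD1 i)//= lerDl sumr_ge0// => k _.
exact: (ph_ge0 (sqint_prehilbert (leb3 R) mO)).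
Qed.

Lemma ip_mul_le (p f : T -> R) (K : R) : sqO f -> measurable_fun Omega p ->
  (forall x, Omega x -> `|p x| <= K) ->
  ipO (fun x => p x * f x) (fun x => p x * f x) <= K ^+ 2 * ipO f f.
Proof.
move=> qf mp pK; have qpf := sqint_mulb mO qf mp pK; have iff := sqint_mul mO qf qf.
rewrite /ip -RintegralZl//; apply: le_Rintegral => //.
- exact: (sqint_mul mO qpf qpf).
- exact: (integrableZl mO _ iff).
move=> x Ox; rewrite -!expr2 exprMn ler_wpM2r ?sqr_ge0//.
rewrite -(real_normK (num_real (p x))) lerXn2r ?nnegrE ?pK//.
exact: le_trans (pK _ Ox).
Qed.

Lemma ip_mulA (p f g : T -> R) : ipO f (fun x => p x * g x) = ipO (fun x => p x * f x) g.
Proof. by apply: eq_Rintegral => x _; rewrite mulrCA mulrA. Qed.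

(** The div-curl lemma for test fields with a weakly null factor. The cut fields [p f j] are test
    fields whose curls are bounded by [3 K M]; replacing them by mollifications costs an error
    uniform in [j], and the mollified fields tend to 0 uniformly. The compact support comes from
    [f j], so that the weight [p = 1] is covered too. *)
Lemma weak_null_rcurl_pairing (J : Type) (F : set_system J) (p : T -> R) (f g : J -> field)
    (K M : R) : Filter F -> smooth p ->
  (forall x, Omega x -> `|p x| <= K) ->
  (forall k x, Omega x -> `|partial k p x| <= K) ->
  0 <= K -> 0 <= M ->
  (forall j, testfield_in (f j)) -> (forall j, testfield_in (g j)) ->
  (forall j, ipvO (f j) (f j) <= M ^+ 2) ->
  (forall j, ipvO (rcurl (f j)) (rcurl (f j)) <= M ^+ 2) ->
  (forall j, ipvO (rcurl (g j)) (rcurl (g j)) <= M ^+ 2) ->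
  (forall (w : T -> R) i, sqO w -> ipO w (f j i) @[j --> F] --> (0 : R)) ->
  ipvO (rcurl (g j)) (fun i x => p x * f j i x) @[j --> F] --> (0 : R).
Proof.
move=> FF sp pK dpK K0 M0 tf tg fM cfM cgM fw.
have mp : measurable_fun Omega p.
  by apply: measurable_funTS; apply: continuous_measurable3; exact: smooth_continuous.
have tv j : testfield_in (fun i => p \* f j i) by move=> i; exact: (testfun_in_mul sp (tf j i)).
have cvM j := rcurl_smoothM_le sp (tf j) pK dpK (fM j) (cfM j).
have vM i j : ipO (p \* f j i) (p \* f j i) <= K ^+ 2 * M ^+ 2.
  apply: le_trans (ip_mul_le (testfun_in_sqint (tf j i)) mp pK) _.
  apply: ler_wpM2l; first exact: sqr_ge0.
  exact: le_trans (ipv_comp_le i (testfield_in_sqintv (tf j))) (fM j).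
have vw i (w : T -> R) : sqO w -> ipO w (p \* f j i) @[j --> F] --> (0 : R).
  move=> qw; under eq_fun do rewrite ip_mulA.
  by apply: fw; exact: (sqint_mulb mO qw mp pK).
pose A := fine (leb3 R Omega).
have A0 : 0 <= A by exact/fine_ge0/measure_ge0.
pose S := Num.sqrt A.
have S2 : S ^+ 2 = A by rewrite sqr_sqrtr.
have S0 : 0 <= S by exact: sqrtr_ge0.
apply/cvgr0Pnorm_le => e e0.
(* The mollification error [3 delta M (3 K M)] is at most [e / 2]; adding 1 keeps the denominator
   positive when [K] or [M] is 0. *)
pose delta := e / (2 * (3 * (M * (3 * K * M)) + 1)).
have c0 : 0 < 2 * (3 * (M * (3 * K * M)) + 1).
  by rewrite mulr_gt0// ltr_wpDl// !mulr_ge0.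
have d0 : 0 < delta by rewrite divr_gt0.
have [eta [te eta0 inteta suppeta]] := mollifier_exists d0.
(* Each of the three components contributes at most [M e' S], where [S] is the [L^2] norm of the
   constant 1; together they stay below [e / 2]. *)
pose e' := e / (2 * (3 * (M * S) + 1)).
have c1 : 0 < 2 * (3 * (M * S) + 1) by rewrite mulr_gt0// ltr_wpDl// !mulr_ge0.
have e'0 : 0 < e' by rewrite divr_gt0.
have small i := weak_null_mollify_uniform FF te (fun j => tv j i) (vM i) (vw i) e'0.
apply: filterS3 (small 0) (small 1) (small 2%:R) => j s0 s1 s2.
have s i x : Omega x -> `|mollify eta (p \* f j i) x| <= e'.
  by case: (I3_cases i) => ->; [exact: s0|exact: s1|exact: s2].
have tcg := testfield_in_rcurl (tg j).
have N0 : 0 <= 3 * K * M by rewrite !mulr_ge0.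
have b1 : ipvT (rcurl (g j)) (rcurl (g j)) <= M ^+ 2 by rewrite -ipv_testfield_in.
have b2 : ipvT (rcurl (fun i => p \* f j i)) (rcurl (fun i => p \* f j i)) <= (3 * K * M) ^+ 2.
  by rewrite -(ipv_testfield_in _ (testfield_in_rcurl (tv j))).
have := mollified_pairing te eta0 inteta suppeta (testfield_in_testfield (tg j))
  (testfield_in_testfield (tv j)) M0 N0 b1 b2.
rewrite pairing0//.
have qa i : sqO (mollify eta (p \* f j i)).
  by apply: (sqint_bounded mO Ooo _ (s i)); exact: (measurable_mollify te (tv j i)).
have comp i : `|\int[leb3 R]_x (rcurl (g j) i x * mollify eta (p \* f j i) x)| <= M * (e' * S).
  rewrite -[X in `|X|]/(ip (leb3 R) setT _ _) -(ip_testfun_in _ (tcg i)).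
  apply: (norm_le_cs (sqint_prehilbert (leb3 R) mO) (testfun_in_sqint (tcg i)) (qa i)) => //.
  - by rewrite mulr_ge0// ltW.
  - exact: le_trans (ipv_comp_le i (testfield_in_sqintv tcg)) (cgM j).
  have -> : (e' * S) ^+ 2 = \int[leb3 R]_(y in Omega) (e' ^+ 2).
    by rewrite Rintegral_cst//= exprMn S2.
  apply: le_Rintegral => //.
  - exact: (sqint_mul mO (qa i) (qa i)).
  - exact: (sqint_mul mO (sqint_cst mO _ Ooo) (sqint_cst mO _ Ooo)).
  - move=> y Oy; rewrite -!expr2 -(real_normK (num_real (mollify _ _ _))) lerXn2r ?nnegrE ?s//.
    exact: ltW.
have d2 : 3 * delta * (M * (3 * K * M)) <= e / 2.
  rewrite /delta -[leLHS](_ : e * (3 * (M * (3 * K * M))) / (2 * (3 * (M * (3 * K * M)) + 1)) = _); last by ring.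
  exact: mul_ratio_le_half.
have d3 : 3 * (M * (e' * S)) <= e / 2.
  rewrite /e' -[leLHS](_ : e * (3 * (M * S)) / (2 * (3 * (M * S) + 1)) = _); last by ring.
  exact: mul_ratio_le_half.
rewrite sum3 => h; apply: half_chain_le h (comp 0) (comp 1) (comp 2%:R) d2 d3.
Qed.

Let phv := sqintv_prehilbert (leb3 R) mO 'I_3.

(** [u] lies in [H_0(curl)] and has curl [v], expressed as membership of the pair in the closure of
    the graph of [rcurl] on test fields. Carrying the curl along makes this a linear condition on
    pairs, to which Mazur's theorem applies. *)
Definition H0pair (u v : field) := [/\ sqvO u, sqvO v & forall e, 0 < e ->
  exists phi, [/\ testfield_in phi, ipvO (u - phi) (u - phi) <= e ^+ 2 &
    ipvO (v - rcurl phi) (v - rcurl phi) <= e ^+ 2]].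

Lemma testfield_in_lincomb a (u v : field) : testfield_in u -> testfield_in v ->
  testfield_in (a *: u + v).
Proof. by move=> tu tv i; exact: (testfun_in_lincomb a (tu i) (tv i)). Qed.

Lemma rcurl_lincomb a (u v : field) : testfield u -> testfield v ->
  rcurl (a *: u + v) = a *: rcurl u + rcurl v.
Proof.
move=> tu tv; apply/funext => i; apply/funext => x.
have E k j := partialL k a (testfun_smooth (tu j)) (testfun_smooth (tv j)).
have -> : (a *: rcurl u + rcurl v) i x = a * rcurl u i x + rcurl v i x by [].
by rewrite /rcurl !E; ring.
Qed.

Lemma H0pair_testfield u : testfield_in u -> H0pair u (rcurl u).
Proof.
move=> tu; split.
- exact: testfield_in_sqintv.
- by apply: testfield_in_sqintv; exact: testfield_in_rcurl.
- move=> e e0; exists u; rewrite !subrr; have P0 := ph0 phv.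
  by rewrite !(b0l phv P0) sqr_ge0.
Qed.

Lemma rcurl0 : rcurl (0 : field) = 0.
Proof.
have t0 : testfield (0 : field) by move=> i; have [] := testfun_in0 Omega.
have := rcurl_lincomb (- 1) t0 t0.
by rewrite scaleN1r oppr0 addr0 scaleN1r addNr.
Qed.

Lemma H0pair0 : H0pair 0 0.
Proof.
by rewrite -{2}rcurl0; apply: H0pair_testfield => i; exact: testfun_in0.
Qed.

Lemma lincomb_sqr_le a (w z : field) (e : R) : sqvO w -> sqvO z ->
  ipvO w w <= (e / (2 * (`|a| + 1))) ^+ 2 -> ipvO z z <= (e / (2 * (`|a| + 1))) ^+ 2 ->
  ipvO (a *: w + z) (a *: w + z) <= e ^+ 2.
Proof.
move=> qw qz hw hz; apply: le_trans (bsqrD_le phv (phZ phv a qw) qz) _.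
rewrite (bZ phv _ qw (phZ phv a qw)) (bZr phv _ qw qw).
have a0 : 0 < 2 * (`|a| + 1) by rewrite mulr_gt0// ltr_wpDl.
have a2 : a * (a * ipvO w w) <= `|a| ^+ 2 * (e / (2 * (`|a| + 1))) ^+ 2.
  by rewrite mulrA -expr2 -(real_normK (num_real a)) ler_wpM2l ?sqr_ge0.
apply: (@le_trans _ _ (2 * (`|a| ^+ 2 * (e / (2 * (`|a| + 1))) ^+ 2) + 2 * (e / (2 * (`|a| + 1))) ^+ 2)).
  by move: a2 hz; move: (a * _) (ipvO z z) => s t; lra.
apply: le_trans (sqr_scale_le (normr_ge0 a) (sqr_ge0 _)) _.
by rewrite -exprMn mulrCA divff ?mulr1// gt_eqF.
Qed.

Lemma H0pair_lincomb a u v u' v' : H0pair u v -> H0pair u' v' ->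
  H0pair (a *: u + u') (a *: v + v').
Proof.
move=> [qu qv uv] [qu' qv' uv']; split; [exact: (phL phv)|exact: (phL phv)|].
move=> e e0.
have e'0 : 0 < e / (2 * (`|a| + 1)) by rewrite divr_gt0// mulr_gt0// ltr_wpDl.
have [p [tp h1 h2]] := uv _ e'0; have [q [tq h3 h4]] := uv' _ e'0.
exists (a *: p + q); split; first exact: testfield_in_lincomb.
  rewrite lincombB.
  apply: lincomb_sqr_le h1 h3.
    by apply: (phB phv) => //; exact: testfield_in_sqintv.
  by apply: (phB phv) => //; exact: testfield_in_sqintv.
rewrite rcurl_lincomb; try exact: testfield_in_testfield.
rewrite lincombB.
apply: lincomb_sqr_le h2 h4.
  by apply: (phB phv) => //; apply: testfield_in_sqintv; exact: testfield_in_rcurl.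
by apply: (phB phv) => //; apply: testfield_in_sqintv; exact: testfield_in_rcurl.
Qed.

Lemma rcurl_sym u v : testfield_in u -> testfield_in v ->
  ipvO u (rcurl v) = ipvO (rcurl u) v.
Proof.
move=> tu tv; rewrite !ipv_testfield_in//; last exact: testfield_in_rcurl.
have t i := testfield_in_testfield tu i; have s i := testfield_in_testfield tv i.
have E i j k : ip (leb3 R) setT (u i) (partial j (v k)) =
    - ip (leb3 R) setT (partial j (u i)) (v k).
  by rewrite /ip integration_by_parts3// opprK.
have phT := sqint_prehilbert (leb3 R) (@measurableT _ T).
have d (w : field) k j : testfield w -> sqint (leb3 R) setT (partial k (w j)).
  by move=> tw; exact: (testfun_sqint (testfun_partial k (tw j))).
pose B j m k := ip (leb3 R) setT (partial j (u m)) (v k).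
have L i : ip (leb3 R) setT (u i) (rcurl v i) =
    B (i + 2%:R) i (i + 1) - B (i + 1) i (i + 2%:R).
  rewrite -[rcurl v i]/(partial (i + 1) (v (i + 2%:R)) - partial (i + 2%:R) (v (i + 1))).
  by rewrite (bBr phT (d v _ _ s) (d v _ _ s) (testfun_sqint (t i))) !E opprK addrC.
have M i : ip (leb3 R) setT (rcurl u i) (v i) =
    B (i + 1) (i + 2%:R) i - B (i + 2%:R) (i + 1) i.
  rewrite -[rcurl u i]/(partial (i + 1) (u (i + 2%:R)) - partial (i + 2%:R) (u (i + 1))).
  by rewrite (bB phT (d u _ _ t) (d u _ _ t) (testfun_sqint (s i))).
rewrite /ipv (eq_bigr _ (fun i _ => L i)) (eq_bigr _ (fun i _ => M i)) !sum3 !I3_addE.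
by clear; move: B => B; ring.
Qed.

(** The symmetry of the curl on test fields passes to the closure. It makes [v] the distributional
    curl of [u]. *)
Lemma H0pair_rcurl_sym u v p : H0pair u v -> testfield_in p ->
  ipvO u (rcurl p) = ipvO v p.
Proof.
move=> [qu qv uv] tp.
have qp := testfield_in_sqintv tp; have qcp := testfield_in_sqintv (testfield_in_rcurl tp).
pose n (w : field) := Num.sqrt (ipvO w w).
have n0 w : 0 <= n w by exact: sqrtr_ge0.
have nE w : sqvO w -> ipvO w w <= n w ^+ 2.
  by move=> qw; rewrite sqr_sqrtr//; exact: (ph_ge0 phv).
apply/eqP; rewrite -subr_eq0 -normr_le0.
apply: (@le_of_small_error _ _ _ ((n u + n (rcurl p) + 1) + (n v + n p + 1))).
move=> e /andP[e0 e1]; have [q [tq h1 h2]] := uv _ e0.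
have qq := testfield_in_sqintv tq; have qcq := testfield_in_sqintv (testfield_in_rcurl tq).
have e01 : 0 <= e <= 1 by rewrite ltW.
have z w : ipvO (w - w) (w - w) <= e ^+ 2.
  by rewrite subrr (b0l phv (ph0 phv)) sqr_ge0.
have b1 := inner_approx_le phv qu qq qcp qcp (n0 _) (n0 _) e01 (nE _ qu) (nE _ qcp) h1 (z _).
have b2 := inner_approx_le phv qv qcq qp qp (n0 _) (n0 _) e01 (nE _ qv) (nE _ qp) h2 (z _).
rewrite add0r mulrDl; apply: le_trans (lerD b1 b2).
apply: le_trans (ler_normB _ _).
by rewrite (rcurl_sym tq tp) opprB addrA subrK.
Qed.

(** Density of test fields in [poincare_pairing]. The norm of [E] enters only the vanishing error
    term, so the final bound is in terms of the two curls, as needed for a bound on the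
    frequency. *)
Lemma H0pair_poincare (E C H D : field) (M N : R) : 0 <= r -> 0 <= M -> 0 <= N ->
  H0pair E C -> H0pair H D ->
  ipvO D D <= M ^+ 2 -> ipvO C C <= N ^+ 2 ->
  `|ipvO D E| <= (2 * r + 1) * (M * N).
Proof.
move=> r0 M0 N0 [qE qC EC] [qH qD HD] DM CN.
pose A := Num.sqrt (ipvO E E).
have A0 : 0 <= A by exact: sqrtr_ge0.
have EA : ipvO E E <= A ^+ 2 by rewrite sqr_sqrtr//; exact: (ph_ge0 phv).
apply: (@le_of_small_error _ _ _ ((M + A + 1) + (2 * r + 1) * (M + N + 1))).
move=> e /andP[e0 e1]; have e01 : 0 <= e <= 1 by rewrite ltW.
have [p [tp Ep Cp]] := EC _ e0; have [q [tq Hq Dq]] := HD _ e0.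
have qp := testfield_in_sqintv tp; have qcp := testfield_in_sqintv (testfield_in_rcurl tp).
have qcq := testfield_in_sqintv (testfield_in_rcurl tq).
have b1 := inner_approx_le phv qD qcq qE qp M0 A0 e01 DM EA Dq Ep.
have Me : 0 <= M + e by rewrite addr_ge0// ltW.
have Ne : 0 <= N + e by rewrite addr_ge0// ltW.
have cq : ipvT (rcurl q) (rcurl q) <= (M + e) ^+ 2.
  rewrite -(ipv_testfield_in _ (testfield_in_rcurl tq)).
  exact: (triangleB_le phv qD qcq M0 (ltW e0) DM Dq).
have cp : ipvT (rcurl p) (rcurl p) <= (N + e) ^+ 2.
  rewrite -(ipv_testfield_in _ (testfield_in_rcurl tp)).
  exact: (triangleB_le phv qC qcp N0 (ltW e0) CN Cp).
have off (u : field) : testfield_in u -> forall i x, r < `|x| -> u i x = 0.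
  move=> tu i x rx; apply: (testfun_in_off (tu i)) => /Or.
  by rewrite leNgt rx.
have := poincare_pairing (testfield_in_testfield tq) (testfield_in_testfield tp)
  Me Ne r0 (off _ tq) (off _ tp) cq cp.
rewrite (pairing0 _ (testfield_in_rcurl tq)) => b2.
by apply: product_error_le b1 b2; rewrite // addr_ge0// mulr_ge0.
Qed.

(** A pair of fields becomes one vector with six components, and the graph of the curl a subspace of
    a single space of the form [sqintv]. *)
Definition join (u v : field) : 'I_3 + 'I_3 -> T -> R :=
  fun i => match i with inl j => u j | inr j => v j end.

Lemma ipv_join (u v u' v' : field) :
  ipv (leb3 R) Omega (join u v) (join u' v') = ipvO u u' + ipvO v v'.
Proof. by rewrite /ipv big_sumType. Qed.

Lemma joinB (u v u' v' : field) : join u v - join u' v' = join (u - u') (v - v').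
Proof. by apply/funext => -[]. Qed.

Lemma joinL a (u v u' v' : field) :
  a *: join u v + join u' v' = join (a *: u + u') (a *: v + v').
Proof. by apply/funext => -[]. Qed.

Lemma cvg_ipv (J : Type) (F : set_system J) (I : finType) (w : I -> T -> R)
    (u : J -> I -> T -> R) (l : I -> T -> R) : Filter F ->
  (forall i, ipO (w i) (u j i) @[j --> F] --> ipO (w i) (l i)) ->
  ipv (leb3 R) Omega w (u j) @[j --> F] --> ipv (leb3 R) Omega w l.
Proof. by move=> FF h; apply: cvg_big => [|i _]; [exact: add_continuous|exact: h]. Qed.

(** The set of all [H0pair] is a subspace, hence by [weak_closed_closed] the weak limit is within
    [e / 2] of some pair in it; that pair is within [e / 2] of a test field and its curl. *)
Lemma H0pair_weak_limit (J : Type) (F : set_system J) (u v : J -> field) (lu lv : field)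
    (M : R) : ProperFilter F ->
  (forall j, H0pair (u j) (v j)) ->
  (forall j, ipvO (u j) (u j) <= M) -> (forall j, ipvO (v j) (v j) <= M) ->
  sqvO lu -> sqvO lv ->
  (forall (w : T -> R) i, sqO w -> ipO w (u j i) @[j --> F] --> ipO w (lu i)) ->
  (forall (w : T -> R) i, sqO w -> ipO w (v j i) @[j --> F] --> ipO w (lv i)) ->
  H0pair lu lv.
Proof.
move=> FF uv uM vM qlu qlv uw vw; split => // e e0.
have phJ := sqintv_prehilbert (leb3 R) mO ('I_3 + 'I_3)%type.
pose W : set ('I_3 + 'I_3 -> T -> R) :=
  [set w | exists p : field * field, H0pair p.1 p.2 /\ w = join p.1 p.2].
have WP : W `<=` sqintv (leb3 R) Omega (I := ('I_3 + 'I_3)%type).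
  by move=> _ [[a b] [[qa qb _] ->]] [] i; [exact: qa|exact: qb].
have Plv : sqintv (leb3 R) Omega (join lu lv) by move=> [] i; [exact: qlu|exact: qlv].
have WL a x y : W x -> W y -> W (a *: x + y).
  move=> [[u1 v1] [h1 ->]] [[u2 v2] [h2 ->]].
  exists (a *: u1 + u2, a *: v1 + v2); rewrite joinL; split => //.
  exact: H0pair_lincomb.
have W0 : W 0 by exists (0, 0); split; [exact: H0pair0|apply/funext => -[]].
have e20 : 0 < e / 2 by rewrite divr_gt0.
have bM j : ipv (leb3 R) Omega (join (u j) (v j)) (join (u j) (v j)) <= M + M.
  by rewrite ipv_join lerD.
have wk w : sqintv (leb3 R) Omega w ->
    ipv (leb3 R) Omega w (join (u j) (v j)) @[j --> F] --> ipv (leb3 R) Omega w (join lu lv).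
  by move=> qw; apply: cvg_ipv => -[] i; [exact: uw|exact: vw].
have e220 : 0 < (e / 2) ^+ 2 by rewrite exprn_gt0.
have [_ [[a b] [[qa qb ab] ->]] hab] := weak_closed_closed phJ FF WP Plv WL W0
  (fun j => ex_intro _ (u j, v j) (conj (uv j) erefl)) bM wk e220.
have [p [tp h1 h2]] := ab _ e20.
have qp := testfield_in_sqintv tp; have qcp := testfield_in_sqintv (testfield_in_rcurl tp).
move: hab; rewrite joinB ipv_join /= => hab.
have g1 := ph_ge0 phv (phB phv qlu qa); have g2 := ph_ge0 phv (phB phv qlv qb).
have k1 : ipvO (lu - a) (lu - a) <= (e / 2) ^+ 2 by apply: le_trans (ltW hab); rewrite lerDl.
have k2 : ipvO (lv - b) (lv - b) <= (e / 2) ^+ 2 by apply: le_trans (ltW hab); rewrite lerDr.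
have eE : e = e / 2 + e / 2 by rewrite -splitr.
exists p; split => //.
  have := triangle_le phv (phB phv qlu qa) (phB phv qa qp) (ltW e20) (ltW e20) k1 h1.
  by rewrite addrA subrK -eE.
have := triangle_le phv (phB phv qlv qb) (phB phv qb qcp) (ltW e20) (ltW e20) k2 h2.
by rewrite addrA subrK -eE.
Qed.

(** Multiplication by the localizing weight against which [gap] is integrated. *)
Definition scalef (p : T -> R) (u : field) : field := fun i x => p x * u i x.

Lemma scalefB p u v : scalef p (u - v) = scalef p u - scalef p v.
Proof.
apply/funext => i; apply/funext => x.
have -> : (scalef p u - scalef p v) i x = p x * u i x - p x * v i x by [].
by rewrite /scalef -mulrBr.
Qed.

Lemma ipv_scalefA p u v : ipvO u (scalef p v) = ipvO (scalef p u) v.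
Proof. by apply: eq_bigr => i _; exact: ip_mulA. Qed.

(** * The div-curl lemma in the closure of the graph *)

Section CompensatedCompactness.
Variables (p : T -> R) (K : R).
Hypotheses (sp : smooth p) (K0 : 0 <= K) (pK : forall x, Omega x -> `|p x| <= K)
  (dpK : forall k x, Omega x -> `|partial k p x| <= K).

Let mp : measurable_fun Omega p.
Proof. by apply: measurable_funTS; apply: continuous_measurable3; exact: smooth_continuous. Qed.

Lemma sqintv_scalef u : sqvO u -> sqvO (scalef p u).
Proof. by move=> qu i; exact: (sqint_mulb mO (qu i) mp pK). Qed.

Lemma ipv_scalef_le u : sqvO u -> ipvO (scalef p u) (scalef p u) <= K ^+ 2 * ipvO u u.
Proof.
by move=> qu; rewrite /ipv mulr_sumr; apply: ler_sum => i _; exact: (ip_mul_le (qu i) mp pK).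
Qed.

(** Each pair is replaced by a test field whose distance tends to 0 with [n]. The replacement
    preserves weak convergence to 0 and changes the pairing by a quantity that tends to 0, so
    [weak_null_rcurl_pairing] applies. *)
Lemma weak_null_H0pair (U : set_system nat) (E C H D : nat -> field) (M : R) :
  ProperFilter U -> \oo `<=` U -> 0 <= M ->
  (forall n, H0pair (E n) (C n)) -> (forall n, H0pair (H n) (D n)) ->
  (forall n, ipvO (E n) (E n) <= M ^+ 2) -> (forall n, ipvO (C n) (C n) <= M ^+ 2) ->
  (forall n, ipvO (D n) (D n) <= M ^+ 2) ->
  (forall (w : T -> R) i, sqO w -> ipO w (E n i) @[n --> U] --> (0 : R)) ->
  ipvO (D n) (scalef p (E n)) @[n --> U] --> (0 : R).
Proof.
move=> UF oU M0 EC HD EM CM DM Ew.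
have K1 : 0 < K + 1 by rewrite ltr_wpDl.
(* [e] tends to 0 along [U] because [U] refines [\oo]. The division by [K + 1] keeps the error below
   [e n] after multiplication by [p]. *)
pose e n : R := n.+1%:R^-1; pose d n : R := e n / (K + 1).
have e0 n : 0 < e n by rewrite invr_gt0.
have e1 n : e n <= 1 by rewrite invf_le1// ler1n.
have d0 n : 0 < d n by rewrite divr_gt0.
have de n : d n <= e n by rewrite ler_pdivrMr// ler_peMr ?lerDr// ltW.
have Kde n : K * d n <= e n.
  by rewrite mulrCA ger_pMr// ler_pdivrMr// mul1r lerDl.
have ecvg : e n @[n --> U] --> (0 : R).
  by move=> A /(@cvg_harmonic R) hA; exact: oU.
have [f hf] := choice (fun n => let: And3 _ _ h := EC n in h _ (d0 n)).
have [g hg] := choice (fun n => let: And3 _ _ h := HD n in h _ (d0 n)).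
have tf n : testfield_in (f n) by case: (hf n).
have tg n : testfield_in (g n) by case: (hg n).
have qf n := testfield_in_sqintv (tf n).
have qcf n := testfield_in_sqintv (testfield_in_rcurl (tf n)).
have qcg n := testfield_in_sqintv (testfield_in_rcurl (tg n)).
have qE n : sqvO (E n) by case: (EC n).
have qC n : sqvO (C n) by case: (EC n).
have qD n : sqvO (D n) by case: (HD n).
have en0 n : 0 <= e n by exact: ltW.
have dn0 n : 0 <= d n by exact: ltW.
have dsqr n : d n ^+ 2 <= e n ^+ 2 by rewrite lerXn2r ?nnegrE.
have h1 n : ipvO (E n - f n) (E n - f n) <= d n ^+ 2 by case: (hf n).
have h2 n : ipvO (C n - rcurl (f n)) (C n - rcurl (f n)) <= 1 ^+ 2.
  have [_ _ h] := hf n; apply: le_trans h _; apply: le_trans (dsqr n) _.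
  by rewrite lerXn2r ?nnegrE.
have h3 n : ipvO (D n - rcurl (g n)) (D n - rcurl (g n)) <= e n ^+ 2.
  by have [_ _ h] := hg n; apply: le_trans h (dsqr n).
have h4 n : ipvO (D n - rcurl (g n)) (D n - rcurl (g n)) <= 1 ^+ 2.
  by apply: le_trans (h3 n) _; rewrite lerXn2r ?nnegrE.
have h5 n : ipvO (E n - f n) (E n - f n) <= 1 ^+ 2.
  apply: le_trans (h1 n) _; apply: le_trans (dsqr n) _.
  by rewrite lerXn2r ?nnegrE.
have M1 : 0 <= M + 1 by rewrite addr_ge0.
have fw (w : T -> R) i : sqO w -> ipO w (f n i) @[n --> U] --> (0 : R).
  move=> qw; have ph := sqint_prehilbert (leb3 R) mO.
  pose N := Num.sqrt (ipO w w).
  have Nw : ipO w w <= N ^+ 2 by rewrite sqr_sqrtr//; exact: (ph_ge0 ph).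
  have N0 : 0 <= N by exact: sqrtr_ge0.
  have D0 : ipO w (E n i - f n i) @[n --> U] --> (0 : R).
    apply/cvgr0Pnorm_le => eps eps0.
    have epsN : 0 < eps / (N + 1) by rewrite divr_gt0// ltr_wpDl.
    move/cvgr0Pnorm_le: ecvg => /(_ _ epsN); apply: filterS => n hn.
    have qEf := phB phv (qE n) (qf n).
    have := norm_le_cs ph qw (qEf i) N0 (ltW (d0 n)) Nw (le_trans (ipv_comp_le i qEf) (h1 n)).
    move=> /le_trans; apply; rewrite (ger0_norm (ltW (e0 n))) in hn.
    have N1 : 0 < N + 1 by rewrite ltr_wpDl.
    rewrite ler_pdivlMr// in hn; apply: le_trans hn; rewrite mulrC.
    by apply: ler_pM => //; rewrite lerDl.
  have -> : (0 : R) = 0 - 0 by rewrite subr0.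
  under eq_fun => n.
    rewrite (_ : ipO w (f n i) = ipO w (E n i) - ipO w (E n i - f n i)).
    over.
    by rewrite (bBr ph (qE n i) (qf n i) qw) opprB addrC subrK.
  by apply: cvgB => //; exact: Ew.
have core := weak_null_rcurl_pairing (p := p) (f := f) (g := g) _ sp pK dpK K0 M1 tf tg
  (fun n => triangleB_le phv (qE n) (qf n) M0 ler01 (EM n) (h5 n))
  (fun n => triangleB_le phv (qC n) (qcf n) M0 ler01 (CM n) (h2 n))
  (fun n => triangleB_le phv (qD n) (qcg n) M0 ler01 (DM n) (h4 n)) fw.
have diff : ipvO (D n) (scalef p (E n)) - ipvO (rcurl (g n)) (scalef p (f n)) @[n --> U] --> (0 : R).
  apply/cvgr0Pnorm_le => eps eps0.
  have c0 : 0 < M + K * M + 1 by rewrite ltr_wpDl// addr_ge0// mulr_ge0.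
  have epsN : 0 < eps / (M + K * M + 1) by rewrite divr_gt0.
  move/cvgr0Pnorm_le: ecvg => /(_ _ epsN); apply: filterS => n hn.
  rewrite (ger0_norm (ltW (e0 n))) ler_pdivlMr// mulrC in hn; apply: le_trans hn.
  have e01 : 0 <= e n <= 1 by rewrite en0 e1.
  apply: (inner_approx_le phv (qD n) (qcg n) (sqintv_scalef (qE n)) (sqintv_scalef (qf n))
    M0 (mulr_ge0 K0 M0) e01 (DM n)) => //.
    by rewrite exprMn; apply: le_trans (ipv_scalef_le (qE n)) _; rewrite ler_wpM2l ?sqr_ge0.
  rewrite -scalefB; apply: le_trans (ipv_scalef_le (phB phv (qE n) (qf n))) _.
  apply: (@le_trans _ _ ((K * d n) ^+ 2)); first by rewrite exprMn ler_wpM2l ?sqr_ge0.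
  by rewrite lerXn2r ?nnegrE// mulr_ge0.
have -> : (0 : R) = 0 + 0 by rewrite addr0.
under eq_fun => n do rewrite -[ipvO (D n) _](subrK (ipvO (rcurl (g n)) (scalef p (f n)))).
by apply: cvgD; [exact: diff|exact: core].
Qed.

(** Expanding around the limits leaves terms linear in one sequence, which converge weakly, and the
    pairing of [D n - lD] with [E n - lE], which tends to 0 by [weak_null_H0pair]. *)
Lemma compensated_compactness (U : set_system nat) (E C H D : nat -> field)
    (lE lC lH lD : field) (M : R) :
  ProperFilter U -> \oo `<=` U -> 0 <= M ->
  (forall n, H0pair (E n) (C n)) -> (forall n, H0pair (H n) (D n)) ->
  H0pair lE lC -> H0pair lH lD ->
  (forall n, ipvO (E n) (E n) <= M ^+ 2) -> (forall n, ipvO (C n) (C n) <= M ^+ 2) ->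
  (forall n, ipvO (D n) (D n) <= M ^+ 2) ->
  (forall (w : T -> R) i, sqO w -> ipO w (E n i) @[n --> U] --> ipO w (lE i)) ->
  (forall (w : T -> R) i, sqO w -> ipO w (D n i) @[n --> U] --> ipO w (lD i)) ->
  ipvO (D n) (scalef p (E n)) @[n --> U] --> ipvO lD (scalef p lE).
Proof.
move=> UF oU M0 EC HD lEC lHD EM CM DM Ew Dw.
have qE n : sqvO (E n) by case: (EC n).
have qC n : sqvO (C n) by case: (EC n).
have qD n : sqvO (D n) by case: (HD n).
have [qlE qlC _] := lEC; have [_ qlD _] := lHD.
pose n (w : field) := Num.sqrt (ipvO w w).
have n0 w : 0 <= n w by exact: sqrtr_ge0.
pose N := n lE + n lC + n lD.
have nN (w : field) : sqvO w -> n w <= N -> ipvO w w <= N ^+ 2.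
  move=> qw wN; rewrite -[ipvO w w]sqr_sqrtr; last exact: (ph_ge0 phv).
  by rewrite lerXn2r ?nnegrE//; exact: le_trans wN.
have N0 : 0 <= N by rewrite !addr_ge0.
have NE : ipvO lE lE <= N ^+ 2 by apply: nN => //; rewrite /N -addrA lerDl addr_ge0.
have NC : ipvO lC lC <= N ^+ 2.
  by apply: nN => //; rewrite /N addrAC lerDr addr_ge0.
have ND : ipvO lD lD <= N ^+ 2 by apply: nN => //; rewrite /N lerDr addr_ge0.
have MN (a b : field) : sqvO a -> sqvO b -> ipvO a a <= M ^+ 2 -> ipvO b b <= N ^+ 2 ->
    ipvO (- 1 *: b + a) (- 1 *: b + a) <= (N + M) ^+ 2.
  move=> qa qb aM bN; apply: (triangle_le phv (phZ phv _ qb) qa) => //.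
  by rewrite (bZ phv _ qb (phZ phv _ qb)) (bZr phv _ qb qb) mulrA mulrNN mulr1 mul1r.
have NM0 : 0 <= N + M by rewrite addr_ge0.
have w0 (w : T -> R) i : sqO w -> ipO w ((- 1 *: lE + E n) i) @[n --> U] --> (0 : R).
  move=> qw; have ph := sqint_prehilbert (leb3 R) mO.
  have -> : (0 : R) = - 1 * ipO w (lE i) + ipO w (lE i) by rewrite mulN1r addNr.
  under eq_fun do rewrite (bMr ph _ (qlE i) (qE _ i) qw).
  by apply: cvgD; [exact: cvg_cst|exact: Ew].
have core := weak_null_H0pair UF oU NM0 (fun n => H0pair_lincomb (- 1) lEC (EC n))
  (fun n => H0pair_lincomb (- 1) lHD (HD n)) (fun n => MN _ _ (qE n) qlE (EM n) NE)
  (fun n => MN _ _ (qC n) qlC (CM n) NC) (fun n => MN _ _ (qD n) qlD (DM n) ND) w0.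
have s1 : ipvO (D n) (scalef p lE) @[n --> U] --> ipvO lD (scalef p lE).
  rewrite (phC phv lD); under eq_fun do rewrite (phC phv (D _)).
  by apply: cvg_ipv => i; apply: Dw; exact: (sqintv_scalef qlE).
have s2 : ipvO lD (scalef p (E n)) @[n --> U] --> ipvO lD (scalef p lE).
  rewrite ipv_scalefA; under eq_fun do rewrite ipv_scalefA.
  by apply: cvg_ipv => i; apply: Ew; exact: (sqintv_scalef qlD).
have X : ipvO lD (scalef p lE) =
  0 + ipvO lD (scalef p lE) + ipvO lD (scalef p lE) - ipvO lD (scalef p lE).
  by rewrite add0r addrK.
rewrite [X in _ --> X]X.
have decomp m : ipvO (D m) (scalef p (E m)) =
   ipvO (- 1 *: lD + D m) (scalef p (- 1 *: lE + E m)) +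
   ipvO (D m) (scalef p lE) + ipvO lD (scalef p (E m)) - ipvO lD (scalef p lE).
  rewrite !scaleN1r ![- _ + _]addrC scalefB.
  have k1 := sqintv_scalef (qE m); have k2 := sqintv_scalef qlE.
  rewrite (bB phv (qD m) qlD (phB phv k1 k2)) !(bBr phv k1 k2)//.
  move: (ipvO (D m) _) (ipvO (D m) _) (ipvO lD _) (ipvO lD _) => a b c d.
  by rewrite opprB addrA; clear; ring.
under eq_fun do rewrite decomp.
by apply: cvgB; [apply: cvgD; [apply: cvgD|]|exact: cvg_cst].
Qed.

End CompensatedCompactness.

End FieldsInDomain.

(** * Elimination of the coefficients *)

Section PointwiseAlgebra.
Variable R : realType.
Implicit Types (y z : 'I_3 -> R) (a b : R).

Definition dot y z : R := \sum_i y i * z i.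

Lemma dotE y z : dot y z = y 0 * z 0 + y 1 * z 1 + y 2%:R * z 2%:R.
Proof. exact: sum3. Qed.

Lemma dot_ge0 y : 0 <= dot y y.
Proof. by apply: sumr_ge0 => i _; rewrite -expr2 sqr_ge0. Qed.

(* This is [(z - a y) . (b y - z)], nonnegative exactly when some symmetric
   matrix with spectrum in [[a, b]] maps [y] to [z]. *)
Definition gap a b y z : R := (a + b) * dot z y - dot z z - a * b * dot y y.

Lemma gap_dot_ge a b y z : a < b -> 0 <= gap a b y z -> a * dot y y <= dot z y.
Proof.
move=> ab g0; have n0 := dot_ge0 (fun i => z i - a * y i).
have E : (b - a) * (dot z y - a * dot y y) = gap a b y z + dot (fun i => z i - a * y i) (fun i => z i - a * y i).
  by rewrite /gap !dotE; ring.
by rewrite -subr_ge0 -(pmulr_rge0 _ (_ : 0 < b - a)) ?subr_gt0// E addr_ge0.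
Qed.

Lemma gap_dot_le a b y z : 0 <= a -> a < b -> 0 <= gap a b y z ->
  dot z z <= b ^+ 2 * dot y y.
Proof.
move=> a0 ab g0; pose w i := b * y i - z i; have n0 := dot_ge0 w.
have E : (b - a) * (b ^+ 2 * dot y y - dot z z) =
    (b - a) * dot w w + 2 * (b - a) * gap a b y z + 2 * a * (gap a b y z + dot w w).
  by rewrite /gap /w !dotE; ring.
have ba : 0 < b - a by rewrite subr_gt0.
rewrite -subr_ge0 -(pmulr_rge0 _ ba) E; have ba0 := ltW ba.
apply: addr_ge0; first apply: addr_ge0.
- exact: mulr_ge0.
- by rewrite !mulr_ge0.
- by rewrite !mulr_ge0// addr_ge0.
Qed.

Lemma quadratic_formE (A : 'M[R]_3) (y : 'cV[R]_3) :
  (y^T *m (A *m y)) 0 0 = dot (y ^~ 0) (fun i => (A *m y) i 0).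
Proof. by rewrite mxE; apply: eq_bigr => i _; rewrite mxE. Qed.

Lemma sum_sqrE (y : 'cV[R]_3) : \sum_i y i 0 ^+ 2 = dot (y ^~ 0) (y ^~ 0).
Proof. by apply: eq_bigr => i _; rewrite expr2. Qed.

(** With [P = A - a] and [Q = b - A], which commute and add up to [b - a], [gap] is [P y . Q y], and
    [(b - a) P Q = P Q P + Q P Q]. The two summands are the forms of [Q] at [w1 = P y] and of [P] at
    [w2 = Q y], so no square root of a matrix is used. *)
Lemma Msym_gap a b (A : 'M[R]_3) y z : a < b -> Msym a b A ->
  (forall i, z i = \sum_j A i j * y j) -> 0 <= gap a b y z.
Proof.
move=> ab [sA hA] zE.
pose w1 : 'cV[R]_3 := \col_i (z i - a * y i).
pose w2 : 'cV[R]_3 := \col_i (b * y i - z i).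
have /andP[_] := hA w1; have /andP[+ _] := hA w2.
rewrite !quadratic_formE !sum_sqrE -subr_ge0 => h2; rewrite -subr_ge0 => h1.
have ba : 0 < b - a by rewrite subr_gt0.
rewrite -(pmulr_rge0 _ ba); have := addr_ge0 h1 h2; congr (0 <= _).
have s i j : A i j = A j i by rewrite -{1}sA mxE.
have mE (w : 'cV[R]_3) i : (A *m w) i 0 = A i 0 * w 0 0 + A i 1 * w 1 0 + A i 2%:R * w 2%:R 0.
  by rewrite mxE sum3.
rewrite /gap !dotE !mE !mxE !zE !sum3 (s 1 0) (s 2%:R 0) (s 2%:R 1).
clear; move: (A 0 0) (A 0 1) (A 0 2%:R) (A 1 1) (A 1 2%:R) (A 2%:R 2%:R) (y 0) (y 1) (y 2%:R).
move=> p q r t u v x1 x2 x3; ring.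
Qed.

(** If [p . y = 0], the quotient is 0 by the convention for division and the matrix is [a I]. This
    is the right value: [gap >= 0] then forces [p = 0], that is [z = a y]. *)
Definition rank_one_shift a y z : 'M[R]_3 := \matrix_(i, j)
  (a *+ (i == j) + (z i - a * y i) * (z j - a * y j) / dot (fun i => z i - a * y i) y).

Lemma cauchy_schwarz3 y z : (dot y z) ^+ 2 <= dot y y * dot z z.
Proof.
rewrite -subr_ge0.
have -> : dot y y * dot z z - dot y z ^+ 2 = (y 0 * z 1 - y 1 * z 0) ^+ 2 +
   (y 0 * z 2%:R - y 2%:R * z 0) ^+ 2 + (y 1 * z 2%:R - y 2%:R * z 1) ^+ 2.
  by rewrite !dotE; ring.
by rewrite !addr_ge0// sqr_ge0.
Qed.

Lemma gap_shift a b y z (p := fun i => z i - a * y i) :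
  gap a b y z = (b - a) * dot p y - dot p p.
Proof. by rewrite /gap /p !dotE; ring. Qed.

Lemma rank_one_shiftE a y z (x : 'I_3 -> R) i (p := fun i => z i - a * y i) :
  \sum_j rank_one_shift a y z i j * x j = a * x i + p i * (dot p x / dot p y).
Proof.
under eq_bigr do rewrite mxE mulrDl.
rewrite big_split/=; congr (_ + _).
  rewrite (bigD1 i)//= eqxx mulr1n big1 ?addr0// => j ji.
  by rewrite eq_sym (negbTE ji) mul0r.
rewrite mulrA {2}/dot mulr_sumr mulr_suml; apply: eq_bigr => j _.
by rewrite mulrAC; congr (_ / _); rewrite /p mulrA.
Qed.

Lemma rank_one_shift_mul a b y z : a < b -> 0 <= gap a b y z ->
  forall i, \sum_j rank_one_shift a y z i j * y j = z i.
Proof.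
move=> ab; rewrite gap_shift => g0 i.
pose p i := z i - a * y i; rewrite -/p in g0.
rewrite rank_one_shiftE -/p -/(p i) mulrA.
have [d0|d0] := eqVneq (dot p y) 0.
  have pp0 : dot p p = 0.
    by apply/eqP; rewrite eq_le dot_ge0 andbT; move: g0; rewrite d0 mulr0 sub0r oppr_ge0.
  have /eqP := pp0; rewrite psumr_eq0; last by move=> j _; rewrite -expr2 sqr_ge0.
  move=> /allP/(_ i); rewrite mem_index_enum -expr2 sqrf_eq0 => /(_ isT)/eqP pi0.
  by rewrite pi0 !mul0r addr0; move: pi0; rewrite /p => /eqP; rewrite subr_eq0 => /eqP.
by rewrite mulfK// /p addrC subrK.
Qed.

(** The rank-one part is nonnegative with norm [|p|^2 / (p . y)], and [gap_shift] turns [gap >= 0]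
    into the bound [b - a] for it. *)
Lemma rank_one_shift_Msym a b y z : a < b -> 0 <= gap a b y z ->
  Msym a b (rank_one_shift a y z).
Proof.
move=> ab; rewrite gap_shift; set p := (fun i => z i - a * y i) => g0.
have ba : 0 < b - a by rewrite subr_gt0.
have d0 : 0 <= dot p y.
  by rewrite -(pmulr_rge0 _ ba); apply: le_trans (dot_ge0 p) _; rewrite -subr_ge0.
split=> [|x].
  by apply/matrixP => i j; rewrite !mxE eq_sym [(z j - _) * _]mulrC.
have -> : (x^T *m (rank_one_shift a y z *m x)) 0 0 =
    a * dot (x ^~ 0) (x ^~ 0) + (dot p (x ^~ 0)) ^+ 2 / dot p y.
  rewrite quadratic_formE expr2 -mulrA {1 2 3}/dot mulr_suml mulr_sumr -big_split/=.
  apply: eq_bigr => i _; rewrite mxE (rank_one_shiftE a y z (x ^~ 0)) -/p -/(p i).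
  by move: (_ / _) => s; ring.
rewrite sum_sqrE; set X := dot _ _.
have X0 : 0 <= X by exact: dot_ge0.
have t0 : 0 <= dot p (x ^~ 0) ^+ 2 / dot p y by rewrite divr_ge0// sqr_ge0.
apply/andP; split; first by rewrite lerDl.
suff : dot p (x ^~ 0) ^+ 2 / dot p y <= (b - a) * X by lra.
have [->|dn0] := eqVneq (dot p y) 0; first by rewrite invr0 mulr0 mulr_ge0// ltW.
have dp : 0 < dot p y by rewrite lt_neqAle eq_sym dn0.
rewrite ler_pdivrMr//; apply: le_trans (cauchy_schwarz3 _ _) _.
by rewrite mulrAC ler_wpM2r// -subr_ge0.
Qed.

Lemma rank_one_shift_le a b y z i j : 0 <= a -> a < b -> 0 <= gap a b y z ->
  `|rank_one_shift a y z i j| <= a + (b - a).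
Proof.
move=> a0 ab; rewrite gap_shift mxE; set p := (fun i => z i - a * y i) => g0.
have ba : 0 < b - a by rewrite subr_gt0.
have d0 : 0 <= dot p y.
  by rewrite -(pmulr_rge0 _ ba); apply: le_trans (dot_ge0 p) _; rewrite -subr_ge0.
apply: le_trans (ler_normD _ _) _; apply: lerD.
  by case: eqP => _; rewrite ?mulr1n ?mulr0n ?normr0// ger0_norm.
rewrite normf_div (ger0_norm d0).
have [->|dn0] := eqVneq (dot p y) 0; first by rewrite invr0 mulr0 ltW.
have dp : 0 < dot p y by rewrite lt_neqAle eq_sym dn0.
rewrite ler_pdivrMr//; apply: (@le_trans _ _ (dot p p)); last by rewrite -subr_ge0.
have pk k : p k ^+ 2 <= dot p p.
  by rewrite /dot (bigD1 k)//= -expr2 lerDl sumr_ge0// => l _; rewrite -expr2 sqr_ge0.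
have := pk i; have := pk j; rewrite -/(p i) -/(p j).
have : 2 * `|p i * p j| <= p i ^+ 2 + p j ^+ 2.
  rewrite normrM -(real_normK (num_real (p i))) -(real_normK (num_real (p j))).
  rewrite -subr_ge0 (_ : _ - _ = (`|p i| - `|p j|) ^+ 2) ?sqr_ge0//; ring.
move: (`|_|) (dot p p) (p i ^+ 2) (p j ^+ 2) => {}A B C D; lra.
Qed.

End PointwiseAlgebra.
(** * Eigenfields and their weak limits *)

(** Here [m] and [n] stand for the norms of [E] and [H]. Adding the two inequalities gives
    [a w (m^2 + n^2) <= 2 L b^2 w^2 m n], and [2 m n <= m^2 + n^2]. *)
Lemma frequency_bound (R : realFieldType) (a b w m n L : R) : 0 < L -> 0 < w ->
  0 < m ^+ 2 + n ^+ 2 ->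
  a * w * m ^+ 2 <= L * (b * w * m * (b * w * n)) ->
  a * w * n ^+ 2 <= L * (b * w * n * (b * w * m)) ->
  a <= w * (L * b ^+ 2).
Proof.
move=> L0 w0 mn h1 h2.
have c0 : 0 < w * (m ^+ 2 + n ^+ 2) by rewrite mulr_gt0.
have amgm : 0 <= L * (b * w) ^+ 2 * (m - n) ^+ 2 by rewrite mulr_ge0 ?sqr_ge0// mulr_ge0 ?sqr_ge0// ltW.
rewrite -(ler_pM2l c0) -subr_ge0.
have -> : w * (m ^+ 2 + n ^+ 2) * (w * (L * b ^+ 2)) - w * (m ^+ 2 + n ^+ 2) * a =
  L * (b * w) ^+ 2 * (m - n) ^+ 2 + (L * (b * w * m * (b * w * n)) - a * w * m ^+ 2) +
  (L * (b * w * n * (b * w * m)) - a * w * n ^+ 2) by ring.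
by rewrite addr_ge0 ?subr_ge0// addr_ge0 ?subr_ge0.
Qed.

Lemma ler_cvg_all (R : realType) (U : set_system nat) (f g : nat -> R) (l m : R) :
  ProperFilter U -> f n @[n --> U] --> l -> g n @[n --> U] --> m -> (forall n, f n <= g n) -> l <= m.
Proof. by move=> UF fl gm fg; apply: (ler_cvg_to fl gm); exact: nearW. Qed.

Lemma partial_cst (R : realType) (k : 'I_3) (c : R) (x : R3 R) : partial k (cst c) x = 0.
Proof. exact: derive_cst. Qed.

Section EigenLimits.
Variables (R : realType) (Omega : set (R3 R)) (r : R).
Notation T := (R3 R).
Notation field := ('I_3 -> T -> R).
Hypotheses (oOmega : open Omega) (r0 : 0 <= r) (Or : forall x, Omega x -> `|x| <= r).
Let mO : measurable Omega := open_measurable3 oOmega.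
Let Ooo : (leb3 R Omega < +oo)%E := leb3_bounded_lt mO Or.
Notation sqO := (sqint (leb3 R) Omega).
Notation sqvO := (@sqintv _ _ _ (leb3 R) Omega 'I_3).
Notation ipO := (ip (leb3 R) Omega).
Notation ipvO := (@ipv _ _ _ (leb3 R) Omega 'I_3).
Let phv := sqintv_prehilbert (leb3 R) mO 'I_3.

Lemma Rintegral_ae_ge0 (h : T -> R) : (leb3 R).-integrable Omega (EFin \o h) ->
  {ae leb3 R, forall x, Omega x -> 0 <= h x} -> 0 <= \int[leb3 R]_(x in Omega) h x.
Proof.
move=> ih h0; have mh : measurable_fun Omega h by have /integrableP[/measurable_EFinP] := ih.
rewrite /Rintegral (@ae_eq_integral _ _ _ _ _ (fun x => (`|h x|)%:E) (EFin \o h) mO).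
- by apply: fine_ge0; apply: integral_ge0 => x _; rewrite lee_fin.
- by case/integrableP: ih.
- by apply/measurable_EFinP; exact: measurableT_comp.
- by move: h0; apply: filterS => x hx Ox /=; rewrite ger0_norm ?hx.
Qed.

Lemma dot_integrable (u v : field) : sqvO u -> sqvO v ->
  (leb3 R).-integrable Omega (EFin \o (fun x => dot (u ^~ x) (v ^~ x))).
Proof.
move=> qu qv; have i k := sqint_mul mO (qu k) (qv k).
have := integrableD mO (integrableD mO (i 0) (i 1)) (i 2%:R).
by apply: eq_integrable => // x _; rewrite /= dotE.
Qed.

Lemma ipv_dot (u v : field) : sqvO u -> sqvO v ->
  ipvO u v = \int[leb3 R]_(x in Omega) dot (u ^~ x) (v ^~ x).
Proof.
move=> qu qv; have i k := sqint_mul mO (qu k) (qv k).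
under eq_Rintegral do rewrite dotE.
rewrite /ipv sum3 RintegralD//; first by rewrite RintegralD.
exact: (integrableD mO (i 0) (i 1)).
Qed.

Lemma gap_integrable a b (y z : field) : sqvO y -> sqvO z ->
  (leb3 R).-integrable Omega (EFin \o (fun x => gap a b (y ^~ x) (z ^~ x))).
Proof.
move=> qy qz; have izy := dot_integrable qz qy.
have izz := dot_integrable qz qz; have iyy := dot_integrable qy qy.
exact: (integrableB mO (integrableB mO (integrableZl mO (a + b) izy) izz) (integrableZl mO (a * b) iyy)).
Qed.

Lemma dot_scalef p (u v : field) x : dot (u ^~ x) (scalef p v ^~ x) = p x * dot (u ^~ x) (v ^~ x).
Proof. by rewrite /dot mulr_sumr; apply: eq_bigr => i _; rewrite /scalef mulrCA. Qed.

Lemma dot_scale (w : R) (u v : field) x : dot (u ^~ x) ((w *: v) ^~ x) = w * dot (u ^~ x) (v ^~ x).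
Proof. exact: (dot_scalef (cst w)). Qed.

Lemma dotC (u v : 'I_3 -> R) : dot u v = dot v u.
Proof. by apply: eq_bigr => i _; exact: mulrC. Qed.

Lemma scaled_gapE a b w (y z : field) x : gap a b ((w *: y) ^~ x) (z ^~ x) =
  (a + b) * w * dot (z ^~ x) (y ^~ x) - dot (z ^~ x) (z ^~ x) - a * b * w ^+ 2 * dot (y ^~ x) (y ^~ x).
Proof. by rewrite (_ : (w *: y) ^~ x = fun i => w * y i x)// /gap !dotE; ring. Qed.

Lemma weighted_gap_integral a b w p K (y z : field) : smooth p ->
  (forall x, Omega x -> `|p x| <= K) -> sqvO y -> sqvO z ->
  (leb3 R).-integrable Omega (EFin \o (fun x => p x * gap a b ((w *: y) ^~ x) (z ^~ x))) /\
  \int[leb3 R]_(x in Omega) (p x * gap a b ((w *: y) ^~ x) (z ^~ x)) =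
  (a + b) * w * ipvO z (scalef p y) - ipvO z (scalef p z) - a * b * w ^+ 2 * ipvO y (scalef p y).
Proof.
move=> sp pK qy qz.
have qpy := sqintv_scalef oOmega sp pK qy; have qpz := sqintv_scalef oOmega sp pK qz.
have izy := dot_integrable qz qpy.
have izz := dot_integrable qz qpz; have iyy := dot_integrable qy qpy.
have j1 := integrableZl mO ((a + b) * w) izy.
have j2 := integrableZl mO (a * b * w ^+ 2) iyy.
have j12 := integrableB mO j1 izz; have j := integrableB mO j12 j2.
have E x : p x * gap a b ((w *: y) ^~ x) (z ^~ x) =
  (a + b) * w * dot (z ^~ x) (scalef p y ^~ x) - dot (z ^~ x) (scalef p z ^~ x) -
  a * b * w ^+ 2 * dot (y ^~ x) (scalef p y ^~ x).
  by rewrite scaled_gapE !dot_scalef; ring.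
split; first by apply: eq_integrable j => // x _; rewrite /= E.
under eq_Rintegral do rewrite E.
by rewrite !ipv_dot// RintegralB// RintegralB// !RintegralZl.
Qed.

(** The expansion of the nonnegative integral of [p |u - l|^2]. The left side is affine in [u],
    hence weakly continuous, and touches the right side at [u = l]; in this form weak lower
    semicontinuity can be inserted into an inequality before passing to the limit. *)
Lemma weak_lower_bound p K (u l : field) : smooth p -> (forall x, Omega x -> `|p x| <= K) ->
  (forall x, 0 <= p x) -> sqvO u -> sqvO l ->
  2 * ipvO (scalef p l) u - ipvO l (scalef p l) <= ipvO u (scalef p u).
Proof.
move=> sp pK p0 qu ql.
have qpu := sqintv_scalef oOmega sp pK qu; have qpl := sqintv_scalef oOmega sp pK ql.
have h : 0 <= ipvO (u - l) (scalef p (u - l)).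
  rewrite ipv_dot; last by rewrite scalefB; exact: (phB phv).
    by apply: Rintegral_ge0 => x _; rewrite dot_scalef mulr_ge0// dot_ge0.
  exact: (phB phv).
move: h; rewrite scalefB (bB phv qu ql (phB phv qpu qpl)) !(bBr phv qpu qpl)//.
rewrite [ipvO l (scalef p u)]ipv_scalefA (phC phv u (scalef p l)).
by move: (ipvO (scalef p l) u) (ipvO u _) (ipvO l _) => s t v; lra.
Qed.

(** The inequality is integrated against a nonnegative test function [p]. The two square terms are
    replaced by their affine minorants, which converge weakly, and the mixed term converges by
    compensated compactness. At the limit the minorants equal the squares, and the arbitrariness of
    [p] returns the pointwise inequality. *)
Lemma limit_gap a b (U : set_system nat) (wn : nat -> R) (w : R) (E C H D : nat -> field)
    (lE lC lH lD : field) (M : R) :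
  0 <= a -> 0 <= b ->
  ProperFilter U -> \oo `<=` U -> 0 <= M ->
  (forall n, H0pair Omega (E n) (C n)) -> (forall n, H0pair Omega (H n) (D n)) ->
  H0pair Omega lE lC -> H0pair Omega lH lD ->
  (forall n, ipvO (E n) (E n) <= M ^+ 2) -> (forall n, ipvO (C n) (C n) <= M ^+ 2) ->
  (forall n, ipvO (D n) (D n) <= M ^+ 2) ->
  (forall (f : T -> R) i, sqO f -> ipO f (E n i) @[n --> U] --> ipO f (lE i)) ->
  (forall (f : T -> R) i, sqO f -> ipO f (D n i) @[n --> U] --> ipO f (lD i)) ->
  wn n @[n --> U] --> w ->
  (forall n, {ae leb3 R, forall x, Omega x -> 0 <= gap a b ((wn n *: E n) ^~ x) (D n ^~ x)}) ->
  {ae leb3 R, forall x, Omega x -> 0 <= gap a b ((w *: lE) ^~ x) (lD ^~ x)}.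
Proof.
move=> a0 b0 UF oU M0 EC HD lEC lHD EM CM DM Ew Dw ww g0.
have qE n : sqvO (E n) by case: (EC n).
have qD n : sqvO (D n) by case: (HD n).
have [qlE qlC _] := lEC; have [_ qlD _] := lHD.
apply: (ae_ge0_of_testfun oOmega).
  exact: (gap_integrable a b (phZ phv w qlE) qlD).
move=> p [tp _] p0; have [K [K0 pK dpK]] := testfun_C1_bounded tp.
have sp := testfun_smooth tp.
have pK' x : Omega x -> `|p x| <= K by move=> _; exact: pK.
have dpK' k x : Omega x -> `|partial k p x| <= K by move=> _; exact: dpK.
have cc := compensated_compactness oOmega Or sp K0 pK' dpK' UF oU M0 EC HD lEC lHD EM CM DM Ew Dw.
have [_ ->] := weighted_gap_integral a b w sp pK' qlE qlD.
have qplE := sqintv_scalef oOmega sp pK' qlE; have qplD := sqintv_scalef oOmega sp pK' qlD.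
have cE : ipvO (scalef p lE) (E n) @[n --> U] --> ipvO (scalef p lE) lE.
  by apply: cvg_ipv => i; apply: Ew; exact: qplE.
have cD : ipvO (scalef p lD) (D n) @[n --> U] --> ipvO (scalef p lD) lD.
  by apply: cvg_ipv => i; apply: Dw; exact: qplD.
have ineq n : 2 * ipvO (scalef p lD) (D n) - ipvO lD (scalef p lD) +
    a * b * (wn n * wn n) * (2 * ipvO (scalef p lE) (E n) - ipvO lE (scalef p lE)) <=
    (a + b) * wn n * ipvO (D n) (scalef p (E n)).
  have [ig Eg] := weighted_gap_integral a b (wn n) sp pK' (qE n) (qD n).
  have pg : {ae leb3 R, forall x, Omega x -> 0 <= p x * gap a b ((wn n *: E n) ^~ x) (D n ^~ x)}.
    by move: (g0 n); apply: filterS => x hx Ox; rewrite mulr_ge0// hx.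
  have := Rintegral_ae_ge0 ig pg; rewrite Eg.
  have lD_ := weak_lower_bound sp pK' p0 (qD n) qlD.
  have lE_ := weak_lower_bound sp pK' p0 (qE n) qlE.
  have abw : 0 <= a * b * (wn n * wn n) by rewrite -expr2 mulr_ge0 ?sqr_ge0// mulr_ge0.
  have := ler_wpM2l abw lE_; move: lD_; rewrite expr2; clear; lra.
have L1 : 2 * ipvO (scalef p lD) (D n) - ipvO lD (scalef p lD) +
    a * b * (wn n * wn n) * (2 * ipvO (scalef p lE) (E n) - ipvO lE (scalef p lE)) @[n --> U] -->
    2 * ipvO (scalef p lD) lD - ipvO lD (scalef p lD) +
    a * b * (w * w) * (2 * ipvO (scalef p lE) lE - ipvO lE (scalef p lE)).
  apply: cvgD; first by apply: cvgB; [apply: cvgM => //; exact: cvg_cst|exact: cvg_cst].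
  apply: cvgM; first by apply: cvgM; [exact: cvg_cst|exact: cvgM].
  by apply: cvgB; [apply: cvgM => //; exact: cvg_cst|exact: cvg_cst].
have L2 : (a + b) * wn n * ipvO (D n) (scalef p (E n)) @[n --> U] --> (a + b) * w * ipvO lD (scalef p lE).
  by apply: cvgM => //; apply: cvgM => //; exact: cvg_cst.
have := ler_cvg_all UF L1 L2 ineq.
rewrite (phC phv (scalef p lD)) (phC phv (scalef p lE)) expr2.
move: (ipvO lD (scalef p lD)) (ipvO lE (scalef p lE)) (ipvO lD (scalef p lE)) => Y Z X.
rewrite -subr_ge0; congr (0 <= _); ring.
Qed.

(* The system [D = w eps E], [C = w mu H] for [C = curl E] and [D = curl H],
   with [eps] and [mu] eliminated by means of [gap]. *)
Definition real_eigen a b (w : R) (E C H D : field) :=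
  [/\ H0pair Omega E C, H0pair Omega H D, 0 < ipvO E E + ipvO H H,
    {ae leb3 R, forall x, Omega x -> 0 <= gap a b ((w *: E) ^~ x) (D ^~ x)} &
    {ae leb3 R, forall x, Omega x -> 0 <= gap a b ((w *: H) ^~ x) (C ^~ x)}].

(** The integrated forms of [gap_dot_ge] and [gap_dot_le] at [y = w E], the former divided by [w].
    The first bounds the pairing from below, the second bounds the curl by the field. *)
Lemma eigen_energy_bounds a b w (E D : field) : 0 <= a -> a < b -> 0 < w ->
  sqvO E -> sqvO D ->
  {ae leb3 R, forall x, Omega x -> 0 <= gap a b ((w *: E) ^~ x) (D ^~ x)} ->
  a * w * ipvO E E <= ipvO D E /\ ipvO D D <= (b * w) ^+ 2 * ipvO E E.
Proof.
move=> a0 ab w0 qE qD g0.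
have iE := dot_integrable qE qE; have iD := dot_integrable qD qD; have iDE := dot_integrable qD qE.
rewrite !ipv_dot//; split; rewrite -subr_ge0 -RintegralZl// -RintegralB//;
  try exact: (integrableZl mO _ iE).
  apply: Rintegral_ae_ge0; first exact: (integrableB mO iDE (integrableZl mO (a * w) iE)).
  apply: filterS g0 => x hx Ox; have := gap_dot_ge ab (hx Ox).
  rewrite dot_scale dotC dot_scale [dot _ ((w *: E) ^~ x)]dot_scale.
  rewrite -subr_ge0 => h; rewrite -(pmulr_rge0 _ w0).
  by move: h; congr (0 <= _); ring.
apply: Rintegral_ae_ge0; first exact: (integrableB mO (integrableZl mO _ iE) iD).
apply: filterS g0 => x hx Ox; have := gap_dot_le a0 ab (hx Ox).
rewrite dot_scale dotC dot_scale -subr_ge0; congr (0 <= _); ring.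
Qed.

Lemma real_eigen_lower_bound a b w (E C H D : field) : 0 < a -> a < b -> 0 < w ->
  real_eigen a b w E C H D -> a / ((2 * r + 1) * b ^+ 2) <= w.
Proof.
move=> a0 ab w0 [EC HD EH gE gH].
have [qE qC _] := EC; have [qH qD _] := HD.
have [e1 e2] := eigen_energy_bounds (ltW a0) ab w0 qE qD gE.
have [h1 h2] := eigen_energy_bounds (ltW a0) ab w0 qH qC gH.
have b0 : 0 < b by exact: lt_trans ab.
pose m := Num.sqrt (ipvO E E); pose n := Num.sqrt (ipvO H H).
have m2 : m ^+ 2 = ipvO E E by rewrite sqr_sqrtr//; exact: (ph_ge0 phv).
have n2 : n ^+ 2 = ipvO H H by rewrite sqr_sqrtr//; exact: (ph_ge0 phv).
have m0 : 0 <= m by exact: sqrtr_ge0.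
have n0 : 0 <= n by exact: sqrtr_ge0.
have bw0 : 0 <= b * w by rewrite mulr_ge0// ltW.
have bm : 0 <= b * w * m by rewrite mulr_ge0.
have bn : 0 <= b * w * n by rewrite mulr_ge0.
rewrite -m2 -exprMn in e2; rewrite -n2 -exprMn in h2.
have P1 := H0pair_poincare oOmega Or r0 bm bn EC HD e2 h2.
have P2 := H0pair_poincare oOmega Or r0 bn bm HD EC h2 e2.
rewrite -m2 in e1 EH; rewrite -n2 in h1 EH.
have {}P1 := le_trans e1 (le_trans (ler_norm _) P1).
have {}P2 := le_trans h1 (le_trans (ler_norm _) P2).
have L0 : 0 < 2 * r + 1 by rewrite ltr_wpDl// mulr_ge0.
rewrite ler_pdivrMr ?mulr_gt0 ?exprn_gt0//.
exact: (frequency_bound L0 w0 EH P1 P2).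
Qed.

(** [gap] is homogeneous of degree 2 in the two vectors jointly, so all four fields may be scaled
    together. *)
Lemma real_eigen_normalized a b w (E C H D : field) : real_eigen a b w E C H D ->
  exists E' C' H' D', real_eigen a b w E' C' H' D' /\ ipvO E' E' + ipvO H' H' = 1.
Proof.
move=> [EC HD EH gE gH].
have [qE qC _] := EC; have [qH qD _] := HD.
pose t := ipvO E E + ipvO H H; pose c := (Num.sqrt t)^-1.
have c2 : c * c * t = 1.
  by rewrite -expr2 exprVn sqr_sqrtr ?ltW// mulVf// gt_eqF.
have sc (u : field) : sqvO u -> ipvO (c *: u) (c *: u) = c * c * ipvO u u.
  by move=> qu; rewrite (bZ phv _ qu (phZ phv c qu)) (bZr phv _ qu qu) mulrA.
have pz u v : H0pair Omega u v -> H0pair Omega (c *: u) (c *: v).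
  by move=> uv; rewrite -[c *: u]addr0 -[c *: v]addr0; exact: (H0pair_lincomb oOmega Or c uv (H0pair0 oOmega Or)).
have gs (y z : field) : {ae leb3 R, forall x, Omega x -> 0 <= gap a b ((w *: y) ^~ x) (z ^~ x)} ->
    {ae leb3 R, forall x, Omega x -> 0 <= gap a b ((w *: (c *: y)) ^~ x) ((c *: z) ^~ x)}.
  apply: filterS => x hx /hx h; rewrite (_ : gap _ _ _ _ = c * c * gap a b ((w *: y) ^~ x) (z ^~ x)).
    by rewrite mulr_ge0// -expr2 sqr_ge0.
  rewrite (_ : (w *: (c *: y)) ^~ x = fun i => w * (c * y i x))// (_ : (c *: z) ^~ x = fun i => c * z i x)//.
  by rewrite (_ : (w *: y) ^~ x = fun i => w * y i x)// /gap !dotE; ring.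
have one : ipvO (c *: E) (c *: E) + ipvO (c *: H) (c *: H) = 1 by rewrite !sc// -mulrDr.
exists (c *: E), (c *: C), (c *: H), (c *: D); split => //; split.
- exact: pz.
- exact: pz.
- by rewrite one.
- exact: gs.
- exact: gs.
Qed.

Lemma weak_limitv (U : set_system nat) (u : nat -> field) (M : R) : UltraFilter U ->
  (forall n, sqvO (u n)) -> (forall n, ipvO (u n) (u n) <= M) ->
  exists2 l : field, sqvO l & forall (f : T -> R) i, sqO f ->
    ipO f (u n i) @[n --> U] --> ipO f (l i).
Proof.
move=> UU qu uM.
have H i := weak_compactness mO Ooo UU (fun n => qu n i)
  (fun n => le_trans (ipv_comp_le oOmega i (qu n)) (uM n)).
have [l hl] := choice (fun i => let: ex_intro2 f q c := H i in ex_intro _ f (conj q c)).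
by exists l => [i|f i qf]; have [q c] := hl i; [|exact: c].
Qed.

Lemma real_eigen_closed a b (wn : nat -> R) (w W : R) : 0 < a -> a < b -> 0 < w ->
  (forall n, 0 < wn n <= W) -> wn n @[n --> \oo] --> w ->
  (forall n, exists E C H D, real_eigen a b (wn n) E C H D) ->
  exists E C H D, real_eigen a b w E C H D.
Proof.
move=> a0 ab w0 wnW wnw hn.
have {}hn n : exists q : (field * field) * (field * field),
    real_eigen a b (wn n) q.1.1 q.1.2 q.2.1 q.2.2 /\ ipvO q.1.1 q.1.1 + ipvO q.2.1 q.2.1 = 1.
  have [E [C [H [D h]]]] := hn n.
  have [E' [C' [H' [D' h']]]] := real_eigen_normalized h.
  by exists ((E', C'), (H', D')).
have [q hq] := choice hn.
pose E n := (q n).1.1; pose C n := (q n).1.2; pose H n := (q n).2.1; pose D n := (q n).2.2.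
have EC n : H0pair Omega (E n) (C n) by case: (hq n) => -[].
have HD n : H0pair Omega (H n) (D n) by case: (hq n) => -[].
have gE n : {ae leb3 R, forall x, Omega x -> 0 <= gap a b ((wn n *: E n) ^~ x) (D n ^~ x)}.
  by case: (hq n) => -[].
have gH n : {ae leb3 R, forall x, Omega x -> 0 <= gap a b ((wn n *: H n) ^~ x) (C n ^~ x)}.
  by case: (hq n) => -[].
have one n : ipvO (E n) (E n) + ipvO (H n) (H n) = 1 by case: (hq n).
have qE n : sqvO (E n) by case: (EC n).
have qC n : sqvO (C n) by case: (EC n).
have qH n : sqvO (H n) by case: (HD n).
have qD n : sqvO (D n) by case: (HD n).
have wn0 n : 0 < wn n by case/andP: (wnW n).
have eD n := eigen_energy_bounds (ltW a0) ab (wn0 n) (qE n) (qD n) (gE n).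
have eC n := eigen_energy_bounds (ltW a0) ab (wn0 n) (qH n) (qC n) (gH n).
have b0 : 0 < b by exact: lt_trans ab.
have W0 : 0 <= W by case/andP: (wnW 0%N) => /ltW h1 h2; exact: le_trans h2.
(* One bound for all four sequences: the fields have norm at most 1 by normalization, their curls at
   most [b W]. *)
pose M := 1 + b * W.
have bW : 0 <= b * W by rewrite mulr_ge0// ltW.
have M0 : 0 <= M by rewrite addr_ge0.
have M1 : 1 <= M ^+ 2 by rewrite exprn_ege1// lerDl.
have E1 n : ipvO (E n) (E n) <= 1 by rewrite -(one n) lerDl; exact: (ph_ge0 phv).
have H1 n : ipvO (H n) (H n) <= 1 by rewrite -(one n) lerDr; exact: (ph_ge0 phv).
have EM n := le_trans (E1 n) M1; have HM n := le_trans (H1 n) M1.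
have bnd n (x : R) : x <= 1 -> (b * wn n) ^+ 2 * x <= M ^+ 2.
  move=> x1; apply: (@le_trans _ _ ((b * wn n) ^+ 2)).
    by rewrite ger_pMr// exprn_gt0// mulr_gt0.
  have bwn : 0 <= b * wn n by rewrite mulr_ge0// ltW.
  rewrite lerXn2r ?nnegrE//; apply: (@le_trans _ _ (b * W)); last by rewrite lerDr.
  by apply: ler_wpM2l; [exact: ltW|case/andP: (wnW n)].
have DM n := le_trans (eD n).2 (bnd n _ (E1 n)).
have CM n := le_trans (eC n).2 (bnd n _ (H1 n)).
(* All four sequences converge weakly along the same ultrafilter, and limits along [\oo] persist
   since [U] refines it. *)
have [U [UU oU]] := @ultraFilterLemma nat \oo _.
have [lE qlE Ew] := weak_limitv UU qE EM.
have [lC qlC Cw] := weak_limitv UU qC CM.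
have [lH qlH Hw] := weak_limitv UU qH HM.
have [lD qlD Dw] := weak_limitv UU qD DM.
have UF : ProperFilter U by exact: ultra_proper.
have lEC := H0pair_weak_limit oOmega Or UF EC EM CM qlE qlC Ew Cw.
have lHD := H0pair_weak_limit oOmega Or UF HD HM DM qlH qlD Hw Dw.
have wU : wn n @[n --> U] --> w by move=> A /wnw; exact: oU.
exists lE, lC, lH, lD; split => //; last 2 first.
- exact: (limit_gap (ltW a0) (ltW b0) UF oU M0 EC HD lEC lHD EM CM DM Ew Dw wU gE).
- exact: (limit_gap (ltW a0) (ltW b0) UF oU M0 HD EC lHD lEC HM DM CM Hw Cw wU gH).
(* Compensated compactness with weight 1 gives the limits of the full pairings, needed to see that
   the limit fields are not both zero. *)
have c1 x : Omega x -> `|cst (1 : R) x| <= 1 by rewrite normr1.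
have c2 k x : Omega x -> `|partial k (cst (1 : R) : T -> R) x| <= 1.
  by rewrite partial_cst normr0.
have ccE := compensated_compactness oOmega Or (@smooth_cst R 1) ler01 c1 c2 UF oU M0
  EC HD lEC lHD EM CM DM Ew Dw.
have ccH := compensated_compactness oOmega Or (@smooth_cst R 1) ler01 c1 c2 UF oU M0
  HD EC lHD lEC HM DM CM Hw Cw.
have s1 (u : field) : scalef (cst 1) u = u.
  by apply/funext => i; apply/funext => x; rewrite /scalef mul1r.
rewrite !s1 in ccE ccH.
have awcvg : a * wn n @[n --> U] --> a * w by apply: cvgM => //; exact: cvg_cst.
have ccEH : ipvO (D n) (E n) + ipvO (C n) (H n) @[n --> U] --> ipvO lD lE + ipvO lC lH.
  apply: cvgD; [move: ccE; under eq_fun do rewrite s1|move: ccH; under eq_fun do rewrite s1]; exact.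
have le_n n : a * wn n <= ipvO (D n) (E n) + ipvO (C n) (H n).
  rewrite -[leLHS]mulr1 -(one n) mulrDr; exact: lerD (eD n).1 (eC n).1.
have lim := ler_cvg_all UF awcvg ccEH le_n.
have aw : 0 < a * w by rewrite mulr_gt0.
(* If both limit fields had norm 0, both limit pairings would vanish by Cauchy-Schwarz, against the
   lower bound [a w > 0]. *)
have := lt_le_trans aw lim; apply: contraTT; rewrite -!leNgt => h0.
have gE0 := ph_ge0 phv qlE; have gH0 := ph_ge0 phv qlH.
have E0 : ipvO lE lE <= 0 ^+ 2 by rewrite expr0n/=; apply: le_trans h0; rewrite lerDl.
have H0 : ipvO lH lH <= 0 ^+ 2 by rewrite expr0n/=; apply: le_trans h0; rewrite lerDr.
pose n (u : field) := Num.sqrt (ipvO u u).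
have n0 u : 0 <= n u by exact: sqrtr_ge0.
have nE (u : field) : sqvO u -> ipvO u u <= n u ^+ 2.
  by move=> qu; rewrite sqr_sqrtr//; exact: (ph_ge0 phv).
have z1 := norm_le_cs phv qlD qlE (n0 _) (lexx 0) (nE _ qlD) E0.
have z2 := norm_le_cs phv qlC qlH (n0 _) (lexx 0) (nE _ qlC) H0.
rewrite mulr0 normr_le0 in z1; rewrite mulr0 normr_le0 in z2.
by rewrite (eqP z1) (eqP z2) addr0.
Qed.

End EigenLimits.

(** * Complex fields *)

Lemma sum4_lt (R : realFieldType) (a b c d s e : R) :
  a <= s -> b <= s -> c <= s -> d <= s -> s <= e / 8 -> 0 < e -> a + b + (c + d) < e.
Proof. by move=> *; lra. Qed.

Lemma le_of_sum4_lt (R : realDomainType) (a b c d e : R) :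
  0 <= a -> 0 <= b -> 0 <= c -> 0 <= d -> a + b + (c + d) < e ->
  [/\ a <= e, b <= e, c <= e & d <= e].
Proof. by move=> *; split; lra. Qed.

Section ComplexFields.
Variables (R : realType) (Omega : set (R3 R)) (r : R).
Notation T := (R3 R).
Notation field := ('I_3 -> T -> R).
Hypotheses (oOmega : open Omega) (Or : forall x, Omega x -> `|x| <= r).
Let mO : measurable Omega := open_measurable3 oOmega.
Let Ooo : (leb3 R Omega < +oo)%E := leb3_bounded_lt mO Or.
Notation sqO := (sqint (leb3 R) Omega).
Notation sqvO := (@sqintv _ _ _ (leb3 R) Omega 'I_3).
Notation ipO := (ip (leb3 R) Omega).
Notation ipvO := (@ipv _ _ _ (leb3 R) Omega 'I_3).
Let phv := sqintv_prehilbert (leb3 R) mO 'I_3.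

Definition refield (u : vfield R) : field := fun i x => complex.Re (u x i 0).
Definition imfield (u : vfield R) : field := fun i x => complex.Im (u x i 0).
Definition cfield (p q : field) : vfield R := fun x => \col_i (p i x +i* q i x).

Lemma refield_cfield p q : refield (cfield p q) = p.
Proof. by apply/funext => i; apply/funext => x; rewrite /refield mxE. Qed.

Lemma imfield_cfield p q : imfield (cfield p q) = q.
Proof. by apply/funext => i; apply/funext => x; rewrite /imfield mxE. Qed.

Lemma refieldB (u v : vfield R) : refield (fun x => u x - v x) = refield u - refield v.
Proof.
apply/funext => i; apply/funext => x; rewrite /refield !mxE.
rewrite -[RHS]/(complex.Re (u x i 0) - complex.Re (v x i 0)).
by case: (u x i 0) (v x i 0) => [a b] [c d].
Qed.

Lemma imfieldB (u v : vfield R) : imfield (fun x => u x - v x) = imfield u - imfield v.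
Proof.
apply/funext => i; apply/funext => x; rewrite /imfield !mxE.
rewrite -[RHS]/(complex.Im (u x i 0) - complex.Im (v x i 0)).
by case: (u x i 0) (v x i 0) => [a b] [c d].
Qed.

Lemma refield_curl u : refield (curl u) = rcurl (refield u).
Proof.
by apply/funext => i; apply/funext => x; rewrite /refield /curl /partialC mxE.
Qed.

Lemma imfield_curl u : imfield (curl u) = rcurl (imfield u).
Proof.
by apply/funext => i; apply/funext => x; rewrite /imfield /curl /partialC mxE.
Qed.

Lemma normsqE (u : vfield R) x : normsq (u x) =
  \sum_i (refield u i x ^+ 2 + imfield u i x ^+ 2).
Proof. by []. Qed.

Lemma L2normsqE (u : vfield R) : sqvO (refield u) -> sqvO (imfield u) ->
  L2normsq Omega u = (ipvO (refield u) (refield u) + ipvO (imfield u) (imfield u))%:E.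
Proof.
move=> qr qi; rewrite /L2normsq.
have mm (f : T -> R) : measurable_fun Omega f -> measurable_fun Omega (fun x => (f x ^+ 2)%:E).
  by move=> mf; apply/measurable_EFinP; exact: measurable_funX.
transitivity (\int[leb3 R]_(x in Omega) \sum_(i < 3) ((refield u i x ^+ 2)%:E + (imfield u i x ^+ 2)%:E))%E.
  by apply: eq_integral => x _; rewrite normsqE -sumEFin.
rewrite ge0_integral_sum//.
- under eq_bigr => i _.
    rewrite ge0_integralD//; try by move=> x _; rewrite lee_fin sqr_ge0.
    - rewrite !ip_integral//.
      over.
    - by apply: mm; case: (qr i).
    - by apply: mm; case: (qi i).
  by rewrite /= sumEFin big_split.
- by move=> i; apply: emeasurable_funD; apply: mm; [case: (qr i)|case: (qi i)].
- by move=> i x _; rewrite -EFinD lee_fin addr_ge0// sqr_ge0.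
Qed.

Lemma L2P (u : vfield R) : L2 Omega u <-> sqvO (refield u) /\ sqvO (imfield u).
Proof.
split=> [[mu lu]|[qr qi]].
  have mm (f : T -> R) : measurable_fun Omega f -> measurable_fun Omega (fun x => (f x ^+ 2)%:E).
    by move=> mf; apply/measurable_EFinP; exact: measurable_funX.
  have mn : measurable_fun Omega (fun x => (normsq (u x))%:E).
    apply/measurable_EFinP; apply: measurable_sum => i.
    by apply: measurable_funD; apply: measurable_funX; [exact: (mu i).1|exact: (mu i).2].
  have le1 i x : refield u i x ^+ 2 <= normsq (u x) /\ imfield u i x ^+ 2 <= normsq (u x).
    have h : refield u i x ^+ 2 + imfield u i x ^+ 2 <= normsq (u x).
      by rewrite normsqE (bigD1 i)//= lerDl sumr_ge0// => k _; rewrite addr_ge0// sqr_ge0.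
    by split; apply: le_trans h; rewrite ?lerDl ?lerDr sqr_ge0.
  split=> i; split; try by [exact: (mu i).1|exact: (mu i).2].
    apply: le_lt_trans lu; apply: ge0_le_integral => //.
    - by move=> x _; rewrite lee_fin sqr_ge0.
    - by apply: mm; exact: (mu i).1.
    - by move=> x _; rewrite lee_fin; case: (le1 i x).
  apply: le_lt_trans lu; apply: ge0_le_integral => //.
  - by move=> x _; rewrite lee_fin sqr_ge0.
  - by apply: mm; exact: (mu i).2.
  - by move=> x _; rewrite lee_fin; case: (le1 i x).
split; last by rewrite L2normsqE// ltry.
by move=> i; split; [case: (qr i)|case: (qi i)].
Qed.

Lemma integralC_dot (u v : vfield R) : sqvO (refield u) -> sqvO (imfield u) ->
  sqvO (refield v) -> sqvO (imfield v) ->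
  integralC Omega (fun x => ((u x)^T *m v x) 0 0) =
  (ipvO (refield u) (refield v) - ipvO (imfield u) (imfield v)) +i*
  (ipvO (refield u) (imfield v) + ipvO (imfield u) (refield v)).
Proof.
move=> qru qiu qrv qiv; rewrite /integralC.
have E x : ((u x)^T *m v x) 0 0 =
  (dot (refield u ^~ x) (refield v ^~ x) - dot (imfield u ^~ x) (imfield v ^~ x)) +i*
  (dot (refield u ^~ x) (imfield v ^~ x) + dot (imfield u ^~ x) (refield v ^~ x)).
  rewrite mxE sum3 !dotE !mxE /refield /imfield.
  case: (u x 0 0) (u x 1 0) (u x 2%:R 0) => [a1 b1] [a2 b2] [a3 b3].
  case: (v x 0 0) (v x 1 0) (v x 2%:R 0) => [c1 d1] [c2 d2] [c3 d3].
  by apply/eqP; rewrite eq_complex /=; apply/andP; split; apply/eqP; ring.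
rewrite (@eq_Rintegral _ _ _ _ _ (fun x => dot (refield u ^~ x) (refield v ^~ x) -
   dot (imfield u ^~ x) (imfield v ^~ x))); last by move=> x _; rewrite E.
rewrite (@eq_Rintegral _ _ _ _ _ (fun x => dot (refield u ^~ x) (imfield v ^~ x) +
   dot (imfield u ^~ x) (refield v ^~ x)) (fun x => complex.Im _)); last by move=> x _; rewrite E.
have D (f g : field) (qf : sqvO f) (qg : sqvO g) := dot_integrable oOmega qf qg.
by rewrite RintegralB ?RintegralD ?(ipv_dot oOmega)//; exact: D.
Qed.

Lemma L2normsqB (u v : vfield R) : sqvO (refield u) -> sqvO (imfield u) ->
  sqvO (refield v) -> sqvO (imfield v) ->
  L2normsq Omega (fun x => u x - v x) =
  (ipvO (refield u - refield v) (refield u - refield v) +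
   ipvO (imfield u - imfield v) (imfield u - imfield v))%:E.
Proof.
move=> qru qiu qrv qiv; have := @L2normsqE (fun x => u x - v x).
by rewrite refieldB imfieldB; apply; exact: (phB phv).
Qed.

Lemma L2normsqB_curl (u p : vfield R) : sqvO (refield u) -> sqvO (imfield u) ->
  sqvO (rcurl (refield p)) -> sqvO (rcurl (imfield p)) ->
  L2normsq Omega (fun x => u x - curl p x) =
  (ipvO (refield u - rcurl (refield p)) (refield u - rcurl (refield p)) +
   ipvO (imfield u - rcurl (imfield p)) (imfield u - rcurl (imfield p)))%:E.
Proof. by rewrite -refield_curl -imfield_curl; exact: L2normsqB. Qed.

Lemma integralC_dot_curl (u p : vfield R) : sqvO (refield u) -> sqvO (imfield u) ->
  sqvO (rcurl (refield p)) -> sqvO (rcurl (imfield p)) ->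
  integralC Omega (fun x => ((u x)^T *m curl p x) 0 0) =
  (ipvO (refield u) (rcurl (refield p)) - ipvO (imfield u) (rcurl (imfield p))) +i*
  (ipvO (refield u) (rcurl (imfield p)) + ipvO (imfield u) (rcurl (refield p))).
Proof. by rewrite -refield_curl -imfield_curl; exact: integralC_dot. Qed.

Lemma Cc_inftyP (phi : vfield R) : Cc_infty Omega phi <->
  testfield_in Omega (refield phi) /\ testfield_in Omega (imfield phi).
Proof.
split=> [[sm [K [cK KO phi0]]]|[tr ti]].
  have z x i : ~ K x -> refield phi i x = 0 /\ imfield phi i x = 0.
    by move=> /phi0; rewrite /refield /imfield => ->; rewrite mxE.
  have b x : r < `|x| -> ~ K x by move=> + /KO /Or; rewrite leNgt => ->.
  split=> i; split; try by exists K; split => // x /(z _ i)[].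
    by split; [case: (sm i)|exists r => x /b /(z _ i)[]].
  by split; [case: (sm i)|exists r => x /b /(z _ i)[]].
split=> [i|].
  by split; [case: (tr i) => -[]|case: (ti i) => -[]].
have [K hK] := choice (fun i => let: conj _ h := tr i in h).
have [L hL] := choice (fun i => let: conj _ h := ti i in h).
exists (K 0 `|` K 1 `|` K 2%:R `|` (L 0 `|` L 1 `|` L 2%:R)); split.
- have cK i : compact (K i) by case: (hK i).
  have cL i : compact (L i) by case: (hL i).
  by do !apply: compactU => //.
- have KO i : K i `<=` Omega by case: (hK i).
  have LO i : L i `<=` Omega by case: (hL i).
  by rewrite !subUset; do !split => //.
move=> x nx; apply/colP => i; rewrite mxE.
have [_ _ k0] := hK i; have [_ _ l0] := hL i.
apply/eqP; rewrite eq_complex /=; apply/andP; split; apply/eqP.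
  apply: k0 => Kx; apply: nx; left; move: Kx.
  by case: (I3_cases i) => -> Kx; [left; left|left; right|right].
apply: l0 => Kx; apply: nx; right; move: Kx.
by case: (I3_cases i) => -> Kx; [left; left|left; right|right].
Qed.

(** The positivity lemma applied to [f] and to [- f] shows that [f] vanishes almost everywhere. *)
Lemma ip_null_of_testfun (f : T -> R) : sqO f -> (forall p, testfun_in Omega p -> ipO f p = 0) ->
  ipO f f = 0.
Proof.
move=> qf f0.
have int1 : (leb3 R).-integrable Omega (EFin \o f).
  have := sqint_mul mO qf (sqint_cst mO 1 Ooo).
  by apply: eq_integrable => // x _; rewrite /= mulr1.
have p1 : {ae leb3 R, forall x, Omega x -> 0 <= f x}.
  apply: (ae_ge0_of_testfun oOmega int1) => p tp _.
  by under eq_Rintegral do rewrite mulrC; rewrite -/(ipO f p) f0.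
have intN : (leb3 R).-integrable Omega (EFin \o (fun x => - 1 * f x)) := integrableZl mO (- 1) int1.
have p2 : {ae leb3 R, forall x, Omega x -> 0 <= - 1 * f x}.
  apply: (ae_ge0_of_testfun oOmega intN) => p tp _.
  under eq_Rintegral do rewrite mulrCA.
  rewrite RintegralZl//; last by have := sqint_mul mO (testfun_in_sqint oOmega Or tp) qf.
  by under eq_Rintegral do rewrite mulrC; rewrite -/(ipO f p) f0// mulr0.
rewrite /ip /Rintegral (@ae_eq_integral _ _ _ _ _ (cst 0%E) (EFin \o (fun x => f x * f x)) mO) ?integral0//.
  by have /integrableP[] := sqint_mul mO qf qf.
apply: filterS2 p1 p2 => x h1 h2 Ox /=; have := h1 Ox; have := h2 Ox.
by rewrite mulN1r oppr_ge0 => k1 k2; have /eqP -> : f x == 0; rewrite ?eq_le ?k1 ?k2// mulr0.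
Qed.

(** Testing with fields that have a single nonzero component shows that [v] and [w] agree almost
    everywhere. It is needed because [H0curl] speaks of every representative of the curl, [H0pair]
    of a given one. *)
Lemma H0pair_unique (u v w : field) : H0pair Omega u v -> sqvO w ->
  (forall p, testfield_in Omega p -> ipvO u (rcurl p) = ipvO w p) -> H0pair Omega u w.
Proof.
move=> uv qw hw; have [qu qv appr] := uv.
have comp i : ipO (w i - v i) (w i - v i) = 0.
  apply: ip_null_of_testfun; first exact: (phB phv qw qv i).
  move=> p tp; pose P : field := fun j => if j == i then p else cst 0.
  have tP : testfield_in Omega P.
    by move=> j; rewrite /P; case: eqP => // _; exact: testfun_in0.
  have qP := testfield_in_sqintv oOmega Or tP.
  have h : ipvO (w - v) P = 0.
    by rewrite (bB phv qw qv qP) -(hw _ tP) (H0pair_rcurl_sym oOmega Or uv tP) subrr.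
  rewrite -h /ipv (bigD1 i)//= big1 ?addr0.
    by rewrite /P eqxx.
  move=> j ji; rewrite /P (negbTE ji).
  have ph := sqint_prehilbert (leb3 R) mO.
  have qwv : sqO ((w - v) j) by exact: (phB phv qw qv j).
  by rewrite (phC ph); exact: (b0l ph qwv).
have wv : ipvO (w - v) (w - v) <= 0 ^+ 2 by rewrite expr0n /ipv big1// => i _; exact: comp.
split => // e e0; have [p [tp h1 h2]] := appr _ e0.
have qcp := testfield_in_sqintv oOmega Or (testfield_in_rcurl tp).
exists p; split => //.
have := triangle_le phv (phB phv qw qv) (phB phv qv qcp) (lexx 0) (ltW e0) wv h2.
by rewrite addrA subrK add0r.
Qed.

Lemma H0curl_H0pair (E C : vfield R) : H0curl Omega E -> L2 Omega C -> weak_curl Omega E C ->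
  H0pair Omega (refield E) (refield C) /\ H0pair Omega (imfield E) (imfield C).
Proof.
move=> [[lE _] HE] lC wEC; have [qrE qiE] := (L2P E).1 lE; have [qrC qiC] := (L2P C).1 lC.
have appr e : 0 < e -> exists p, [/\ testfield_in Omega (refield p), testfield_in Omega (imfield p) &
    ipvO (refield E - refield p) (refield E - refield p) +
    ipvO (imfield E - imfield p) (imfield E - imfield p) +
    (ipvO (refield C - rcurl (refield p)) (refield C - rcurl (refield p)) +
     ipvO (imfield C - rcurl (imfield p)) (imfield C - rcurl (imfield p))) < e].
  move=> e0; have [p cp] := HE C lC wEC e e0.
  have [tr ti] := (Cc_inftyP p).1 cp.
  have qrp := testfield_in_sqintv oOmega Or tr; have qip := testfield_in_sqintv oOmega Or ti.
  have qrc := testfield_in_sqintv oOmega Or (testfield_in_rcurl tr).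
  have qic := testfield_in_sqintv oOmega Or (testfield_in_rcurl ti).
  rewrite (L2normsqB qrE qiE qrp qip) (L2normsqB_curl qrC qiC qrc qic).
  by rewrite -EFinD lte_fin => h; exists p.
have nn (u : field) : sqvO u -> 0 <= ipvO u u by exact: (ph_ge0 phv).
have H e (e0 : 0 < e) := appr _ (exprn_gt0 2 e0).
split; split => // e e0; have [p [tr ti h]] := H e e0;
  have qrp := testfield_in_sqintv oOmega Or tr; have qip := testfield_in_sqintv oOmega Or ti;
  have qrc := testfield_in_sqintv oOmega Or (testfield_in_rcurl tr);
  have qic := testfield_in_sqintv oOmega Or (testfield_in_rcurl ti);
  have g1 := nn _ (phB phv qrE qrp); have g2 := nn _ (phB phv qiE qip);
  have g3 := nn _ (phB phv qrC qrc); have g4 := nn _ (phB phv qiC qic).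
- by exists (refield p); have [? _ ? _] := le_of_sum4_lt g1 g2 g3 g4 h.
- by exists (imfield p); have [_ ? _ ?] := le_of_sum4_lt g1 g2 g3 g4 h.
Qed.

Lemma H0pair_H0curl (E C : vfield R) :
  H0pair Omega (refield E) (refield C) -> H0pair Omega (imfield E) (imfield C) ->
  [/\ H0curl Omega E, L2 Omega C & weak_curl Omega E C].
Proof.
move=> hr hi; have [qrE qrC _] := hr; have [qiE qiC _] := hi.
have lE : L2 Omega E by apply/L2P.
have lC : L2 Omega C by apply/L2P.
have wEC : weak_curl Omega E C.
  move=> p /Cc_inftyP[tr ti].
  have qrp := testfield_in_sqintv oOmega Or tr; have qip := testfield_in_sqintv oOmega Or ti.
  have qrc := testfield_in_sqintv oOmega Or (testfield_in_rcurl tr).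
  have qic := testfield_in_sqintv oOmega Or (testfield_in_rcurl ti).
  rewrite (integralC_dot_curl qrE qiE qrc qic) (integralC_dot qrC qiC qrp qip).
  by rewrite !(H0pair_rcurl_sym oOmega Or hr)// !(H0pair_rcurl_sym oOmega Or hi).
split => //; split; first by split => //; exists C.
move=> v lv wv e e0; have [qrv qiv] := (L2P v).1 lv.
(* Testing the complex identity with a real field separates its real and imaginary parts. *)
have uniq p : testfield_in Omega p -> ipvO (refield E) (rcurl p) = ipvO (refield v) p /\
    ipvO (imfield E) (rcurl p) = ipvO (imfield v) p.
  move=> tp; have t0 : testfield_in Omega 0 by move=> i; exact: testfun_in0.
  have cp : Cc_infty Omega (cfield p 0) by apply/Cc_inftyP; rewrite refield_cfield imfield_cfield.
  have qp := testfield_in_sqintv oOmega Or tp.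
  have qc := testfield_in_sqintv oOmega Or (testfield_in_rcurl tp).
  have q0 := ph0 phv.
  have := wv _ cp; rewrite integralC_dot_curl ?refield_cfield ?imfield_cfield ?rcurl0//.
  rewrite integralC_dot ?refield_cfield ?imfield_cfield//.
  rewrite ![ipvO _ 0](phC phv) !(b0l phv)// !subr0 !add0r.
  by case.
have hr' := H0pair_unique hr qrv (fun p tp => (uniq p tp).1).
have hi' := H0pair_unique hi qiv (fun p tp => (uniq p tp).2).
have [_ _ ar] := hr'; have [_ _ ai] := hi'.
(* The graph distance is a sum of four square norms, each at most [d ^+ 2 <= e / 8]. *)
pose d := Num.min 1 (e / 8).
have d0 : 0 < d by rewrite lt_min ltr01 divr_gt0.
have dd : d ^+ 2 <= e / 8.
  apply: (@le_trans _ _ d); last by rewrite ge_min lexx orbT.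
  by rewrite expr2 ler_piMr//; [exact: ltW|rewrite ge_min lexx].
have [p [tp p1 p2]] := ar _ d0; have [q [tq q1 q2]] := ai _ d0.
have qp := testfield_in_sqintv oOmega Or tp; have qq := testfield_in_sqintv oOmega Or tq.
have qcp := testfield_in_sqintv oOmega Or (testfield_in_rcurl tp).
have qcq := testfield_in_sqintv oOmega Or (testfield_in_rcurl tq).
exists (cfield p q); first by apply/Cc_inftyP; rewrite refield_cfield imfield_cfield.
have n1 := @L2normsqB E (cfield p q); rewrite refield_cfield imfield_cfield in n1.
have n2 := @L2normsqB_curl v (cfield p q); rewrite refield_cfield imfield_cfield in n2.
rewrite (n1 qrE qiE qp qq) (n2 qrv qiv qcp qcq).
rewrite -EFinD lte_fin.
exact: (sum4_lt p1 q1 p2 q2 dd e0).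
Qed.

Lemma ipv_null (u : field) : sqvO u -> ipvO u u <= 0 ->
  {ae leb3 R, forall x, Omega x -> forall i, u i x = 0}.
Proof.
move=> qu u0.
have comp i : {ae leb3 R, forall x, Omega x -> u i x = 0}.
  have ii := sqint_mul mO (qu i) (qu i).
  have z : ipO (u i) (u i) = 0.
    apply/eqP; rewrite eq_le (le_trans (ipv_comp_le oOmega i qu) u0)/=.
    exact: (ph_ge0 (sqint_prehilbert (leb3 R) mO)).
  have mi : measurable_fun Omega (EFin \o (fun x => (u i x * u i x)%R)) by case/integrableP: ii.
  have /(ae_eq_integral_abs (leb3 R) mO mi) :
      (\int[leb3 R]_(x in Omega) `|(EFin \o (fun x => (u i x * u i x)%R)) x| = 0)%E.
    transitivity (ipO (u i) (u i))%:E; last by rewrite z.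
    rewrite -ip_integral//; apply: eq_integral => x _ /=.
    by rewrite -expr2 ger0_norm// sqr_ge0.
  apply: filterS => x h Ox; have [/eqP] := h Ox.
  by rewrite mulf_eq0 orbb => /eqP.
apply: filterS3 (comp 0) (comp 1) (comp 2%:R) => x h0 h1 h2 Ox i.
by case: (I3_cases i) => ->; [exact: h0|exact: h1|exact: h2].
Qed.

Lemma act_entry (A : 'M[R]_3) (v : 'cV[R[i]]_3) k : act A v k 0 =
  (\sum_j A k j * complex.Re (v j 0)) +i* (\sum_j A k j * complex.Im (v j 0)).
Proof.
rewrite /act mxE !sum3 !mxE.
case: (v 0 0) (v 1 0) (v 2%:R 0) => [a1 b1] [a2 b2] [a3 b3].
by apply/eqP; rewrite eq_complex /=; apply/andP; split; apply/eqP; ring.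
Qed.

Lemma act_cfield (A : 'M[R]_3) (p q : field) x k : act A (cfield p q x) k 0 =
  (\sum_j A k j * p j x) +i* (\sum_j A k j * q j x).
Proof.
by rewrite act_entry; congr (_ +i* _); apply: eq_bigr => j _; rewrite mxE.
Qed.

(** The sign [s] of [w] is moved into the electric field: [D = |w| eps (s E)] and [s C = |w| mu H].
    The coefficients then disappear through [Msym_gap]. *)
Lemma real_eigen_of_system a b (w : R) (eps mu : T -> 'M[R]_3) (E C H D : field) :
  a < b -> w != 0 -> Linfty_Msym Omega a b eps -> Linfty_Msym Omega a b mu ->
  H0pair Omega E C -> H0pair Omega H D -> 0 < ipvO E E + ipvO H H ->
  {ae leb3 R, forall x, Omega x -> forall i, D i x = w * \sum_j eps x i j * E j x} ->
  {ae leb3 R, forall x, Omega x -> forall i, C i x = w * \sum_j mu x i j * H j x} ->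
  exists E' C' H' D', real_eigen Omega a b `|w| E' C' H' D'.
Proof.
move=> ab w0 [_ _ Me] [_ _ Mm] EC HD EH hD hC; have [qE _ _] := EC.
pose s := Num.sg w; have ss : s * s = 1 by rewrite -expr2 sqr_sg w0.
have sw : `|w| * s = w by rewrite mulrC -numEsg.
exists (s *: E), (s *: C), H, D; split => //.
- rewrite -[s *: E]addr0 -[s *: C]addr0.
  exact: (H0pair_lincomb oOmega Or s EC (H0pair0 oOmega Or)).
- by rewrite (bZ phv _ qE (phZ phv s qE)) (bZr phv _ qE qE) mulrA ss mul1r.
- apply: filterS2 Me hD => x hM h Ox; apply: (Msym_gap ab (hM Ox)) => i.
  rewrite (h Ox) mulr_sumr; apply: eq_bigr => j _.
  rewrite -[(_ *: _) j x]/(`|w| * (s * E j x)) [`|w| * _]mulrA sw; ring.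
- apply: filterS2 Mm hC => x hM h Ox; apply: (Msym_gap ab (hM Ox)) => i.
  rewrite -[LHS]/(s * C i x) (h Ox) mulrA -[in s * w]sw mulrCA ss mulr1 mulr_sumr.
  apply: eq_bigr => j _.
  rewrite -[(_ *: _) j x]/(`|w| * H j x); ring.
Qed.

(** As [eps], [mu] and [w] are real, the complex system splits into two real ones of the same form,
    for the pairs [(Im E, Re H)] and [(- Re E, Im H)]. At least one of these pairs is not null. *)
Lemma maxwell_real_eigen a b (w : R) (eps mu : T -> 'M[R]_3) :
  a < b -> w != 0 -> Linfty_Msym Omega a b eps -> Linfty_Msym Omega a b mu ->
  maxwell_eigenvalue Omega eps mu w%:C ->
  exists E C H D, real_eigen Omega a b `|w| E C H D.
Proof.
move=> ab w0 Le Lm [E [H [HE HH nz [cE [cH [[lcE wE] [lcH wH] eH eE]]]]]].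
have [rE iE] := H0curl_H0pair HE lcE wE; have [rH iH] := H0curl_H0pair HH lcH wH.
have e1 : {ae leb3 R, forall x, Omega x -> forall i,
    - imfield cH i x = w * (\sum_j eps x i j * refield E j x) /\
    refield cH i x = w * (\sum_j eps x i j * imfield E j x)}.
  apply: filterS eH => x h Ox i; have /(congr1 (fun m : 'cV_3 => m i 0)) := h Ox.
  rewrite mxE [RHS]mxE act_entry; move/eqP; rewrite eq_complex /refield /imfield.
  case: (cH x i 0) => p q /= /andP[/eqP h1 /eqP h2].
  move: h1 h2; move: (\sum_j _) (\sum_j _) => s t.
  by rewrite !mul0r !mul1r !subr0 ?addr0 ?sub0r ?add0r.
have e2 : {ae leb3 R, forall x, Omega x -> forall i,
    imfield cE i x = w * (\sum_j mu x i j * refield H j x) /\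
    - refield cE i x = w * (\sum_j mu x i j * imfield H j x)}.
  apply: filterS eE => x h Ox i; have /(congr1 (fun m : 'cV_3 => m i 0)) := h Ox.
  rewrite mxE [RHS]mxE act_entry; move/eqP; rewrite eq_complex /refield /imfield.
  case: (cE x i 0) => p q /= /andP[/eqP h1 /eqP h2].
  move: h1 h2; move: (\sum_j _) (\sum_j _) => s t.
  by rewrite !oppr0 !mul0r !mulN1r !subr0 ?opprK ?addr0 ?sub0r ?add0r ?opprK.
have [pos|npos] := ltP 0 (ipvO (imfield E) (imfield E) + ipvO (refield H) (refield H)).
  apply: (real_eigen_of_system ab w0 Le Lm iE rH pos).
    by apply: filterS e1 => x h Ox i; case: (h Ox i).
  by apply: filterS e2 => x h Ox i; case: (h Ox i).
have rE' : H0pair Omega (- 1 *: refield E) (- 1 *: refield cE).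
  rewrite -[- 1 *: refield E]addr0 -[- 1 *: refield cE]addr0.
  exact: (H0pair_lincomb oOmega Or (- 1) rE (H0pair0 oOmega Or)).
have [qrE _ _] := rE; have [qiE _ _] := iE; have [qrH _ _] := rH; have [qiH _ _] := iH.
have [pos|npos2] := ltP 0 (ipvO (- 1 *: refield E) (- 1 *: refield E) + ipvO (imfield H) (imfield H)).
  apply: (real_eigen_of_system ab w0 Le Lm rE' iH pos).
    apply: filterS e1 => x h Ox i; have [h1 _] := h Ox i.
    rewrite -[imfield cH i x]opprK h1 -mulrN -sumrN; congr (_ * _); apply: eq_bigr => j _.
    by rewrite -[(_ *: _) j x]/(- 1 * refield E j x) mulN1r mulrN.
  apply: filterS e2 => x h Ox i; have [_ <-] := h Ox i.
  by rewrite -[LHS]/(- 1 * refield cE i x) mulN1r.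
exfalso; apply: nz.
have g (u : field) : sqvO u -> 0 <= ipvO u u by exact: (ph_ge0 phv).
have zz (u v : field) : sqvO u -> sqvO v -> ipvO u u + ipvO v v <= 0 -> ipvO u u <= 0 /\ ipvO v v <= 0.
  by move=> qu qv h; split; apply: le_trans h; rewrite ?lerDl ?lerDr g.
have [z1 z2] := zz _ _ qiE qrH npos.
have [z3 z4] := zz _ _ (phZ phv _ qrE) qiH npos2.
rewrite (bZ phv _ qrE (phZ phv _ qrE)) (bZr phv _ qrE qrE) mulrA mulrNN mulr1 mul1r in z3.
have null_field (u : vfield R) : sqvO (refield u) -> sqvO (imfield u) ->
    ipvO (refield u) (refield u) <= 0 -> ipvO (imfield u) (imfield u) <= 0 ->
    {ae leb3 R, forall x, Omega x -> u x = 0}.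
  move=> qr qi r_0 i_0; apply: filterS2 (ipv_null qr r_0) (ipv_null qi i_0) => x h1 h2 Ox.
  apply/colP => i; rewrite mxE; apply/eqP; rewrite eq_complex /=.
  by apply/andP; split; apply/eqP; [exact: h1|exact: h2].
apply: filterS2 (null_field _ qrE qiE z3 z1) (null_field _ qrH qiH z2 z4) => x h1 h2 Ox.
by rewrite h1 ?h2.
Qed.

(** The inverse is written [x (x^2)^(-1)], because the real power is known to be the inverse for a
    nonnegative base; both sides are 0 at 0. *)
Lemma measurable_inv_fun (f : T -> R) : measurable_fun Omega f ->
  measurable_fun Omega (fun x => (f x)^-1).
Proof.
move=> mf; have -> : (fun x => (f x)^-1) = (fun x => f x * (f x ^+ 2) `^ (- 1)).
  apply/funext => x; rewrite powR_inv1 ?sqr_ge0//.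
  by have [->|f0] := eqVneq (f x) 0; [rewrite invr0 mul0r|rewrite expr2 invfM mulrA mulfV// mul1r].
apply: measurable_funM => //.
apply: (measurableT_comp (@measurable_powR R (- 1))); exact: measurable_funX.
Qed.

Lemma rank_one_shift_Linfty a b (y z : field) : 0 <= a -> a < b -> sqvO y -> sqvO z ->
  {ae leb3 R, forall x, Omega x -> 0 <= gap a b (y ^~ x) (z ^~ x)} ->
  Linfty_Msym Omega a b (fun x => rank_one_shift a (y ^~ x) (z ^~ x)).
Proof.
move=> a0 ab qy qz g0; split.
- move=> i j; under eq_fun do rewrite mxE.
  have mz k : measurable_fun Omega (z k) by case: (qz k).
  have my k : measurable_fun Omega (y k) by case: (qy k).
  have mp k : measurable_fun Omega (fun x => z k x - a * y k x).
    by apply: measurable_funB => //; apply: measurable_funM => //; exact: measurable_cst.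
  apply: measurable_funD; first exact: measurable_cst.
  apply: measurable_funM; first exact: measurable_funM.
  apply: measurable_inv_fun; apply: measurable_sum => k.
  exact: measurable_funM.
- exists (a + (b - a)); apply: filterS g0 => x h Ox i j.
  by apply: rank_one_shift_le => //; exact: h.
- by apply: filterS g0 => x h Ox; apply: rank_one_shift_Msym => //; exact: h.
Qed.

(** With electric field [i E] and magnetic field [H] the imaginary units cancel: [i D = w eps (i E)]
    and [- i (i C) = w mu H]. The coefficients are the rank-one shifts taken at each point. *)
Lemma real_eigen_maxwell a b (w : R) (E C H D : field) : 0 <= a -> a < b ->
  real_eigen Omega a b w E C H D ->
  exists eps mu : T -> 'M[R]_3, [/\ Linfty_Msym Omega a b eps, Linfty_Msym Omega a b mu &
    maxwell_eigenvalue Omega eps mu w%:C].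
Proof.
move=> a0 ab [EC HD EH gE gH].
have [qE qC _] := EC; have [qH qD _] := HD.
have z := H0pair0 oOmega Or.
exists (fun x => rank_one_shift a ((w *: E) ^~ x) (D ^~ x)).
exists (fun x => rank_one_shift a ((w *: H) ^~ x) (C ^~ x)).
split.
- exact: (rank_one_shift_Linfty a0 ab (phZ phv w qE) qD gE).
- exact: (rank_one_shift_Linfty a0 ab (phZ phv w qH) qC gH).
have [hE lcE wcE] : [/\ H0curl Omega (cfield 0 E), L2 Omega (cfield 0 C) &
    weak_curl Omega (cfield 0 E) (cfield 0 C)].
  by apply: H0pair_H0curl; rewrite ?refield_cfield ?imfield_cfield.
have [hH lcH wcH] : [/\ H0curl Omega (cfield H 0), L2 Omega (cfield D 0) &
    weak_curl Omega (cfield H 0) (cfield D 0)].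
  by apply: H0pair_H0curl; rewrite ?refield_cfield ?imfield_cfield.
exists (cfield 0 E), (cfield H 0); split => //.
  move=> nul; suff : ipvO E E + ipvO H H = 0 by move=> e0; rewrite e0 ltxx in EH.
  have vanish (u : field) : sqvO u -> {ae leb3 R, forall x, Omega x -> forall i, u i x = 0} -> ipvO u u = 0.
    move=> qu u0; apply: big1 => i _.
    rewrite /ip /Rintegral (@ae_eq_integral _ _ _ _ _ (cst 0%E) (EFin \o (fun x => u i x * u i x)) mO) ?integral0//.
      by have /integrableP[] := sqint_mul mO (qu i) (qu i).
    by apply: filterS u0 => x h Ox /=; rewrite h// mulr0.
  rewrite !vanish ?addr0//.
    apply: filterS nul => x h Ox i; have [_ /(congr1 (fun m : 'cV_3 => m i 0))] := h Ox.
    by rewrite !mxE => -[].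
  apply: filterS nul => x h Ox i; have [/(congr1 (fun m : 'cV_3 => m i 0)) + _] := h Ox.
  by rewrite !mxE => -[].
exists (cfield 0 C), (cfield D 0); split => //.
- apply: filterS gE => x h Ox; apply/colP => i.
  have S : w * \sum_j rank_one_shift a ((w *: E) ^~ x) (D ^~ x) i j * E j x = D i x.
    rewrite -(rank_one_shift_mul ab (h Ox) i) mulr_sumr; apply: eq_bigr => j _.
    by rewrite -[in RHS]/(w * E j x) mulrCA.
  rewrite mxE [RHS]mxE act_cfield mxE -[(0 : field) i x]/(0 : R); apply/eqP; rewrite eq_complex /= S.
  rewrite big1 => [|j _]; last exact: mulr0.
  by rewrite !mul0r !mulr0 mul1r !subrr addr0 add0r !eqxx.
- apply: filterS gH => x h Ox; apply/colP => i.
  have S : w * \sum_j rank_one_shift a ((w *: H) ^~ x) (C ^~ x) i j * H j x = C i x.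
    rewrite -(rank_one_shift_mul ab (h Ox) i) mulr_sumr; apply: eq_bigr => j _.
    by rewrite -[in RHS]/(w * H j x) mulrCA.
  rewrite mxE [RHS]mxE act_cfield mxE -[(0 : field) i x]/(0 : R); apply/eqP; rewrite eq_complex /= S.
  rewrite [\sum_j _ * 0 _ _]big1 => [|j _]; last exact: mulr0.
  by rewrite oppr0 !mul0r !mulr0 mulN1r opprK !subr0 !addr0 add0r !eqxx.
Qed.

End ComplexFields.

(** * Existence of a minimal frequency *)

Lemma Linfty_Msym_mono (R : realType) (Omega : set (R3 R)) (a b b' : R) : b <= b' ->
  Linfty_Msym Omega a b `<=` Linfty_Msym Omega a b'.
Proof.
move=> bb' A [mA bA MA]; split => //.
apply: filterS MA => x h Ox; have [sA hA] := h Ox; split => // y.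
have /andP[-> h2] := hA y; apply: le_trans h2 _; apply: ler_wpM2r => //.
by apply: sumr_ge0 => i _; exact: sqr_ge0.
Qed.

Lemma bounded_set_norm_le (R : realType) (Omega : set (R3 R)) : bounded_set Omega ->
  exists2 r : R, 0 <= r & forall x, Omega x -> `|x| <= r.
Proof.
move=> [M [_ hM]]; exists (Num.max 0 (M + 1)); first by rewrite le_max lexx.
by move=> x Ox; apply: (hM (Num.max 0 (M + 1))) => //; rewrite lt_max ltrDl ltr01 orbT.
Qed.

Theorem corollary2p11 (R : realType) (Omega : set (R3 R))
    (alpha0 beta0 : R) :
  lipschitz_domain Omega ->
  0 < alpha0 ->
  (beta_min Omega alpha0 < beta0%:E)%E ->
  0 < omega_star Omega alpha0 beta0 /\
  exists eps mu : R3 R -> 'M[R]_3,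
    [/\ Linfty_Msym Omega alpha0 beta0 eps,
        Linfty_Msym Omega alpha0 beta0 mu &
        maxwell_eigenvalue Omega eps mu (omega_star Omega alpha0 beta0)%:C].
Proof.
move=> [_ /bounded_set_norm_le[r r0 Or] oOmega _ _] a0 /ereal_inf_lt[_ [b [ab [eps [mu [Le Lm [w1 w1n0 ev1]]]]]] <-].
rewrite lte_fin => bb0.
have ab0 : alpha0 < beta0 by exact: lt_trans bb0.
have b0 : 0 < beta0 by exact: lt_trans ab0.
rewrite /omega_star; set S := [set w : R | _]; set w := inf S.
have SP t : S t <-> 0 < t /\ exists E C H D, real_eigen Omega alpha0 beta0 t E C H D.
  split=> [[t0 [e [m [Le' Lm' ev]]]]|[t0 [E [C [H [D h]]]]]]; split => //.
    rewrite -(gtr0_norm t0); apply: (maxwell_real_eigen oOmega Or ab0 _ Le' Lm' ev).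
    by rewrite gt_eqF.
  exact: (real_eigen_maxwell oOmega Or (ltW a0) ab0 h).
(* The definition of [beta_min] provides a nonzero eigenvalue [w1], possibly negative, for some
   [b < beta0]. Its coefficients are admissible for [beta0] as well, and the reduction to real
   fields yields the frequency [|w1|]. *)
have S0 : S !=set0.
  exists `|w1|; apply/SP; split; first by rewrite normr_gt0.
  apply: (maxwell_real_eigen oOmega Or ab0 w1n0 _ _ ev1).
    by move: Le; apply: Linfty_Msym_mono; exact: ltW.
  by move: Lm; apply: Linfty_Msym_mono; exact: ltW.
pose l := alpha0 / ((2 * r + 1) * beta0 ^+ 2).
have l0 : 0 < l by rewrite divr_gt0// mulr_gt0 ?exprn_gt0// ltr_wpDl// mulr_ge0.
have Sl : lbound S l.
  move=> t /SP[t0 [E [C [H [D h]]]]].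
  exact: (real_eigen_lower_bound oOmega r0 Or a0 ab0 t0 h).
have hl : has_lbound S by exists l.
have w0 : 0 < w by apply: lt_le_trans l0 _; exact: lb_le_inf.
split => //.
have adh (n : nat) : exists t, S t /\ t < w + n.+1%:R^-1.
  have n0 : 0 < n.+1%:R^-1 :> R by rewrite invr_gt0.
  by have [t St tw] := inf_adherent n0 (conj S0 hl); exists t.
have [wn hwn] := choice adh.
have wwn n : w <= wn n by apply: ge_inf => //; case: (hwn n).
have wnw n : wn n <= w + n.+1%:R^-1 by case: (hwn n) => _ /ltW.
have wn_cvg : wn n @[n --> \oo] --> w.
  apply: (@squeeze_cvgr _ _ _ _ (cst w) (fun n => w + n.+1%:R^-1)).
  - by apply: nearW => n; rewrite wwn wnw.
  - exact: cvg_cst.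
  - rewrite -[X in _ --> X]addr0; apply: cvgD; first exact: cvg_cst.
    exact: cvg_harmonic.
have wnW n : 0 < wn n <= w + 1.
  rewrite (lt_le_trans w0 (wwn n))/=; apply: le_trans (wnw n) _.
  by rewrite lerD2l invf_le1// ler1n.
have wnE n : exists E C H D, real_eigen Omega alpha0 beta0 (wn n) E C H D.
  by have [/SP[]] := hwn n.
have [E [C [H [D h]]]] := real_eigen_closed oOmega Or a0 ab0 w0 wnW wn_cvg wnE.
exact: (real_eigen_maxwell oOmega Or (ltW a0) ab0 h).
Qed.
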